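(* Let $$r_{13} = 68873,\quad r_{15} = 6018,\quad r_{19} = 336944,\quad r_{21} = 7009,$$ $$r_{25} = 2209439,\quad r_{27} = 16503,\quad r_{33} = 120378,\quad r_{39} = 84079.$$ For each $w \in \{13, 15, 19, 21, 25, 27, 33, 39\}$ and for every admissible integer $r \ge r_w$ (that is, every $r \ge r_w$ with $r \equiv 0$ or $w+1 \pmod 3$), there exists a $\mathrm{PENT}(3,r,w)$ of type D.
   Context: A partial linear space is a (finite) set of points together with a set of lines, each line identified with the set of points incident with it, such that two distinct points lie on at most one common line. Two points are collinear if some line contains both (so a point that lies on a line is collinear with itself). A Steiner system $S(2,k,w)$ is a set of $w$ points with a collection of $k$-subsets (blocks) such that each pair of distinct points is contained in exactly one block. A generalized pentagonal geometry $\mathrm{PENT}(k,r,w)$ is a partial linear space in which every line has exactly $k$ points, every point is on exactly $r$ lines, and for every point $x$ the set of points not collinear with $x$ has size $w$ and is the point set of a Steiner system $S(2,k,w)$, denoted $x^{\mathrm{opp}}$, whose blocks are lines of the geometry. Its deficiency graph has the points of the geometry as vertices, with $x \sim y$ precisely when $x$ and $y$ are not collinear. Given $k$ and $w$, $r$ is admissible if $r(w+1-r) \equiv 0 \pmod k$. An opposite design pair in a $\mathrm{PENT}(k,r,w)$ is a pair of Steiner systems $S(2,k,w)$ with disjoint point sets, whose blocks are lines of the geometry, such that for each point $x$ of either system, $x^{\mathrm{opp}}$ is the other system. A generalized pentagonal geometry is of type D if its deficiency graph is not connected and has girth $4$, and the geometry does not contain an opposite design pair. *)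

(* Defs.v *)
From mathcomp Require Import all_boot all_order all_algebra.

Set Implicit Arguments.
Unset Strict Implicit.
Unset Printing Implicit Defensive.

Record partial_linear_space := PartialLinearSpace {
  pls_point : finType;
  pls_lines : {set {set pls_point}};
  pls_axiom : forall (x y : pls_point) (l m : {set pls_point}),
    x != y -> l \in pls_lines -> m \in pls_lines ->
    x \in l -> y \in l -> x \in m -> y \in m -> l = m
}.

Definition collinear (G : partial_linear_space) : rel (pls_point G) :=
  fun x y => [exists l in pls_lines G, (x \in l) && (y \in l)].

(* Also the edge relation of the deficiency graph.  It is irreflexive as soon
   as every point lies on a line. *)
Definition noncollinear (G : partial_linear_space) : rel (pls_point G) :=
  fun x y => ~~ collinear x y.

(* The Steiner system S(2,k,w) with point set X and block set B. *)
Definition steiner_system (T : finType) (k w : nat)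
    (X : {set T}) (B : {set {set T}}) : Prop :=
  [/\ #|X| = w,
      (forall b, b \in B -> b \subset X /\ #|b| = k) &
      (forall x y, x \in X -> y \in X -> x != y ->
         exists! b, [/\ b \in B, x \in b & y \in b])].

(* (X, B) is x^opp.  For 2 <= k there is at most one such pair, B being then
   the set of all lines contained in X, because two points lie on at most one
   line. *)
Definition is_opp (G : partial_linear_space) (k w : nat) (x : pls_point G)
    (X : {set pls_point G}) (B : {set {set pls_point G}}) : Prop :=
  [/\ X = [set y | noncollinear x y],
      B \subset pls_lines G & steiner_system k w X B].

Definition is_pent (k r w : nat) (G : partial_linear_space) : Prop :=
  [/\ (forall l, l \in pls_lines G -> #|l| = k),
      (forall x : pls_point G, #|[set l in pls_lines G | x \in l]| = r) &
      (forall x : pls_point G, exists X B, is_opp k w x X B)].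

Definition opposite_design_pair (G : partial_linear_space) (k w : nat)
    (X : {set pls_point G}) (BX : {set {set pls_point G}})
    (Y : {set pls_point G}) (BY : {set {set pls_point G}}) : Prop :=
  [/\ steiner_system k w X BX /\ steiner_system k w Y BY,
      [disjoint X & Y],
      BX \subset pls_lines G /\ BY \subset pls_lines G,
      (forall x, x \in X -> is_opp k w x Y BY) &
      (forall y, y \in Y -> is_opp k w y X BX)].

(* A cycle of a graph is a cyclic sequence of at least 3 distinct vertices;
   without the lower bound, [ucycle e] also accepts the empty sequence and, for
   symmetric e, every edge. *)
Definition graph_cycle (T : finType) (e : rel T) (c : seq T) : Prop :=
  ucycle e c /\ 3 <= size c.

Definition has_girth (T : finType) (e : rel T) (g : nat) : Prop :=
  (exists2 c, graph_cycle e c & size c = g) /\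
  (forall c, graph_cycle e c -> g <= size c).

Definition graph_connected (T : finType) (e : rel T) : Prop :=
  forall x y : T, connect e x y.

Definition type_D (k r w : nat) (G : partial_linear_space) : Prop :=
  [/\ is_pent k r w G,
      ~ graph_connected (@noncollinear G),
      has_girth (@noncollinear G) 4 &
      ~ exists X BX Y BY, @opposite_design_pair G k w X BX Y BY].

(* The difference is taken in int, since r may exceed w + 1. *)
Definition admissible (k w r : nat) : Prop :=
  (r%:Z * (w%:Z + 1 - r%:Z) = 0 %[mod k%:Z])%Z.

(* Main.v *)
Require Import Defs.
From Stdlib Require Import BinNat FMapPositive.
From mathcomp Require Import all_boot all_order all_algebra.
From mathcomp Require Import zify.

Set Implicit Arguments.
Unset Strict Implicit.
Unset Printing Implicit Defensive.

(* A PENT(3,r,w) has v = 2r + w + 1 points, and r is admissible iff v is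
   congruent to 0 or w + 1 modulo 3.  If the groups of a 3-GDD of type g^t u^1
   are filled with systems on g and u points, the deficiency graph of the
   result is the disjoint union of the deficiency graphs of the parts; so it is
   disconnected, has no component K_{w,w} if the parts have none, and has
   girth 4 as soon as one part does (a deficiency graph is triangle-free,
   because two points of x^opp are collinear).  3-GDDs of type g^3 u^1 and
   g^4 u^1 come from a transversal design over Z_h whose parallel classes are
   inflated by small 3-GDDs (Wilson's construction).  Small systems come from
   cyclic designs, and from inflating every point of a PENT(3,r,w) to a copy of
   an STS(3), STS(7) or STS(13).  From these, finitely many applications of the
   filling construction reach an interval of sizes v that is long enough for
   g^3 u^1 alone to produce all larger ones. *)

(** * Partial triple systems and type D *)

(** Sizes v, rather than r, are the working parameter because they add up under filling: v = t g +
    u. For the odd w at hand, admissibility of r means that v is 0 or c modulo 6, where c is 2 or 4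
    and congruent to w + 1 modulo 3. All groups filled have size g = 6a, so filling preserves the
    residue of u; one seed in class c is therefore enough once plenty of multiples of 6 are known.
    The obstacle is arithmetical: parallel classes over Z_h need 2 to be a unit modulo h for three
    groups, and 2 and 3 to be units for four groups. So a must be odd, and for four groups also
    prime to 3. In a size 3(6a) + u the first term then moves in steps of 36, which is why runs of
    six consecutive values of u/6 are needed to reach everything. Type D is reduced to local
    conditions on the parts: a 4-cycle in the systems placed on the groups of size g, and, at every
    point x, two points of x^opp with different opposite sets. *)

(* [f x y] is the third point of the line through [x] and [y], and [None] if
   [x = y] or if [x] and [y] are not collinear. *)
Definition triple_system (T : finType) (f : T -> T -> option T) : Prop :=
  (forall x, f x x = None) /\
  (forall x y z, f x y = Some z -> f y x = Some z /\ f x z = Some y).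

Definition opposite (T : finType) (f : T -> T -> option T) (x : T) : {set T} :=
  [set y | (y != x) && (f x y == None)].

(** The last clause closes x^opp under third points, which is what makes the lines inside it a
    Steiner system. For w = 0 any two distinct points are collinear, so this is a Steiner triple
    system on [T]. *)
Definition pentagonal (w : nat) (T : finType) (f : T -> T -> option T) : Prop :=
  [/\ triple_system f, (forall x, #|opposite f x| = w) &
      forall x y z, y \in opposite f x -> z \in opposite f x -> y != z ->
        exists2 u, f y z = Some u & u \in opposite f x].

(** In an opposite design pair all points of x^opp share one opposite set. Denying this at every
    point, and not just once, gives a condition that passes to fillings and inflations and that a
    cyclic system needs to satisfy at one point per orbit only. *)
Definition no_opp_pair (T : finType) (f : T -> T -> option T) : Prop :=
  forall x, exists y z, [/\ y \in opposite f x, z \in opposite f x & opposite f y != opposite f z].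

Definition has_4cycle (T : finType) (f : T -> T -> option T) : Prop :=
  exists x y a b,
    [/\ x != y, a != b, a \in opposite f x, b \in opposite f x &
        a \in opposite f y /\ b \in opposite f y].

(** [D] is a union of components, neither empty nor everything; in a filled design it will be one
    group. *)
Definition opp_disconnected (T : finType) (f : T -> T -> option T) : Prop :=
  exists (D : {set T}) (x y : T), [/\ x \in D, y \notin D &
    forall a b, b \in opposite f a -> (a \in D) = (b \in D)].

Section TripleSystem.
Variables (T : finType) (f : T -> T -> option T).
Hypothesis fT : triple_system f.

Lemma ts_irrefl x : f x x = None. Proof. by case: fT. Qed.

Lemma ts_sym x y : f x y = f y x.
Proof.
case Exy: (f x y) => [z|]; first by case: (fT.2 _ _ _ Exy).
by case Eyx: (f y x) => [z|] //; case: (fT.2 _ _ _ Eyx); rewrite Exy.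
Qed.

Lemma ts_swap x y z : f x y = Some z -> f x z = Some y.
Proof. by case/(fT.2 _ _ _). Qed.

Lemma ts_rot x y z : f x y = Some z -> f y z = Some x.
Proof. by rewrite ts_sym; apply: ts_swap. Qed.

Lemma ts_neq x y z : f x y = Some z -> [/\ x != y, x != z & y != z].
Proof.
move=> E; split; apply/eqP => H.
- by move: E; rewrite H ts_irrefl.
- by move: (ts_swap E); rewrite H ts_irrefl.
- by move: (ts_rot E); rewrite H ts_irrefl.
Qed.

Lemma opp_sym x y : (y \in opposite f x) = (x \in opposite f y).
Proof. by rewrite !inE eq_sym ts_sym. Qed.

Definition line_through (x y : T) : {set T} :=
  if f x y is Some z then [set x; y; z] else set0.

Definition lines : {set {set T}} :=
  [set line_through p.1 p.2 | p : T * T & isSome (f p.1 p.2)].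

Lemma linesP l : reflect (exists x y z, f x y = Some z /\ l = [set x; y; z])
                         (l \in lines).
Proof.
apply: (iffP imsetP) => [[[x y]]|[x [y [z [E ->]]]]].
  rewrite inE /line_through /=; case E: (f x y) => [z|] // _ ->.
  by exists x, y, z.
by exists (x, y); rewrite ?inE /line_through /= E.
Qed.

(** The values of [f] on the six ordered pairs from a triple follow from one of them by swaps and
    rotations, so any two points of a line recover all of it. *)
Lemma in_line l x y : l \in lines -> x \in l -> y \in l -> x != y ->
  exists2 z, f x y = Some z & l = [set x; y; z].
Proof.
case/linesP=> a [b [c [E ->]]]; rewrite !inE -!orbA.
have E1 := ts_swap E; have E2 := ts_rot E; have E3 := ts_rot E2.
have E4 := ts_rot E1; have E5 := ts_rot E4.
by move=> /or3P[] /eqP-> /or3P[] /eqP->; rewrite ?eqxx //= => _;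
  [exists c|exists b|exists c|exists a|exists b|exists a] => //;
  apply/setP=> s; rewrite !inE; do 3 case: eqP.
Qed.

Lemma lines_card3 l : l \in lines -> #|l| = 3.
Proof.
case/linesP=> x [y [z [E ->]]]; have [xy xz yz] := ts_neq E.
by rewrite -setUA cardsU1 cards2 !inE negb_or xy xz yz.
Qed.

Lemma lines_unique (x y : T) l m : x != y -> l \in lines -> m \in lines ->
  x \in l -> y \in l -> x \in m -> y \in m -> l = m.
Proof.
move=> xy lL mL xl yl xm ym.
have [z E ->] := in_line lL xl yl xy.
by have [z' E' ->] := in_line mL xm ym xy; move: E'; rewrite E => -[->].
Qed.

Definition pls : partial_linear_space := PartialLinearSpace lines_unique.

Lemma line_through_in x y : isSome (f x y) -> line_through x y \in lines.
Proof. by move=> xy; apply/imsetP; exists (x, y); rewrite ?inE. Qed.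

Lemma line_throughL x y : isSome (f x y) -> x \in line_through x y.
Proof. by rewrite /line_through; case: (f x y) => // z _; rewrite !inE eqxx. Qed.

Lemma line_throughR x y : isSome (f x y) -> y \in line_through x y.
Proof.
by rewrite /line_through; case: (f x y) => // z _; rewrite !inE eqxx orbT.
Qed.

(** Sending y to the line through x and y has as fibres the lines through x with x removed, each of
    size 2. *)
Lemma card_lines_through x :
  (#|[set l in lines | x \in l]|.*2)%N = #|[set y | isSome (f x y)]|.
Proof.
rewrite -[RHS]sum1_card.
rewrite (partition_big (line_through x) (mem [set l in lines | x \in l])) /=;
  last first.
  by move=> y; rewrite !inE => xy; rewrite line_through_in ?line_throughL.
rewrite -muln2 -sum_nat_const; apply: eq_bigr => l; rewrite inE => /andP[lL xl].
have /eqP : #|l :\ x| = 2.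
  by have := cardsD1 x l; rewrite xl lines_card3 // => -[].
rewrite sum1_card => /eqP {1}<-; apply: eq_card => y; rewrite !inE.
apply/andP/andP => [[yx yl]|[xy /eqP <-]].
  have [|z E ->] := in_line lL xl yl; first by rewrite eq_sym.
  by rewrite inE /line_through E.
have [] : x != y /\ y \in line_through x y.
  move: xy; rewrite inE => xy; split; last exact: line_throughR.
  by apply/eqP => e; move: xy; rewrite e ts_irrefl.
by rewrite eq_sym.
Qed.

End TripleSystem.

(** * From local properties of the operation to type D *)

Section TypeD.
Variables (w r : nat) (T : finType) (f : T -> T -> option T).
Hypotheses (fP : pentagonal w f) (w_gt0 : 0 < w) (r_gt0 : 0 < r).
Hypothesis cardT : #|T| = (r.*2 + w).+1.

Let fT : triple_system f. Proof. by case: fP. Qed.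
Notation G := (pls fT).

Lemma card_collinear x : #|[set y | isSome (f x y)]| = r.*2.
Proof.
have [_ /(_ x) cx _] := fP.
have := cardsC (x |: opposite f x); rewrite cardsU1 inE eqxx cx cardT => H.
have -> : [set y | isSome (f x y)] = ~: (x |: opposite f x).
  apply/setP => y; rewrite !inE negb_or negb_and negbK.
  case: eqP => [->|] /=; first by rewrite ts_irrefl.
  by case: (f x y).
by lia.
Qed.

(** The case y = x requires that x lie on some line, so that it is collinear with itself; [r_gt0]
    provides one. *)
Lemma noncollinear_opp x : [set y | @noncollinear G x y] = opposite f x.
Proof.
apply/setP => y; rewrite !inE /noncollinear /collinear /=.
case: eqVneq => [->|yx] /=.
  have : 0 < #|[set y | isSome (f x y)]| by rewrite card_collinear; lia.
  case/card_gt0P => z; rewrite inE => xz; apply/negbTE; rewrite negbK.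
  by apply/existsP; exists (line_through f x z);
    rewrite line_through_in ?line_throughL.
apply/idP/eqP => [|xy].
  apply: contraNeq => xy; apply/existsP; exists (line_through f x y).
  have xyS : isSome (f x y) by case: (f x y) xy.
  by rewrite line_through_in ?line_throughL ?line_throughR.
apply/negP => /existsP[l /and3P[lL xl yl]].
have [|z E _] := in_line fT lL xl yl; first by rewrite eq_sym.
by rewrite E in xy.
Qed.

Lemma is_pent_pls : is_pent 3 r w G.
Proof.
split=> [l|x|x]; first exact: lines_card3.
  by apply: double_inj; rewrite card_lines_through // card_collinear.
(* The blocks are all lines contained in x^opp; the closure clause of [pentagonal] keeps the third
   point inside. *)
exists (opposite f x), [set l in lines f | l \subset opposite f x].
split; first by rewrite noncollinear_opp.
  by apply/subsetP => l; rewrite inE => /andP[].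
have [_ /(_ x) cx oppP] := fP.
split=> // [l|y z yx zx yz].
  by rewrite inE => /andP[lL lx]; split=> //; apply: (lines_card3 fT).
have [u E ux] := oppP x y z yx zx yz.
exists [set y; z; u]; split.
  split; rewrite ?inE ?eqxx ?orbT //.
  apply/andP; split; first by apply/linesP; exists y, z, u.
  by apply/subsetP => s; rewrite !inE -orbA => /or3P[] /eqP->;
     move: yx zx ux; rewrite !inE.
move=> l [+ yl zl]; rewrite inE => /andP[lL _].
by have [u' E' ->] := in_line fT lL yl zl yz; move: E'; rewrite E => -[->].
Qed.

Hypotheses (f4 : has_4cycle f) (fD : opp_disconnected f) (fK : no_opp_pair f).

Lemma type_D_pls : type_D 3 r w G.
Proof.
have ncE x y : @noncollinear G x y = (y \in opposite f x).
  by rewrite -noncollinear_opp inE.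
split; first exact: is_pent_pls.
(* [D] is closed under adjacency, so a path starting in it never reaches y. *)
- case: fD => D [x [y [xD /negP yD Dcl]]] /(_ x y) /connectP[p xp yE].
  apply: yD; rewrite {}yE.
  elim: p x xp xD => //= z p IH x /andP[xz zp] xD; apply: IH zp _.
  by rewrite -(Dcl x) // -ncE.
- split.
    case: f4 => x [y [a [b [xy ab ax bx [ay byy]]]]].
    exists [:: x; a; y; b] => //; split=> //; apply/andP; split.
      rewrite /= !ncE ax byy (opp_sym fT a) ay (opp_sym fT b) bx //.
    have neq s t : s \in opposite f t -> s != t by rewrite inE => /andP[].
    rewrite /= !inE !negb_or xy ab !andbT.
    by rewrite (eq_sym x a) (eq_sym x b) (eq_sym y b) !neq.
  (* A triangle x, y, z would put y and z into [opposite f x], hence on a common line, although they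
     are adjacent. *)
  move=> c [] /andP[cc uc]; rewrite leq_eqVlt => /orP[/eqP c3|//].
  case: c c3 cc uc => [|x [|y [|z [|? ?]]]] //= _.
  rewrite !ncE => /and4P[xy yz zx _] /and3P[_ + _].
  rewrite mem_seq1 => nyz.
  have [_ _ oppP] := fP.
  have [|//|u] := oppP x y z xy; first by rewrite (opp_sym fT).
  by move: yz; rewrite inE => /andP[_ /eqP->].
(* For x in X the two points given by [fK] lie in x^opp = Y, so both would have X as their opposite
   set. *)
case=> X [BX [Y [BY [[[cX _ _] _] _ _ XY YX]]]].
have /card_gt0P[x xX] : 0 < #|X| by rewrite cX.
case: (XY x xX) => YE _ _; rewrite noncollinear_opp in YE.
have [y [z [yx zx]]] := fK x; rewrite -YE in yx zx.
case: (YX y yx) => X1 _ _; case: (YX z zx) => X2 _ _.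
by rewrite -!noncollinear_opp -X1 -X2 eqxx.
Qed.

End TypeD.

(** * Group divisible designs *)

Definition gdd (T : finType) (J : eqType) (gr : T -> J)
    (f : T -> T -> option T) : Prop :=
  triple_system f /\ forall x y, (f x y == None) = (gr x == gr y).

Definition transport (T T' : Type) (e : T' -> T) (e' : T -> T')
    (f : T -> T -> option T) (x y : T') : option T' :=
  omap e' (f (e x) (e y)).

Lemma transport_ts (T T' : finType) (e : T' -> T) (e' : T -> T')
    (f : T -> T -> option T) :
  cancel e' e -> cancel e e' -> triple_system f ->
  triple_system (transport e e' f).
Proof.
move=> eK e'K fT; split=> [x|x y z]; rewrite /transport ?ts_irrefl //.
case E: (f (e x) (e y)) => [u|] //= [<-].
by rewrite (ts_sym fT) E eK (ts_swap fT E) /= e'K.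
Qed.

Lemma transport_gdd (T T' : finType) (J : eqType) (gr : T -> J)
    (e : T' -> T) (e' : T -> T') (f : T -> T -> option T) :
  cancel e' e -> cancel e e' -> gdd gr f -> gdd (gr \o e) (transport e e' f).
Proof.
move=> eK e'K [fT fgr]; split; first exact: transport_ts.
by move=> x y /=; rewrite -fgr /transport; case: (f _ _).
Qed.

(* Type g^t u^1: the points of [U] form the last group. *)
Definition group_of (t : nat) (G U : Type) (p : 'I_t * G + U) : option 'I_t :=
  if p is inl q then Some q.1 else None.

Definition has_gdd (t g u : nat) : Prop :=
  exists f, gdd (@group_of t 'I_g 'I_u) f.

(** [has_gdd] lives on ordinals so that only the sizes matter; bijections carry the design to
    whatever point sets are to be filled. [has_gdd_of] is the way back. *)
Lemma has_gdd_on (t g u : nat) (G U : finType) :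
  #|G| = g -> #|U| = u -> has_gdd t g u ->
  exists f, gdd (@group_of t G U) f.
Proof.
move=> <- <- [f fP].
pose e (p : 'I_t * G + U) : 'I_t * 'I_#|G| + 'I_#|U| :=
  match p with inl q => inl (q.1, enum_rank q.2) | inr v => inr (enum_rank v) end.
pose e' (p : 'I_t * 'I_#|G| + 'I_#|U|) : 'I_t * G + U :=
  match p with inl q => inl (q.1, enum_val q.2) | inr v => inr (enum_val v) end.
have eK : cancel e' e by case=> [[i a]|v]; rewrite /= enum_valK.
have e'K : cancel e e' by case=> [[i a]|v]; rewrite /= enum_rankK.
exists (transport e e' f).
have [fT fgr] := transport_gdd eK e'K fP; split=> // x y; rewrite fgr.
by case: x y => [[? ?]|?] [[? ?]|?].
Qed.

(** * Filling the groups of a group divisible design *)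

Section Fill.
Variables (w t : nat) (G U : finType).
Variable F : 'I_t * G + U -> 'I_t * G + U -> option ('I_t * G + U).
Variables (fG : G -> G -> option G) (fU : U -> U -> option U).
Hypotheses (FP : gdd (@group_of t G U) F).
Hypotheses (GP : pentagonal w fG) (UP : pentagonal w fU).

Definition fill (x y : 'I_t * G + U) : option ('I_t * G + U) :=
  match x, y with
  | inl (i, a), inl (j, b) =>
      if i == j then omap (fun c => inl (i, c)) (fG a b) else F x y
  | inr u, inr v => omap inr (fU u v)
  | _, _ => F x y
  end.

Let FT := FP.1.
Let Fgr := FP.2.
Let GT : triple_system fG. Proof. by case: GP. Qed.
Let UT : triple_system fU. Proof. by case: UP. Qed.

Lemma fill_ts : triple_system fill.
Proof.
(* The points of a GDD line lie in three different groups, so permuting them never leaves the branch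
   of [fill] that uses [F]. *)
have Fdiff x y z : F x y = Some z ->
    [/\ group_of x != group_of y, group_of x != group_of z &
        group_of y != group_of z].
  move=> E; have E1 := ts_swap FT E; have E2 := ts_rot FT E.
  by rewrite -!Fgr E E1 E2.
have fillF x y : group_of x != group_of y -> fill x y = F x y.
  by case: x y => [[i a]|u] [[j b]|v] //= /negbTE; rewrite -[Some i == _]/(i == j) => ->.
have F_case x y z : group_of x != group_of y -> fill x y = Some z ->
    fill y x = Some z /\ fill x z = Some y.
  move=> xy; rewrite fillF // => E; have [_ xz yz] := Fdiff _ _ _ E.
  by rewrite !fillF // 1?eq_sym // (ts_sym FT) E (ts_swap FT E).
split=> [[[i a]|u]|x y z] /=; rewrite ?eqxx ?ts_irrefl //.
case: x y => [[i a]|u] [[j b]|v]; try exact: F_case.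
  case: (eqVneq i j) => [<-|ij]; last by apply: F_case.
  rewrite /= eqxx; case E: (fG a b) => [c|] //= [<-].
  by rewrite eqxx (ts_sym GT) E (ts_swap GT E).
rewrite /=; case E: (fU u v) => [c|] //= [<-].
by rewrite (ts_sym UT) E (ts_swap UT E).
Qed.

(** Points of different groups are collinear already in the GDD, so no edge of the deficiency graph
    leaves a group. *)
Lemma opp_fill_inl i a : opposite fill (inl (i, a)) = [set inl (i, c) | c in opposite fG a].
Proof.
apply/setP => y; rewrite inE; apply/andP/imsetP => [[yx]|[c + ->]].
  case: y yx => [[j b]|v] yx /=.
    case: (eqVneq i j) yx => [<-|ij] yx E; last first.
      by move: E; rewrite Fgr => /eqP[] /eqP; rewrite (negbTE ij).
    exists b => //; rewrite inE; case: (fG a b) E => // _.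
    by rewrite andbT; apply: contraNneq yx => ->.
  by rewrite Fgr.
by rewrite inE => /andP[ca /eqP E]; rewrite /= eqxx E; split=> //; apply: contraNneq ca => -[->].
Qed.

Lemma opp_fill_inr u : opposite fill (inr u) = [set inr v | v in opposite fU u].
Proof.
apply/setP => y; rewrite inE; apply/andP/imsetP => [[yx]|[c + ->]].
  case: y yx => [[j b]|v] yx /=; first by rewrite Fgr.
  move=> E; exists v => //; rewrite inE; case: (fU u v) E => // _.
  by rewrite andbT; apply: contraNneq yx => ->.
by rewrite inE => /andP[ca /eqP E]; rewrite /= E; split=> //; apply: contraNneq ca => -[->].
Qed.

Lemma fill_pentagonal : pentagonal w fill.
Proof.
have [_ cG oG] := GP; have [_ cU oU] := UP.
have injl i : injective (fun c : G => inl (i, c) : 'I_t * G + U) by move=> ? ? [].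
have injr : injective (fun c : U => inr c : 'I_t * G + U) by move=> ? ? [].
split; first exact: fill_ts.
  by case=> [[i a]|u]; rewrite ?opp_fill_inl ?opp_fill_inr card_imset.
case=> [[i a]|u] y z; rewrite ?opp_fill_inl ?opp_fill_inr.
  move=> /imsetP[b ba ->] /imsetP[c ca ->] bc.
  have [|d E da] := oG a b c ba ca; first by apply: contraNneq bc => ->.
  by exists (inl (i, d)); rewrite /= ?eqxx ?E // imset_f.
move=> /imsetP[b ba ->] /imsetP[c ca ->] bc.
have [|d E da] := oU u b c ba ca; first by apply: contraNneq bc => ->.
by exists (inr d); rewrite /= ?E // imset_f.
Qed.

Lemma fill_no_opp_pair : no_opp_pair fG -> no_opp_pair fU -> no_opp_pair fill.
Proof.
have injl i : injective (fun c : G => inl (i, c) : 'I_t * G + U) by move=> ? ? [].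
have injr : injective (fun c : U => inr c : 'I_t * G + U) by move=> ? ? [].
move=> GK UK [[i a]|u].
  have [y [z [ya za yz]]] := GK a.
  exists (inl (i, y)), (inl (i, z)); rewrite !opp_fill_inl !imset_f //; split=> //.
  by rewrite (inj_eq (imset_inj (injl i))).
have [y [z [ya za yz]]] := UK u.
exists (inr y), (inr z); rewrite !opp_fill_inr !imset_f //; split=> //.
by rewrite (inj_eq (imset_inj injr)).
Qed.

Lemma fill_4cycle : 0 < t -> has_4cycle fG -> has_4cycle fill.
Proof.
move=> t0 [x [y [a [b [xy ab ax bx [ay bY]]]]]].
pose i := Ordinal t0.
have ne (p q : G) : p != q -> inl (i, p) != inl (i, q) :> 'I_t * G + U.
  by apply: contraNneq => -[->].
exists (inl (i, x)), (inl (i, y)), (inl (i, a)), (inl (i, b)).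
by rewrite !opp_fill_inl !imset_f // !ne.
Qed.

Lemma fill_disconnected : 1 < t -> 0 < #|G| -> opp_disconnected fill.
Proof.
move=> t1 /card_gt0P[a _].
pose i := Ordinal (ltnW t1); pose j := Ordinal t1.
exists [set x | group_of x == Some i], (inl (i, a)), (inl (j, a)); split;
  rewrite ?inE //.
case=> [[k b]|u] y; rewrite ?opp_fill_inl ?opp_fill_inr => /imsetP[c _ ->];
  by rewrite !inE.
Qed.

End Fill.

(* [blk y] and [pos y] describe the y-th parallel class of a resolvable design
   on [Q]: the block containing a point, and the position of the point there.
   The ingredients of the y-th class share its [n y] infinite points. *)
Section Wilson.
Variables (s : nat) (Q M B Y : finType) (J : eqType) (gq : Q -> J).
Variables (blk : Y -> Q -> B) (pos : Y -> Q -> 'I_s) (pt : Y -> B -> 'I_s -> Q).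
Hypothesis ptK : forall y q, pt y (blk y q) (pos y q) = q.
Hypothesis blk_pt : forall y b c, blk y (pt y b c) = b.
Hypothesis pos_pt : forall y b c, pos y (pt y b c) = c.
Hypothesis blk_ex : forall q q', gq q != gq q' -> exists y, blk y q = blk y q'.
Hypothesis blk_gq : forall y q q', q != q' -> blk y q = blk y q' -> gq q != gq q'.
Hypothesis blk_uniq : forall y y' q q', q != q' ->
  blk y q = blk y q' -> blk y' q = blk y' q' -> y = y'.
Variables (n : Y -> nat).
Let ipt y : finType := ('I_s * M + 'I_(n y))%type.
Variable f : forall y, ipt y -> ipt y -> option (ipt y).
Hypothesis fP : forall y, gdd (@group_of s M 'I_(n y)) (@f y).

Let wpt : finType := (Q * M + {y : Y & 'I_(n y)})%type.

(** The copy of the y-th ingredient over the block b: its finite points spread over b, while its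
    infinite points are common to all blocks of the class. *)
Definition wlift y (b : B) (p : ipt y) : wpt :=
  match p with
  | inl (c, a) => inl (pt y b c, a)
  | inr v => inr (Tagged (fun y => 'I_(n y)) v)
  end.

Definition wproj y (x : Q * M) : ipt y := inl (pos y x.1, x.2).

(** [pick] has at most one candidate, by [blk_uniq]. An infinite point carries its class as a tag,
    which together with a finite point determines the block. *)
Definition wilson (x x' : wpt) : option wpt :=
  match x, x' with
  | inl p, inl q =>
      if [pick y | (gq p.1 != gq q.1) && (blk y p.1 == blk y q.1)] is Some y
      then omap (wlift (blk y p.1)) (f (wproj y p) (wproj y q)) else None
  | inl p, inr u => omap (wlift (blk (tag u) p.1))
                         (f (wproj (tag u) p) (inr (tagged u)))
  | inr u, inl p => omap (wlift (blk (tag u) p.1))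
                         (f (inr (tagged u)) (wproj (tag u) p))
  | inr _, inr _ => None
  end.

Definition wgroup (x : wpt) : option J := if x is inl p then Some (gq p.1) else None.

(** Consistency of the gluing: two points of an ingredient in different groups belong to no other
    ingredient, since distinct points of Q share at most one block over all classes. *)
Lemma wilson_lift y b (p p' : ipt y) : group_of p != group_of p' ->
  wilson (wlift b p) (wlift b p') = omap (wlift b) (f p p').
Proof.
case: p p' => [[c a]|v] [[c' a']|v'] //= cc';
  rewrite /wproj /= ?pos_pt ?blk_pt //.
have qq : pt y b c != pt y b c'.
  by apply: contraNneq cc' => /(congr1 (pos y)); rewrite !pos_pt => ->.
have ee : blk y (pt y b c) = blk y (pt y b c') by rewrite !blk_pt.
case: pickP => [y' /andP[_ /eqP]|/(_ y)]; last by rewrite ee eqxx (blk_gq qq ee).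
by move/(blk_uniq qq ee) => <-; rewrite !pos_pt blk_pt.
Qed.

(** The covering half of the gluing. With [wilson_lift] it moves every GDD axiom into a single
    ingredient. *)
Lemma wilson_local (x x' : wpt) : wgroup x != wgroup x' ->
  exists y b (p p' : ipt y),
    [/\ x = wlift b p, x' = wlift b p' & group_of p != group_of p'].
Proof.
case: x x' => [[q a]|[y v]] [[q' a']|[y' v']] //= qq.
- have [y yy] : exists y, blk y q = blk y q' by exact: blk_ex.
  exists y, (blk y q), (wproj y (q, a)), (wproj y (q', a')).
  rewrite /= {2}yy !ptK; split=> //.
  (* Equal positions in the same block would make q and q' the same point. *)
  apply: contraNneq qq => -[pp].
  by rewrite -(ptK y q) yy pp ptK.
- exists y', (blk y' q), (wproj y' (q, a)), (inr v'); split=> //.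
  by rewrite /= ptK.
- exists y, (blk y q'), (inr v), (wproj y (q', a')); split=> //.
  by rewrite /= ptK.
Qed.

Lemma wilson_gdd : gdd wgroup wilson.
Proof.
have Nsame x x' : wgroup x = wgroup x' -> wilson x x' = None.
  case: x x' => [[q a]|u] [[q' a']|u'] //= [->].
  by case: pickP => // y; rewrite eqxx.
split; last first.
  move=> x x'; case: (eqVneq (wgroup x)) => [/Nsame->//|/wilson_local].
  case=> y [b [p [p' [-> -> pp]]]]; rewrite wilson_lift //.
  by have := (fP y).2 p p'; rewrite (negbTE pp); case: (f _ _).
split=> [x|x x' z]; first exact: Nsame.
case: (eqVneq (wgroup x) (wgroup x')) => [/Nsame->//|/wilson_local].
case=> y [b [p [p' [-> -> pp]]]]; rewrite wilson_lift //.
have [fT fgr] := fP y.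
case E: (f p p') => [r|] //= [<-].
have E1 := ts_swap fT E; have pr : group_of p != group_of r by rewrite -fgr E1.
by rewrite wilson_lift 1?eq_sym // (ts_sym fT) E wilson_lift // E1.
Qed.

End Wilson.

Lemma has_gdd_of (t : nat) (G U : finType) f :
  gdd (@group_of t G U) f -> has_gdd t #|G| #|U|.
Proof.
move=> fP.
pose e (p : 'I_t * G + U) : 'I_t * 'I_#|G| + 'I_#|U| :=
  match p with inl q => inl (q.1, enum_rank q.2) | inr v => inr (enum_rank v) end.
pose e' (p : 'I_t * 'I_#|G| + 'I_#|U|) : 'I_t * G + U :=
  match p with inl q => inl (q.1, enum_val q.2) | inr v => inr (enum_val v) end.
have eK : cancel e' e by case=> [[i a]|v]; rewrite /= enum_valK.
have e'K : cancel e e' by case=> [[i a]|v]; rewrite /= enum_rankK.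
exists (transport e' e f).
have [fT fgr] := transport_gdd e'K eK fP; split=> // x y; rewrite fgr.
by case: x y => [[? ?]|?] [[? ?]|?].
Qed.

(** * Transversal designs over a cyclic group *)

Section TransversalDesign.
Import GRing.Theory.
Local Open Scope ring_scope.

Lemma coprime_mulrn_inj (h d : nat) : coprime d h.+1 ->
  injective (fun y : 'I_h.+1 => y *+ d).
Proof.
move=> cdh y y' E; apply/eqP; rewrite -subr_eq0; apply/eqP.
have : (y - y') *+ d = 0 by rewrite mulrnBl E subrr.
move: (y - y') => z; rewrite Zp_mulrn => /(congr1 val) /= zd0.
have : (h.+1 %| z * d)%N by rewrite /dvdn zd0.
rewrite Gauss_dvdl 1?coprime_sym // /dvdn modn_small // => /eqP z0.
exact: val_inj.
Qed.

(** The block with intercept b in the class y is the line of slope y, consisting of the points (i, b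
    + y i). Two points in columns i and j determine y (i - j), so the slope exists and is unique
    because i - j is a unit modulo [h.+1]; this is what [cop] ensures. Each class y is a partition
    of the points, so it can be given its own number of infinite points. *)
Lemma has_gdd_td (t h m : nat) (n : 'I_h.+1 -> nat) :
  (forall d : nat, (0 < d < t)%N -> coprime d h.+1) ->
  (forall y, has_gdd t m (n y)) -> has_gdd t (h.+1 * m)%N (\sum_y n y)%N.
Proof.
move=> cop ingr.
have {ingr} [f fP] := fin_all_exists ingr.
pose A := 'I_h.+1.
(* Injectivity gives uniqueness of the slope and, [A] being finite, also its existence. *)
have inj (i j : 'I_t) : i != j -> injective (fun y : A => y *+ i - y *+ j).
  wlog ij : i j / (i < j)%N => [H|_].
    rewrite neq_ltn => /orP[] ij; first by apply: H => //; rewrite neq_ltn ij.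
    move=> y y' E; apply: (H j i ij); rewrite ?neq_ltn ?ij //.
    by rewrite -[LHS]opprB -[RHS]opprB E.
  move=> y y' E; apply: (@coprime_mulrn_inj h (j - i)).
    by apply: cop; rewrite subn_gt0 ij (leq_ltn_trans (leq_subr _ _)).
  by rewrite !mulrnBr ?(ltnW ij) // -[LHS]opprB -[RHS]opprB E.
pose blk (y : A) (q : 'I_t * A) : A := q.2 - y *+ q.1.
pose pos (y : A) (q : 'I_t * A) := q.1.
pose pt (y : A) (b : A) (i : 'I_t) : 'I_t * A := (i, b + y *+ i).
have blkE y q q' : (blk y q = blk y q') -> y *+ q.1 - y *+ q'.1 = q.2 - q'.2.
  move=> E; have -> : q.2 = q'.2 + (y *+ q.1 - y *+ q'.1).
    by rewrite -[LHS](subrK (y *+ q.1)) -/(blk y q) E /blk addrAC addrA.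
  by rewrite [RHS]addrAC subrr add0r.
have ptK y q : pt y (blk y q) (pos y q) = q.
  by case: q => i a; rewrite /pt /blk subrK.
have blk_pt y b c : blk y (pt y b c) = b by rewrite /blk addrK.
have blk_ex (q q' : 'I_t * A) : q.1 != q'.1 -> exists y, blk y q = blk y q'.
  move=> qq; have [g _ gK] := injF_bij (inj _ _ qq).
  have /= := gK (q.2 - q'.2); set y := g _ => E.
  exists y; apply/eqP; rewrite /blk -[q.2](subrK q'.2) -E.
  by rewrite addrAC [y *+ q.1 - _ - _]addrAC subrr add0r addrC.
have blk_fst y (q q' : 'I_t * A) : q != q' -> blk y q = blk y q' -> q.1 != q'.1.
  move=> qq E; apply: contraNneq qq => e.
  by case: q q' e E => [i a] [j b] /= ->; rewrite /blk /= => /addIr ->.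
have blk_uniq y y' (q q' : 'I_t * A) : q != q' ->
    blk y q = blk y q' -> blk y' q = blk y' q' -> y = y'.
  move=> qq E E'; apply: (inj _ _ (blk_fst _ _ _ qq E)).
  by rewrite (blkE _ _ _ E) (blkE _ _ _ E').
have W := wilson_gdd ptK blk_pt (fun _ _ _ => erefl) blk_ex blk_fst blk_uniq fP.
pose U := {y : A & 'I_(n y)}.
pose e (p : 'I_t * (A * 'I_m) + U) : ('I_t * A) * 'I_m + U :=
  match p with inl q => inl ((q.1, q.2.1), q.2.2) | inr v => inr v end.
pose e' (p : ('I_t * A) * 'I_m + U) : 'I_t * (A * 'I_m) + U :=
  match p with inl q => inl (q.1.1, (q.1.2, q.2)) | inr v => inr v end.
have eK : cancel e' e by case=> [[[? ?] ?]|?].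
have e'K : cancel e e' by case=> [[? [? ?]]|?].
have [fT fgr] := transport_gdd eK e'K W.
have <- : #|{: A * 'I_m}| = (h.+1 * m)%N by rewrite card_prod !card_ord.
have <- : #|{: U}| = (\sum_y n y)%N.
  by rewrite card_tagged sumnE big_map big_enum; apply: eq_bigr => y _; rewrite card_ord.
apply: (@has_gdd_of _ _ _ (transport e e' (wilson fst blk pos pt f))).
split=> // x y; rewrite fgr.
by case: x y => [[? [? ?]]|?] [[? [? ?]]|?].
Qed.
End TransversalDesign.

(** * Cyclic designs given by tables *)

Section Lift.
Import GRing.Theory.
Local Open Scope ring_scope.
Variables (I : finType) (A : finZmodType) (D : I -> I -> A -> option (I * A)).

Definition shift (x : A) (p : I * A) : I * A := (p.1, x + p.2).

(** [D i j d] stands for the third point of the line through (i, 0) and (j, d); all other lines are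
    translates. *)
Definition lift_op (p q : I * A) : option (I * A) :=
  omap (shift p.2) (D p.1 q.1 (q.2 - p.2)).

Lemma lift_op0 i q : lift_op (i, 0) q = D i q.1 q.2.
Proof.
rewrite /lift_op subr0; case: (D _ _ _) => [[k e]|] //=.
by rewrite /shift add0r.
Qed.

Lemma lift_op_shift x p q : lift_op (shift x p) (shift x q) = omap (shift x) (lift_op p q).
Proof.
rewrite /lift_op /= opprD addrACA subrr add0r.
by case: (D _ _ _) => //= r; rewrite /shift /= addrA.
Qed.

Lemma shiftK x : cancel (shift x) (shift (- x)).
Proof. by case=> i a; rewrite /shift /= addKr. Qed.

Lemma shift_inj x : injective (shift x). Proof. exact: can_inj (shiftK x). Qed.

Lemma shift0E p : p = shift p.2 (p.1, 0).
Proof. by case: p => i a; rewrite /shift /= addr0. Qed.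

Lemma opposite_shift x p : opposite lift_op (shift x p) = shift x @: opposite lift_op p.
Proof.
apply/setP => y; rewrite -{1}(shiftK (- x) y) opprK.
rewrite [RHS](_ : _ = (shift (- x) y \in opposite lift_op p)); last first.
  apply/imsetP/idP => [[z zp ->]|yp]; first by rewrite shiftK.
  by exists (shift (- x) y); rewrite // -{1}(shiftK (- x) y) opprK.
rewrite !inE lift_op_shift (inj_eq (@shift_inj x)).
by case: (lift_op _ _).
Qed.

Hypothesis D0 : forall i, D i i 0 = None.
Hypothesis D1 : forall i j d k e, D i j d = Some (k, e) ->
  D j i (- d) = Some (k, e - d) /\ D i k e = Some (j, d).

Lemma lift_ts : triple_system lift_op.
Proof.
split=> [p|p q r]; first by rewrite /lift_op subrr D0.
rewrite /lift_op; case E: (D _ _ _) => [[k e]|] //= [<-].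
have [E1 E2] := D1 E; rewrite /shift /=; split.
  rewrite opprB in E1; rewrite E1 /= /shift /=; congr (Some (_, _)).
  by rewrite addrCA subrKC addrC.
rewrite [p.2 + e]addrC addrK E2 /= /shift /=; congr (Some _).
by rewrite subrKC -surjective_pairing.
Qed.

Variable w : nat.
Hypothesis cD : forall i, #|opposite lift_op (i, 0)| = w.
Hypothesis oD : forall i y z, y \in opposite lift_op (i, 0) ->
  z \in opposite lift_op (i, 0) -> y != z ->
  exists2 u, lift_op y z = Some u & u \in opposite lift_op (i, 0).

Lemma lift_pentagonal : pentagonal w lift_op.
Proof.
split=> [|p|p y z]; first exact: lift_ts.
  by rewrite (shift0E p) opposite_shift card_imset //; apply: shift_inj.
rewrite (shift0E p) opposite_shift => /imsetP[a aP ->] /imsetP[b bP ->].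
rewrite (inj_eq (@shift_inj _)) => /(oD aP bP)[c E cP].
by exists (shift p.2 c); rewrite ?lift_op_shift ?E ?imset_f.
Qed.

Lemma lift_no_opp_pair :
  (forall i, exists y z, [/\ y \in opposite lift_op (i, 0),
     z \in opposite lift_op (i, 0) & opposite lift_op y != opposite lift_op z]) ->
  no_opp_pair lift_op.
Proof.
move=> H p; have [y [z [yp zp yz]]] := H p.1.
exists (shift p.2 y), (shift p.2 z).
have -> : opposite lift_op p = shift p.2 @: opposite lift_op (p.1, 0).
  by rewrite -opposite_shift -shift0E.
rewrite !opposite_shift !imset_f //; split=> //.
by rewrite (inj_eq (imset_inj (@shift_inj p.2))).
Qed.

End Lift.

(** * Difference tables in binary arithmetic and their boolean checks *)

Definition nrange (n : N) : seq N := [seq bin_of_nat k | k <- iota 0 n].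

Lemma mem_nrange (n k : N) : (k \in nrange n) = (k < n).
Proof.
apply/mapP/idP => [[j]|kn]; first by rewrite mem_iota => /andP[_ jn] ->; rewrite bin_of_natK.
by exists (k : nat); rewrite ?mem_iota ?nat_of_binK.
Qed.

Section Table.
Variables (n m : N).

Definition modsub (x y : N) : N := if (y <=? x)%num then (x - y)%num else (x + n - y)%num.

Definition table := PositiveMap.t (N * N).

Definition key (i j d : N) : positive := N.succ_pos ((i * m + j) * n + d)%num.

Definition get (D : table) (i j d : N) : option (N * N) :=
  PositiveMap.find (key i j d) D.

Definition put (D : table) (i j d k e : N) : table :=
  PositiveMap.add (key i j d) (k, e) D.

Record block := Block { blk_i : N; blk_j : N; blk_d : N; blk_k : N; blk_e : N }.

(* All translates of the triple (i,0), (j,d), (k,e), where (i,x) is the element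
   [x] of the i-th of [m] copies of Z_n. *)
Definition put_block (D : table) (b : block) : table :=
  let: Block i j d k e := b in
  let d' := modsub 0 d in let e' := modsub 0 e in
  let ed := modsub e d in let de := modsub d e in
  put (put (put (put (put (put D i j d k e) i k e j d) j i d' k ed) j k ed i d')
       k i e' j de) k j de i e'.

(** Mixed radix: with M = m n the code of a block is (i M + (j n + d)) M + (k n + e). *)
Definition decode_block (c : N) : block :=
  let M := (m * n)%num in
  let: (c1, q) := N.div_eucl c M in
  let: (i, p) := N.div_eucl c1 M in
  let: (j, d) := N.div_eucl p n in
  let: (k, e) := N.div_eucl q n in
  Block i j d k e.

Definition dilate (z : N) (b : block) : block :=
  let: Block i j d k e := b in
  Block i j (N.modulo (d * z) n) k (N.modulo (e * z) n).

(* [z] is a unit of order [r] modulo [n]; each code stands for the [r] base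
   blocks obtained from it by multiplication with the powers of [z]. *)
Definition table_of (r z : N) (codes : seq N) : table :=
  foldl put_block (PositiveMap.empty _)
    (flatten [seq traject (dilate z) (decode_block c) r | c <- codes]).

Definition pts : seq (N * N) := [seq (i, d) | i <- nrange m, d <- nrange n].

Variable D : table.

Definition oppb (i : N) (p : N * N) : bool :=
  (p != (i, 0%num)) && ~~ isSome (get D i p.1 p.2).

Definition opps (i : N) : seq (N * N) := filter (oppb i) pts.

(** The checks read the finished table back through [get], so they certify it whatever codes and
    multiplier produced it. *)
Definition ts_ok : bool :=
  [&& n != 0%num, m != 0%num,
      all (fun i => ~~ isSome (get D i i 0)) (nrange m) &
      all (fun i => all (fun p : N * N =>
        if get D i p.1 p.2 is Some (k, e) then
          [&& (k <? m)%num, (e <? n)%num,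
              get D p.1 i (modsub 0 p.2) == Some (k, modsub e p.2) &
              get D i k e == Some p]
        else true) pts) (nrange m)].

(** Translation invariance leaves only the points (i, 0) to test. The lookup moves p to (p.1, 0);
    subtracting [modsub 0 p.2] adds p.2 and so moves the third point back. *)
Definition pent_ok (w : N) : bool :=
  all (fun i => let L := opps i in
    (bin_of_nat (size L) == w) &&
    all (fun p : N * N => all (fun q : N * N => (p == q) ||
      (if get D p.1 q.1 (modsub q.2 p.2) is Some (k, e) then
         oppb i (k, modsub e (modsub 0 p.2)) else false)) L) L) (nrange m).

(** [s] is given relative to p: the point (s.1, p.2 + s.2) is opposite to p, and its position
    relative to q has second coordinate s.2 - (q.2 - p.2). *)
Definition no_opp_pair_ok : bool :=
  all (fun i => let L := opps i in
    has (fun p : N * N => let L' := opps p.1 in has (fun q : N * N => (p != q) &&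
      has (fun s : N * N => ~~ oppb q.1 (s.1, modsub s.2 (modsub q.2 p.2))) L') L) L)
   (nrange m).

(** The cycle sought is (0, 0), p, (s.1, p.2 + s.2), q. A single base point is tried, since one
    cycle is enough. *)
Definition cycle_ok : bool :=
  let L := opps 0 in
  has (fun p : N * N => let L' := opps p.1 in has (fun q : N * N => (p != q) &&
      has (fun s : N * N =>
        ((s.1, modsub s.2 (modsub 0 p.2)) != (0%num, 0%num)) &&
        oppb q.1 (s.1, modsub s.2 (modsub q.2 p.2))) L') L) L.

End Table.

(** * Soundness of the checks *)

Section TableLift.
Import GRing.Theory.
Variables (n m : N) (D : table).
Hypothesis ok : ts_ok n m D.

Notation h := (nat_of_bin n).-1.
Notation l := (nat_of_bin m).-1.
Notation A := 'I_h.+1.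
Notation I := 'I_l.+1.
Notation bin := bin_of_nat.

(** Ordinals form a cyclic group only when their index is a visible successor, so [n] and [m] enter
    through their predecessors; [ts_ok] excludes 0. *)
Lemma h_n : h.+1 = n.
Proof. by case/and4P: ok => /eqP n0 _ _ _; lia. Qed.

Lemma l_m : l.+1 = m.
Proof. by case/and4P: ok => _ /eqP m0 _ _; lia. Qed.

Lemma ord_n (x : A) : (bin x < n)%N.
Proof. by rewrite bin_of_natK; have := ltn_ord x; have := h_n; lia. Qed.

Lemma ord_m (x : I) : (bin x < m)%N.
Proof. by rewrite bin_of_natK; have := ltn_ord x; have := l_m; lia. Qed.

Lemma bin_sub (x y : A) : bin (x - y)%R = modsub n (bin x) (bin y).
Proof.
have xn := ltn_ord x; have yn := ltn_ord y; have hn := h_n.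
suff -> : nat_of_ord (x - y)%R = if y <= x then x - y else x + n - y.
  rewrite /modsub; case: (leqP y x) => yx; case: N.leb_spec => ?; lia.
rewrite /= modnDmr.
case: (leqP y x) => yx.
  by rewrite addnBA 1?ltnW // addnC -addnBA // modnDl modn_small //; lia.
by rewrite modn_small; lia.
Qed.

Lemma bin0 : bin (0%R : A) = 0%num. Proof. by []. Qed.

Lemma bin_opp (x : A) : bin (- x)%R = modsub n 0 (bin x).
Proof. by rewrite -sub0r bin_sub. Qed.

Lemma bin_add (x y : A) : bin (x + y)%R = modsub n (bin x) (modsub n 0 (bin y)).
Proof. by rewrite -bin_opp -bin_sub opprK. Qed.

Definition code (p : I * A) : N * N := (bin p.1, bin p.2).
Definition decode (p : N * N) : I * A := (inord p.1, inord p.2).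

Lemma codeK : cancel code decode.
Proof. by case=> i a; rewrite /decode /= !bin_of_natK !inord_val. Qed.

Lemma decodeK (k e : N) : k < m -> e < n -> code (decode (k, e)) = (k, e).
Proof.
by rewrite -h_n -l_m /code /= => km en; rewrite !inordK // !nat_of_binK.
Qed.

Lemma code_inj : injective code. Proof. exact: can_inj codeK. Qed.

Lemma code_pts p : code p \in pts n m.
Proof. by apply/allpairsP; exists (code p); rewrite !mem_nrange ord_n ord_m. Qed.

Definition table_op (i j : I) (d : A) : option (I * A) :=
  omap decode (get n m D (bin i) (bin j) (bin d)).

Lemma getP i p (k e : N) : get n m D (bin (i : I)) (code p).1 (code p).2 = Some (k, e) ->
  [/\ code (decode (k, e)) = (k, e),
      get n m D (code p).1 (bin i) (modsub n 0 (code p).2) = Some (k, modsub n e (code p).2) &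
      get n m D (bin i) k e = Some (code p)].
Proof.
case/and4P: ok => _ _ _ /allP /(_ (bin i)); rewrite mem_nrange ord_m => /(_ isT).
move=> /allP /(_ _ (code_pts p)) + E; rewrite E.
by case/and4P => km en /eqP-> /eqP->; rewrite decodeK //; move: km en; lia.
Qed.

Lemma table_op0 i : table_op i i 0%R = None.
Proof.
case/and4P: ok => _ _ /allP /(_ (bin i)) + _; rewrite mem_nrange ord_m => /(_ isT).
by rewrite /table_op bin0; case: (get _ _ _ _ _ _).
Qed.

Lemma table_op1 i j d k e : table_op i j d = Some (k, e) ->
  table_op j i (- d)%R = Some (k, e - d)%R /\ table_op i k e = Some (j, d).
Proof.
rewrite /table_op; case E: (get _ _ _ _ _ _) => [[k' e']|] //= [<- <-].
have [K E1 E2] := @getP i (j, d) _ _ E; case: K => Kk Ke.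
rewrite bin_opp E1 Kk Ke E2 /= -/(decode _) codeK -{1}Ke -bin_sub.
by split=> //; congr (Some (_, _)); rewrite [LHS]/inord bin_of_natK valKd.
Qed.

Definition table_lift : I * A -> I * A -> option (I * A) := lift_op table_op.

Lemma table_lift_ts : triple_system table_lift.
Proof. exact: lift_ts table_op0 table_op1. Qed.

Lemma oppbE i p : oppb n m D (bin (i : I)) (code p) =
  (p \in opposite table_lift (i, 0%R)).
Proof.
rewrite inE /table_lift lift_op0 /oppb /table_op; congr (_ && _).
  by rewrite -bin0 -[(bin i, _)]/(code (i, 0%R)) (inj_eq code_inj).
by case: (get _ _ _ _ _ _).
Qed.

Lemma mem_opps i p : (code p \in opps n m D (bin (i : I))) =
  (p \in opposite table_lift (i, 0%R)).
Proof. by rewrite mem_filter code_pts andbT oppbE. Qed.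

Lemma pts_code q : q \in pts n m -> exists p, q = code p.
Proof.
case/allpairsP => -[k e] /=; rewrite !mem_nrange => -[km en ->].
by exists (decode (k, e)); rewrite decodeK.
Qed.

Lemma opps_code i q : q \in opps n m D (bin (i : I)) ->
  exists2 p, q = code p & p \in opposite table_lift (i, 0%R).
Proof.
move=> qi; have [p qE] : exists p, q = code p.
  by apply: pts_code; move: qi; rewrite mem_filter => /andP[].
by exists p; rewrite // -mem_opps -qE.
Qed.

Lemma size_opps i : size (opps n m D (bin (i : I))) = #|opposite table_lift (i, 0%R)|.
Proof.
have uniq_nrange k : uniq (nrange k).
  by rewrite map_inj_uniq ?iota_uniq //; apply: can_inj bin_of_natK.
rewrite cardE -(size_map code); apply/perm_size/uniq_perm.
- by rewrite filter_uniq // allpairs_uniq // => -[? ?] [? ?].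
- by rewrite map_inj_uniq ?enum_uniq //; apply: code_inj.
move=> q; apply/idP/mapP => [/opps_code[p -> pi]|[p + ->]].
  by exists p; rewrite ?mem_enum.
by rewrite mem_enum mem_opps.
Qed.

(** Turns a lookup relative to p into the value of the operation at two arbitrary points, with the
    third point again relative to p. *)
Lemma get_lift (p q : I * A) :
  get n m D (bin p.1) (bin q.1) (modsub n (bin q.2) (bin p.2)) =
  omap (fun u : I * A => (bin u.1, bin (u.2 - p.2)%R)) (table_lift p q).
Proof.
rewrite /table_lift /lift_op /table_op -bin_sub.
case E: (get _ _ _ _ _ _) => [[k e]|] //.
have [[Kk Ke] _ _] := @getP p.1 (q.1, (q.2 - p.2)%R) _ _ E.
change (Some (k, e) = Some (bin (inord k : I), bin (p.2 + inord e - p.2 : A)%R)).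
have addlK (a b : A) : (a + b - a)%R = b by rewrite addrC addKr.
by rewrite addlK Kk Ke.
Qed.

Section Pent.
Variable w : N.
Hypothesis pok : pent_ok n m D w.

Lemma mem_bin (i : I) : bin i \in nrange m.
Proof. by rewrite mem_nrange ord_m. Qed.

Lemma table_lift_pentagonal : pentagonal w table_lift.
Proof.
apply: lift_pentagonal => [||i|i y z]; [exact: table_op0|exact: table_op1|..].
  have /andP[/eqP <- _] := allP pok _ (mem_bin i).
  by rewrite bin_of_natK size_opps.
rewrite -!mem_opps => yi zi yz.
have /andP[_ /allP /(_ _ yi) /allP /(_ _ zi)] := allP pok _ (mem_bin i).
rewrite (inj_eq code_inj) (negbTE yz) /= get_lift -/table_lift.
case E: (table_lift y z) => [u|] //= ui; exists u => //.
have := oppbE i u; rewrite /code -[u.2](subrK y.2) bin_add => <-.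
exact: ui.
Qed.

Lemma opp_shiftE p q : (q \in opposite table_lift p) =
  oppb n m D (bin p.1) (bin q.1, bin (q.2 - p.2)%R).
Proof.
rewrite -[(bin q.1, _)]/(code (q.1, (q.2 - p.2)%R)) oppbE.
rewrite [in LHS](shift0E p) /table_lift opposite_shift.
rewrite -[q in LHS](_ : shift p.2 (q.1, (q.2 - p.2)%R) = q); last first.
  by rewrite [RHS]surjective_pairing; congr (_, _); apply: subrKC.
by rewrite mem_imset //; apply: shift_inj.
Qed.

Lemma opp_shiftl p s : (shift p.2 s \in opposite table_lift p) =
  (s \in opposite table_lift (p.1, 0%R)).
Proof.
rewrite opp_shiftE -[(shift _ _).1]/(s.1) -[(shift _ _).2]/(p.2 + s.2)%R.
by rewrite [(p.2 + _)%R]addrC addrK -oppbE.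
Qed.

Lemma opp_shiftr (p q s : I * A) : (shift p.2 s \in opposite table_lift q) =
  oppb n m D (bin q.1) (bin s.1, modsub n (bin s.2) (modsub n (bin q.2) (bin p.2))).
Proof.
rewrite opp_shiftE -!bin_sub -[(shift _ _).1]/(s.1) -[(shift _ _).2]/(p.2 + s.2)%R.
by rewrite opprB [(s.2 + _)%R]addrCA addrA.
Qed.

Lemma table_lift_no_opp_pair : no_opp_pair_ok n m D -> no_opp_pair table_lift.
Proof.
move=> kok; apply: lift_no_opp_pair => i.
have /hasP[p' /opps_code[p -> pi]] := allP kok _ (mem_bin i).
case/hasP => q' /opps_code[q -> qi] /andP[_].
case/hasP => s' /opps_code[s -> si] /negP qs.
exists p, q; split=> //; apply/eqP => /setP /(_ (shift p.2 s)).
by rewrite opp_shiftl si opp_shiftr => /esym.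
Qed.

Lemma table_lift_4cycle : cycle_ok n m D -> has_4cycle table_lift.
Proof.
move=> /hasP[_ /(@opps_code 0%R)[p -> p0]].
move=> /hasP[_ /(@opps_code 0%R)[q -> q0] /andP[pq]].
move=> /hasP[s' /opps_code[s -> sp] /andP[s0 sq]].
exists (0%R, 0%R), (shift p.2 s), p, q; split=> //.
- apply: contraNneq s0 => /(congr1 code) /esym.
  rewrite /code -[(shift _ _).1]/(s.1) -[(shift _ _).2]/(p.2 + s.2)%R.
  by rewrite addrC bin_add => ->.
- by apply: contraNneq pq => ->.
split; first by rewrite (opp_sym table_lift_ts) opp_shiftl.
by rewrite (opp_sym table_lift_ts) opp_shiftr.
Qed.

End Pent.
End TableLift.

(** * Sizes of systems *)

Definition grp_of (t g : nat) (x : N) : nat :=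
  if x < t * g then x %/ g else t.

Definition gdd_ok (t g : nat) (m : N) (D : table) : bool :=
  all (fun i => all (fun j => isSome (get 1 m D i j 0) ==
                              (grp_of t g i != grp_of t g j)) (nrange m)) (nrange m).

(** Over the trivial group Z_1 a table is an arbitrary triple system on [m] points. These are
    numbered group by group, g consecutive numbers each, with the last group at the end. *)
Lemma table_gdd (t g u : nat) (m : N) (D : table) :
  nat_of_bin m = t * g + u -> ts_ok 1 m D -> gdd_ok t g m D -> has_gdd t g u.
Proof.
move=> mE ok /allP gok.
have l_mE := l_m ok; have fT := table_lift_ts ok.
pose V := ('I_t * 'I_g + 'I_u)%type.
pose nat_e (p : V) : nat :=
  match p with inl q => q.1 * g + q.2 | inr v => t * g + v end.
have lt_tg (i : 'I_t) (a : 'I_g) : i * g + a < t * g.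
  rewrite -ltn_subRL; apply: (leq_trans (ltn_ord a)).
  by rewrite -mulnBl leq_pmull // subn_gt0.
have lt_e p : nat_e p < m.-1.+1.
  rewrite l_mE mE; case: p => [[i a]|v] /=; last by rewrite ltn_add2l.
  exact: ltn_addr.
have grp_e p : grp_of t g (bin_of_nat (nat_e p)) =
    if p is inl q then q.1 : nat else t.
  rewrite /grp_of bin_of_natK; case: p => [[i a]|v] /=.
    rewrite lt_tg divnMDl ?divn_small ?addn0 //.
    (* Dividing by g needs 0 < g, which the element a of ['I_g] provides. *)
    by case: (g) a => [[]|].
  by rewrite ltnNge leq_addr.
pose e (p : V) : 'I_m.-1.+1 * 'I_1 := (Ordinal (lt_e p), ord0).
have e_inj : injective e.
  move=> p q [/= E]; have := grp_e q; rewrite -E grp_e.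
  case: p q E => [[i a]|v] [[j b]|v'] /=.
  - by move=> E /val_inj ij; rewrite -ij in E *; move/addnI: E => /val_inj ->.
  - by move=> _ it; have := ltn_ord i; rewrite it ltnn.
  - by move=> _ it; have := ltn_ord j; rewrite -it ltnn.
  by move=> /addnI /val_inj ->.
have [|e' eK e'K] := inj_card_bij e_inj.
  by rewrite card_sum !card_prod !card_ord l_mE mE muln1.
exists (transport e e' (@table_lift 1%num m D)); split; first exact: transport_ts.
have grpE (p : V) : (if p is inl q then q.1 : nat else t) = oapp (@nat_of_ord t) t (group_of p).
  by case: p.
have oapp_inj : injective (oapp (@nat_of_ord t) t).
  move=> [i|] [j|] //= E; first by congr Some; apply: val_inj.
    by have := ltn_ord i; rewrite E ltnn.
  by have := ltn_ord j; rewrite -E ltnn.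
move=> p q; rewrite -(inj_eq oapp_inj) -!grpE -!grp_e.
have bin_e r : bin_of_nat (nat_e r) \in nrange m.
  by rewrite mem_nrange bin_of_natK -l_mE.
have /allP/(_ _ (bin_e q))/eqP := gok _ (bin_e p).
rewrite /transport /table_lift /lift_op /table_op GRing.subrr /=.
by case: (get _ _ _ _ _ _) => [?|] /= /esym; [move/negbTE|move/negbFE].
Qed.

(** What filling asks of its parts: [pent_size] for the last group, [pent4_size] for the equal
    groups; the outcome is [pentD_size]. *)
Definition pent_size (w v : nat) : Prop :=
  exists (T : finType) f, [/\ #|T| = v, pentagonal w f & @no_opp_pair T f].

Definition pent4_size (w v : nat) : Prop :=
  exists (T : finType) f,
    [/\ #|T| = v, pentagonal w f, @no_opp_pair T f & has_4cycle f].

Definition pentD_size (w v : nat) : Prop :=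
  exists (T : finType) f,
    [/\ #|T| = v, pentagonal w f, @no_opp_pair T f & has_4cycle f /\ opp_disconnected f].

Lemma pent4_pent w v : pent4_size w v -> pent_size w v.
Proof. by case=> T [f []]; exists T, f. Qed.

Lemma pentD_pent4 w v : pentD_size w v -> pent4_size w v.
Proof. by case=> T [f [? ? ? []]]; exists T, f. Qed.

(** Allows an empty last group, that is, filling designs of type g^t. *)
Lemma pent_size0 w : pent_size w 0.
Proof.
exists void, (fun x _ => None); split; first by rewrite card_void.
  by split; first split; case.
by case.
Qed.

(** Two nonempty groups already disconnect the graph and one of them supplies the 4-cycle, so the
    last group may be filled with a connected system without 4-cycles. *)
Lemma pent_size_fill w t g u : 1 < t -> 0 < g -> has_gdd t g u ->
  pent4_size w g -> pent_size w u -> pentD_size w (t * g + u).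
Proof.
move=> t1 g0 H [G [fG [cG pG kG c4]]] [U [fU [cU pU kU]]].
have [F FP] := has_gdd_on cG cU H.
exists ('I_t * G + U)%type, (fill F fG fU); split.
- by rewrite card_sum card_prod card_ord cG cU.
- exact: fill_pentagonal.
- exact: fill_no_opp_pair.
by split; [apply: fill_4cycle; rewrite // ltnW|apply: fill_disconnected; rewrite ?cG].
Qed.

Lemma sum_two_steps (M q j h : nat) :
  \sum_(y < h) (if y < q then M else if y < q + j then 2 else 0) =
  minn q h * M + 2 * (minn (q + j) h - minn q h).
Proof.
elim: h => [|h IH]; first by rewrite big_ord0 !minn0 mul0n.
rewrite big_ord_recr /= IH.
case: ltnP => hq.
  have -> : minn q h.+1 = (minn q h).+1 by lia.
  by rewrite mulSn; lia.
have -> : minn q h.+1 = q by lia.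
have E : minn q h = q by lia.
by rewrite ?E; case: (boolP (h < q + j)) => hj; lia.
Qed.

(** Of the h parallel classes, q receive M infinite points, j receive 2 and the others none. *)
Lemma has_gdd_stack (t h m M q j : nat) : 0 < h ->
  (forall d, 0 < d < t -> coprime d h) ->
  has_gdd t m 0 -> has_gdd t m 2 -> has_gdd t m M -> q + j <= h ->
  has_gdd t (h * m) (q * M + 2 * j).
Proof.
case: h => // h _ cop H0 H2 HM qj.
have -> : q * M + 2 * j =
    \sum_(y < h.+1) (if y < q then M else if y < q + j then 2 else 0).
  by rewrite sum_two_steps; congr (_ * _ + _); lia.
by apply: has_gdd_td => // y; case: ifP => _ //; case: ifP.
Qed.

(** * Inflating points to Steiner triple systems *)

Section Inflate.
Variables (w : nat) (T A : finType) (h : A -> A -> A).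
Variables (f : T -> T -> option T) (g : A -> A -> option A).
Hypotheses (hC : commutative h) (hK : forall a, involutive (h a)).
Hypotheses (fP : pentagonal w f) (gP : pentagonal 0 g).

(** A line x, y, z yields the triples (x, a), (y, b), (z, h a b). By [hC] and [hK], [h] is a totally
    symmetric quasigroup, so the rule does not depend on the order of the points of the line. Inside
    the copy of [A] over a point the Steiner triple system [g] is used. *)
Definition inflate (p q : T * A) : option (T * A) :=
  if p.1 == q.1 then omap (pair p.1) (g p.2 q.2)
  else omap (pair^~ (h p.2 q.2)) (f p.1 q.1).

Let fT : triple_system f. Proof. by case: fP. Qed.
Let gT : triple_system g. Proof. by case: gP. Qed.

Lemma g_total a b : a != b -> g a b != None.
Proof.
case: gP => _ /(_ a) /eqP; rewrite cards_eq0 => /eqP/setP/(_ b) + _ ab.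
by rewrite !inE eq_sym ab /= => ->.
Qed.

Lemma inflate_ts : triple_system inflate.
Proof.
split=> [[x a]|[x a] [y b] [z c]]; rewrite /inflate /=.
  by rewrite eqxx ts_irrefl.
rewrite [y == x]eq_sym; case: (eqVneq x y) => [<-|xy].
  case E: (g a b) => [e|] //= [<- <-].
  by rewrite (ts_sym gT) E eqxx (ts_swap gT E).
case E: (f x y) => [u|] //= [<- <-]; have [_ xu _] := ts_neq fT E.
by rewrite (negbTE xu) (ts_sym fT) E (ts_swap fT E) /= hC hK.
Qed.

Lemma opposite_inflate x a : opposite inflate (x, a) = setX (opposite f x) setT.
Proof.
apply/setP => -[y b]; rewrite !inE andbT /inflate /= [x == y]eq_sym xpair_eqE.
case: (eqVneq y x) => [->|yx] /=; last by case: (f x y).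
by case: eqVneq => // ba; have := @g_total a b; rewrite eq_sym ba; case: (g a b) => // /(_ isT).
Qed.

Lemma inflate_pentagonal : pentagonal (w * #|A|) inflate.
Proof.
have [_ cf of_] := fP.
split; first exact: inflate_ts.
  by case=> x a; rewrite opposite_inflate cardsX cf cardsT.
case=> x a [y b] [z c]; rewrite opposite_inflate !in_setX !in_setT !andbT /= => yx zx yz.
rewrite /inflate /=; case: (eqVneq y z) yz => [<-|yz] bc.
  have /g_total : b != c by apply: contraNneq bc => ->.
  by case: (g b c) => // e _; exists (y, e); rewrite ?in_setX ?in_setT ?andbT.
have [u -> ux] := of_ x y z yx zx yz.
by exists (u, h b c); rewrite ?in_setX ?in_setT ?andbT.
Qed.

Hypothesis fK : no_opp_pair f.

Lemma inflate_no_opp_pair : no_opp_pair inflate.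
Proof.
case=> x a; have [y [z [yx zx yz]]] := fK x.
exists (y, a), (z, a); rewrite !opposite_inflate !in_setX !in_setT !andbT /=; split=> //.
apply: contraNneq yz => /setP E; apply/eqP/setP => u.
by have := E (u, a); rewrite !in_setX !in_setT !andbT /=.
Qed.

(** Two copies of x have the same opposite set, and this set has two points by [fK]. So a system to
    be inflated needs no 4-cycle of its own. *)
Lemma inflate_4cycle : 0 < #|T| -> 1 < #|A| -> has_4cycle inflate.
Proof.
move=> /card_gt0P[x _] /card_gt1P[a [b [_ _ ab]]].
have [y [z [yx zx yz]]] := fK x.
exists (x, a), (x, b), (y, a), (z, a); rewrite !opposite_inflate !in_setX !in_setT !andbT /=.
split=> //.
  by apply: contraNneq ab => /(congr1 snd) /= ->.
by apply: contraNneq yz => -[->].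
Qed.

End Inflate.

Lemma table_pentagonal (n m r z : N) (codes : seq N) (w : N) :
  let D := table_of n m r z codes in
  ts_ok n m D && pent_ok n m D w ->
  [/\ #|{: 'I_m.-1.+1 * 'I_n.-1.+1}| = (m * n)%num &
      pentagonal w (@table_lift n m D)].
Proof.
move=> D /andP[ok pok]; split; last exact: table_lift_pentagonal.
by rewrite card_prod !card_ord (l_m ok) (h_n ok); lia.
Qed.

Lemma table_pent (n m r z : N) (codes : seq N) (w : nat) (v : N) :
  (let D := table_of n m r z codes in
   [&& ts_ok n m D && pent_ok n m D (bin_of_nat w), no_opp_pair_ok n m D &
       (v =? m * n)%num]) ->
  pent_size w v.
Proof.
move=> /= /and3P[ok kok /N.eqb_spec->].
have [cT fP] := table_pentagonal ok.
exists ('I_m.-1.+1 * 'I_n.-1.+1)%type, (@table_lift n m (table_of n m r z codes)).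
rewrite bin_of_natK in fP; split=> //; case/andP: ok => ok _.
exact: table_lift_no_opp_pair.
Qed.

Lemma table_pent4 (n m r z : N) (codes : seq N) (w : nat) (v : N) :
  (let D := table_of n m r z codes in
   [&& ts_ok n m D && pent_ok n m D (bin_of_nat w), no_opp_pair_ok n m D,
       cycle_ok n m D & (v =? m * n)%num]) ->
  pent4_size w v.
Proof.
move=> /= /and4P[ok kok cok /N.eqb_spec->].
have [cT fP] := table_pentagonal ok.
exists ('I_m.-1.+1 * 'I_n.-1.+1)%type, (@table_lift n m (table_of n m r z codes)).
rewrite bin_of_natK in fP; case/andP: ok => ok _; split=> //.
  exact: table_lift_no_opp_pair.
exact: table_lift_4cycle.
Qed.

Import GRing.Theory.

Lemma pent_inflate (n r z : N) (codes : seq N) w (v : N) :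
  let D := table_of n 1 r z codes in
  ts_ok n 1 D && pent_ok n 1 D 0 -> (1 <? n)%num && (0 <? v)%num ->
  pent_size w v -> pent4_size (w * n) (v * n)%num.
Proof.
move=> D ok /andP[/N.ltb_spec0 n1 /N.ltb_spec0 v0] [T [f [cT fP fK]]].
have [cA gP] := table_pentagonal ok.
pose A : finType := ('I_(nat_of_bin 1).-1.+1 * 'I_n.-1.+1)%type.
have {}cA : #|A| = n by rewrite cA; lia.
(* The triples with sum 0 in Z_n; this operation is totally symmetric for every n. *)
pose h (p q : A) : A := (ord0, - (p.2 + q.2))%R.
have hC : commutative h by move=> p q; rewrite /h addrC.
have hK p : involutive (h p).
  by case=> i b; rewrite /h (ord1 i) opprB addrC addKr.
pose g : A -> A -> option A := @table_lift n 1%num D.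
have {}gP : pentagonal 0 g := gP.
exists (T * A)%type, (inflate h f g); split.
- by rewrite card_prod cA cT; lia.
- by rewrite -[X in w * X]cA; apply: inflate_pentagonal.
- exact: inflate_no_opp_pair gP fK.
by apply: (inflate_4cycle h gP fK); rewrite ?cT ?cA; lia.
Qed.

Lemma table_gdd_of (t g u : nat) (codes : seq N) :
  (let m := bin_of_nat (t * g + u) in let D := table_of 1 m 1 1 codes in
   ts_ok 1 m D && gdd_ok t g m D) -> has_gdd t g u.
Proof.
move=> /= /andP[ok gok]; apply: table_gdd ok gok; exact: bin_of_natK.
Qed.

(** Ingredients for three groups, of weight 2. In type g^t u^1, a point of an equal group is joined
    to the u last points by lines with distinct third points in the other equal groups, so u is at
    most g (t - 1). Hence the last group of size 4 in [gdd_3_2_4] is the largest possible. *)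
Lemma gdd_3_2_0 : has_gdd 3 2 0.
Proof.
apply: (@table_gdd_of 3 2 0 [::
  16; 23; 53; 58]%num);
vm_cast_no_check (erefl true).
Qed.

Lemma gdd_3_2_2 : has_gdd 3 2 2.
Proof.
apply: (@table_gdd_of 3 2 2 [::
  21; 31; 38; 86; 92; 111; 167; 238]%num);
vm_cast_no_check (erefl true).
Qed.

Lemma gdd_3_2_4 : has_gdd 3 2 4.
Proof.
apply: (@table_gdd_of 3 2 4 [::
  26; 38; 49; 57; 127; 139; 146; 158; 248; 259; 347; 356]%num);
vm_cast_no_check (erefl true).
Qed.

(** Weight 2 fails for four groups: a 3-GDD of type 2^4 2^1 would split 40 pairs into triples.
    Weight 6 works, and the largest last group is then 6 * 3 = 18. *)
Lemma gdd_4_6_0 : has_gdd 4 6 0.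
Proof.
apply: (@table_gdd_of 4 6 0 [::
  158; 189; 211; 233; 253; 287; 310; 378; 404; 740; 757; 783; 814; 837; 857;
  887; 931; 978; 1314; 1332; 1360; 1382; 1415; 1436; 1486; 1531; 1581; 1884;
  1911; 1943; 1963; 1988; 2005; 2086; 2133; 2154; 2465; 2490; 2518; 2541;
  2556; 2584; 2635; 2663; 2684; 3043; 3070; 3086; 3112; 3135; 3162; 3188;
  3213; 3311; 3791; 3837; 3862; 4388; 4439; 4459; 4917; 4938; 5036; 5490;
  5516; 5567; 6114; 6163; 6190; 6643; 6693; 6718]%num);
vm_cast_no_check (erefl true).
Qed.

Lemma gdd_4_6_2 : has_gdd 4 6 2.
Proof.
apply: (@table_gdd_of 4 6 2 [::
  171; 205; 228; 247; 285; 300; 331; 437; 460; 596; 845; 877; 907; 927; 956;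
  984; 1009; 1058; 1090; 1117; 1520; 1548; 1575; 1607; 1635; 1663; 1710; 1786;
  1816; 1870; 2204; 2234; 2257; 2276; 2307; 2330; 2363; 2388; 2436; 2495;
  2877; 2902; 2930; 2962; 2976; 3010; 3063; 3090; 3117; 3223; 3558; 3575;
  3600; 3637; 3657; 3684; 3764; 3795; 3815; 3950; 4439; 4495; 4548; 4627;
  5066; 5142; 5195; 5225; 5770; 5797; 5846; 5869; 6414; 6493; 6520; 6681;
  7116; 7145; 7172; 7200; 7772; 7793; 7847; 7901; 8657; 9411; 10086; 12036]%num);
vm_cast_no_check (erefl true).
Qed.

Lemma gdd_4_6_18 : has_gdd 4 6 18.
Proof.
apply: (@table_gdd_of 4 6 18 [::
  290; 333; 370; 419; 453; 499; 540; 572; 623; 655; 712; 743; 783; 822; 872;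
  910; 955; 996; 2051; 2098; 2127; 2178; 2223; 2267; 2305; 2344; 2378; 2432;
  2469; 2510; 2545; 2592; 2628; 2677; 2717; 2758; 3813; 3859; 3893; 3946;
  3982; 4016; 4067; 4099; 4143; 4190; 4230; 4278; 4325; 4365; 4406; 4434;
  4480; 4525; 5570; 5615; 5660; 5709; 5737; 5789; 5834; 5862; 5917; 5950;
  5998; 6033; 6078; 6121; 6172; 6207; 6257; 6294; 7345; 7380; 7418; 7466;
  7512; 7545; 7584; 7637; 7673; 7717; 7756; 7810; 7845; 7892; 7935; 7979;
  8014; 8047; 9097; 9147; 9195; 9226; 9275; 9316; 9365; 9398; 9444; 9480;
  9519; 9571; 9600; 9658; 9691; 9731; 9782; 9812; 11119; 11160; 11200; 11243;
  11295; 11322; 11376; 11409; 11465; 11500; 11548; 11582; 12880; 12932; 12967;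
  13002; 13061; 13087; 13130; 13182; 13222; 13262; 13307; 13341; 14649; 14699;
  14724; 14778; 14815; 14864; 14896; 14945; 14977; 15024; 15073; 15118; 16405;
  16453; 16498; 16533; 16574; 16620; 16670; 16707; 16751; 16795; 16824; 16871;
  18173; 18226; 18258; 18311; 18336; 18385; 18433; 18464; 18508; 18549; 18596;
  18644; 19948; 19983; 20024; 20073; 20114; 20146; 20191; 20231; 20274; 20322;
  20353; 20394; 21958; 21998; 22035; 22076; 22122; 22173; 23717; 23758; 23808;
  23853; 23883; 23935; 25492; 25519; 25569; 25616; 25659; 25703; 27251; 27292;
  27337; 27382; 27410; 27459; 29012; 29059; 29093; 29131; 29184; 29225; 30783;
  30827; 30854; 30905; 30945; 30988]%num);
vm_cast_no_check (erefl true).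
Qed.

(** * Closure under filling *)

(* Bit [x] of [P] stands for the size [6 * x], bit [x] of [Q] for [6 * x + c].
   A step [(t, a)] fills a 3-GDD of type (6a)^t u^1 for all known sizes [u]
   below the bound at once.  The subtraction of 27 leaves room for the at most 8
   classes that get 2 infinite points instead of 0 or 18. *)
Section Closure.
Local Open Scope N_scope.
Variables (w : nat) (c K : N).
Hypotheses (c_even : c mod 2 = 0) (c_lt : c < 6).

(** For three groups 6a = 3a * 2, so h = 3a has to be odd; for four groups 6a = a * 6, so h = a has
    to be prime to 2 and 3. Giving every class its maximum of 4 or 18 infinite points makes u/6
    equal to 2a or 3a, the source of [step_bound]. *)
Definition step_ok (s : N * N) : bool :=
  let: (t, a) := s in
  (a mod 2 =? 1) && ((t =? 3) || (t =? 4) && negb (a mod 3 =? 0)).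

Definition step_bound (s : N * N) : N :=
  let: (t, a) := s in if t =? 3 then 2 * a else 3 * a - 27.

Definition push (s : N * N) (Q : N) : N :=
  N.lor Q (N.shiftl (N.land Q (N.ones (step_bound s))) (s.1 * s.2)).

(** A step whose group size 6a has not been reached yet is skipped, so the list of steps is only a
    hint and its order matters. *)
Definition close0 (P : N) (steps : seq (N * N)) : N :=
  foldl (fun P s => if N.testbit P s.2 && step_ok s then push s P else P) P steps.

Definition close1 (P Q : N) (steps : seq (N * N)) : N :=
  foldl (fun Q s => if N.testbit P s.2 && step_ok s then push s Q else Q) Q steps.

(** [K] bounds the seeds, which may have connected deficiency graphs. A size above [K] was reached
    by filling and is therefore of type D. *)
Definition good (d x : N) : Prop :=
  pent_size w (6 * x + d)%num /\ (K < x -> pentD_size w (6 * x + d)%num).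

(** The exception x = 0 is the empty system: it can be a last group but has no 4-cycle. *)
Definition good4 (x : N) : Prop :=
  good 0 x /\ (x <> 0 -> pent4_size w (6 * x)%num).

Lemma has_gdd3_idx (a x d : N) :
  a mod 2 = 1 -> d mod 2 = 0 -> d < 6 -> x < 2 * a ->
  has_gdd 3 (6 * a)%num (6 * x + d)%num.
Proof.
move=> ao de d6 xa.
pose u := nat_of_bin (6 * x + d)%num.
have -> : nat_of_bin (6 * a)%num = (3 * a * 2)%N by lia.
(* u is even, so its remainder modulo 4 is 0 or 2: all classes in use get 4 infinite points except
   at most one, which gets 2. *)
have uE : u = ((u %/ 4) * 4 + 2 * ((u %% 4) %/ 2))%N.
  have [y dy] : exists y, d = 2 * y by exists (d / 2); rewrite {1}(N.div_mod' d 2) de N.add_0_r.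
  have -> : u = (2 * (3 * x + y)%num)%N by rewrite /u; lia.
  by lia.
rewrite -/u uE; apply: (has_gdd_stack _ _ gdd_3_2_0 gdd_3_2_2 gdd_3_2_4) => //;
  first by have := N.div_mod' a 2; lia.
  move=> k kk; have [->|->] : k = 1 \/ k = 2 by lia.
    exact: coprime1n.
  by rewrite coprime2n; have := N.div_mod' a 2; lia.
by rewrite /u; lia.
Qed.

Lemma has_gdd4_idx (a x d : N) :
  a mod 2 = 1 -> a mod 3 <> 0 -> d mod 2 = 0 -> d < 6 -> x < 3 * a - 27 ->
  has_gdd 4 (6 * a)%num (6 * x + d)%num.
Proof.
move=> ao a3 de d6 xa.
pose u := nat_of_bin (6 * x + d)%num.
have -> : nat_of_bin (6 * a)%num = (a * 6)%N by lia.
have uE : u = ((u %/ 18) * 18 + 2 * ((u %% 18) %/ 2))%N.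
  have [y dy] : exists y, d = 2 * y by exists (d / 2); rewrite {1}(N.div_mod' d 2) de N.add_0_r.
  have -> : u = (2 * (3 * x + y)%num)%N by rewrite /u; lia.
  by lia.
rewrite -/u uE; apply: (has_gdd_stack _ _ gdd_4_6_0 gdd_4_6_2 gdd_4_6_18) => //;
  first by have := N.div_mod' a 2; lia.
  move=> k kk; have [->|[->|->]] : k = 1 \/ k = 2 \/ k = 3 by lia.
  - exact: coprime1n.
  - by rewrite coprime2n; have := N.div_mod' a 2; lia.
  rewrite prime_coprime //; have := N.div_mod' a 3.
  have : a mod 3 < 3 by exact: N.mod_lt.
  move: (a mod 3) (a / 3) a3 => r y r0 r3 ->.
  by lia.
by rewrite /u; lia.
Qed.

Lemma push_pentD (t a x d : N) : step_ok (t, a) -> x < step_bound (t, a) ->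
  d mod 2 = 0 -> d < 6 -> pent4_size w (6 * a)%num -> pent_size w (6 * x + d)%num ->
  pentD_size w (6 * (t * a + x) + d)%num.
Proof.
rewrite /step_ok /step_bound => /andP[/N.eqb_spec ao ta] xb de d6 Pa Px.
have a0 : (0 < 6 * a)%num by have := N.div_mod' a 2; lia.
have -> : nat_of_bin (6 * (t * a + x) + d)%num =
    (t * (6 * a)%num + (6 * x + d)%num)%N by lia.
case/orP: ta xb => [/N.eqb_spec-> xb|/andP[/N.eqb_spec-> /N.eqb_spec a3] xb].
  by apply: pent_size_fill => //; [lia|apply: has_gdd3_idx].
by apply: pent_size_fill => //; [lia|apply: has_gdd4_idx].
Qed.

Lemma testbit_push s Q x : N.testbit (push s Q) x ->
  N.testbit Q x \/ exists y, [/\ N.testbit Q y, y < step_bound s & x = s.1 * s.2 + y].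
Proof.
rewrite /push N.lor_spec => /orP[|]; first by left.
case: (N.le_gt_cases (s.1 * s.2) x) => sx; last by rewrite N.shiftl_spec_low.
rewrite N.shiftl_spec_high' // N.land_spec => /andP[Qy].
case: (N.lt_ge_cases (x - s.1 * s.2) (step_bound s)) => yb; last first.
  by rewrite N.ones_spec_high.
by right; exists (x - s.1 * s.2); split=> //; lia.
Qed.

Lemma close0_good P steps : (forall x, N.testbit P x -> good4 x) ->
  forall x, N.testbit (close0 P steps) x -> good4 x.
Proof.
elim: steps P => // s steps IH P PG; apply: IH.
case: ifP => // /andP[Ps sok] x /testbit_push[/PG //|[y [Py yb ->]]].
case: s Ps sok yb => t a /= Pa sok yb.
have a0 : a <> 0 by move=> a0; move: sok; rewrite a0.
have D : pentD_size w (6 * (t * a + y) + 0)%num.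
  by apply: push_pentD => //; [apply: (PG a _).2|apply: (PG y _).1.1].
by split; [split=> // | move=> _; move: D; rewrite N.add_0_r];
   [apply/pent4_pent/pentD_pent4|apply: pentD_pent4].
Qed.

Lemma close1_good P Q steps : (forall x, N.testbit P x -> good4 x) ->
  (forall x, N.testbit Q x -> good c x) ->
  forall x, N.testbit (close1 P Q steps) x -> good c x.
Proof.
move=> PG; elim: steps Q => // s steps IH Q QG; apply: IH.
case: ifP => // /andP[Ps sok] x /testbit_push[/QG //|[y [Qy yb ->]]].
case: s Ps sok yb => t a /= Pa sok yb.
have a0 : a <> 0 by move=> a0; move: sok; rewrite a0.
have D : pentD_size w (6 * (t * a + y) + c)%num.
  by apply: push_pentD => //; [apply: (PG a _).2|apply: (QG y _).1].
by split=> //; apply/pent4_pent/pentD_pent4.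
Qed.

Definition full (P A L : N) : bool :=
  N.land (N.shiftr P A) (N.ones L) =? N.ones L.

Lemma fullP P A L x : full P A L -> A <= x -> x < A + L -> N.testbit P x.
Proof.
move=> /N.eqb_spec E Ax xL.
have := N.ones_spec_low L (x - A) _; rewrite -E N.land_spec N.shiftr_spec'.
have -> : x - A + A = x by lia.
by move=> H; case: (N.testbit P x) (H ltac:(lia)).
Qed.

Variables (P Q A0 L0 A1 XV L1 : N).
Hypotheses (PG : forall x, N.testbit P x -> good4 x).
Hypotheses (QG : forall x, N.testbit Q x -> good c x).
Hypotheses (fullP0 : full P A0 L0) (L0_ge : 3 * A0 + 16 <= L0) (A0_gt : 3 <= A0).

(** For odd a the number 3a moves in steps of 6, so u ranges over a window of exactly six values. *)
Lemma split_odd_triple A x : A + 3 <= x ->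
  exists a u, [/\ x = 3 * a + u, a mod 2 = 1, A <= u & u < A + 6].
Proof.
move=> Ax; have [y ->] : exists y, x = A + 3 + y by exists (x - A - 3); lia.
exists (1 + y / 6 * 2), (A + y mod 6).
have y6 : y mod 6 < 6 by exact: N.mod_lt.
rewrite N.Div0.mod_add {1}(N.div_mod' y 6).
by move: (y / 6) (y mod 6) y6 => k r r6; split=> //; lia.
Qed.

(** Beyond the verified interval x is at least 4 A0 + 16, by [L0_ge]. As u is at most A0 + 5, this
    forces A0 <= a and u < 2a, and both a and u are below x, so strong induction applies. *)
Lemma close0_all x : A0 <= x -> good4 x.
Proof.
elim/(well_founded_induction N.lt_wf_0): x => x IH A0x.
case: (N.lt_ge_cases x (A0 + L0)) => xL; first exact/PG/(fullP fullP0).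
have [|a [u [xE ao Au uA]]] := @split_odd_triple A0 x; first lia.
have Gu : good4 u by apply: IH; lia.
have Ga : good4 a by apply: IH; lia.
have D : pentD_size w (6 * (3 * a + u) + 0)%num.
  apply: push_pentD => //; first by rewrite /step_ok ao.
  - by change (u < 2 * a); lia.
  - by apply: Ga.2; lia.
  exact: Gu.1.1.
rewrite xE; split; first by split=> //; apply/pent4_pent/pentD_pent4.
by move=> _; apply: pentD_pent4; move: D; rewrite N.add_0_r.
Qed.

Hypotheses (fullQ0 : full Q A1 6) (fullQ1 : full Q XV L1).
Hypotheses (L1_ge : A1 + 3 * A0 + 15 <= XV + L1) (L1_ge' : 3 * A1 + 20 <= XV + L1).
Hypotheses (K0 : A0 <= XV) (KV : K < XV).

Lemma closeD x d : XV <= x -> d = 0 \/ d = c -> pentD_size w (6 * x + d)%num.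
Proof.
move=> xV [->|->]; first by apply: (close0_all _).1.2; lia.
case: (N.lt_ge_cases x (XV + L1)) => xL.
  by apply: (QG (fullP fullQ1 _ _)).2; lia.
have [|a [u [xE ao Au uA]]] := @split_odd_triple A1 x; first lia.
have Gu : good c u by apply/QG/(fullP fullQ0).
rewrite xE; apply: push_pentD => //; first by rewrite /step_ok ao.
- by change (u < 2 * a); lia.
- by apply: (close0_all _).2; lia.
exact: Gu.1.
Qed.

End Closure.

(** Seeds 6a and 6a + c, filling steps for either class, a bound on the seeds, and the windows of
    [closeD]. In each certificate below [c_XV] is (2 r_w + w + 1) / 6 rounded down, so it is
    dictated by the bound r_w of the theorem. *)
Record certificate := Certificate {
  c_res : N; c_mult : seq N; c_other : seq N;
  c_steps0 : seq (N * N); c_steps1 : seq (N * N);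
  c_max : N; c_A0 : N; c_L0 : N; c_A1 : N; c_XV : N; c_L1 : N }.

Definition mask (P : N) (l : seq N) : N := foldl N.setbit P l.

Lemma testbit_mask P l x : N.testbit (mask P l) x -> N.testbit P x \/ x \in l.
Proof.
elim: l P => [|a l IH] P /=; first by left.
case/IH => [|xl]; last by right; rewrite inE xl orbT.
rewrite N.setbit_eqb => /orP[/N.eqb_spec->|]; last by left.
by right; rewrite inE eqxx.
Qed.

Definition certified (s : certificate) : bool :=
  let: Certificate c C0 C1 s0 s1 K A0 L0 A1 XV L1 := s in
  (* Starting from 1 sets bit 0, the empty system; class c has no such free member. *)
  let P := close0 (mask 1 C0) s0 in
  let Q := close1 P (mask 0 C1) s1 in
  [&& (N.modulo c 2 =? 0)%num && (c <? 6)%num,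
      all (fun a => (a <=? K)%num) C0 && all (fun a => (a <=? K)%num) C1,
      full P A0 L0, (3 * A0 + 16 <=? L0)%num && (3 <=? A0)%num,
      full Q A1 6 && full Q XV L1,
      (A1 + 3 * A0 + 15 <=? XV + L1)%num && (3 * A1 + 20 <=? XV + L1)%num &
      (A0 <=? XV)%num && (K <? XV)%num].

Lemma certified_pentD (w : nat) (s : certificate) :
  certified s ->
  {in c_mult s, forall a, pent4_size w (6 * a)%num} ->
  {in c_other s, forall a, pent_size w (6 * a + c_res s)%num} ->
  forall x d, (c_XV s <= x)%num -> d = 0%num \/ d = c_res s ->
  pentD_size w (6 * x + d)%num.
Proof.
case: s => c C0 C1 s0 s1 K A0 L0 A1 XV L1 /=.
set P := close0 _ _; set Q := close1 _ _ _.
case/and5P => /andP[/N.eqb_spec c2 /N.ltb_spec0 c6] /andP[/allP K0 /allP K1] F0.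
move=> /andP[/N.leb_spec0 L0A /N.leb_spec0 A03].
case/and3P => /andP[F1 F2] /andP[/N.leb_spec0 L1A /N.leb_spec0 L1A'].
move=> /andP[/N.leb_spec0 A0V /N.ltb_spec0 KV] G0 G1 x d.
have PG y : N.testbit P y -> good4 w K y.
  apply: (close0_good c2 c6) => // {}y /testbit_mask[|yC].
    case: y => [|p] // _; split; last by [].
    by split=> [|/N.nlt_0_r] //; exact: pent_size0.
  split; last by move=> _; apply: G0.
  split; first by rewrite N.add_0_r; apply/pent4_pent/G0.
  by have /N.leb_spec0 := K0 y yC; lia.
apply: (@closeD w c K c2 c6 P Q A0 L0 A1 XV L1) => // {}x.
apply: (close1_good c2 c6) => // y /testbit_mask[|yC]; first by rewrite N.bits_0.
split; first exact: G1.
by have /N.leb_spec0 := K1 y yC; lia.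
Qed.

(** * Small systems *)

(** The codes here and in the next two lemmas are difference families: {0,1,2} over Z_3 (a short
    orbit), {0,1,3} over Z_7, and {0,1,4}, {0,2,7} over Z_13. *)
Lemma pent_inflate3 w (v : N) : pent_size w v -> (0 <? v)%num ->
  pent4_size (w * 3) (v * 3)%num.
Proof. by move=> Pv v0; apply: (@pent_inflate 3 1 1 [:: 5]%num) => //; vm_compute. Qed.

Lemma pent_inflate7 w (v : N) : pent_size w v -> (0 <? v)%num ->
  pent4_size (w * 7) (v * 7)%num.
Proof. by move=> Pv v0; apply: (@pent_inflate 7 1 1 [:: 10]%num) => //; vm_compute. Qed.

Lemma pent_inflate13 w (v : N) : pent_size w v -> (0 <? v)%num ->
  pent4_size (w * 13) (v * 13)%num.
Proof. by move=> Pv v0; apply: (@pent_inflate 13 1 1 [:: 17; 33]%num) => //; vm_compute. Qed.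

(** There is no cyclic STS(9), so a factor 9 is obtained by inflating twice by 3. *)
Lemma pent_inflate9 w (v : N) : pent_size w v -> (0 <? v)%num ->
  pent4_size (w * 9) (v * 9)%num.
Proof.
move=> /pent_inflate3 Pv v0; have /pent4_pent/pent_inflate3 := Pv v0.
have -> : (w * 3 * 3 = w * 9)%N by lia.
have -> : (v * 3 * 3 = v * 9)%num by lia.
by apply; move: v0; clear Pv; case: v.
Qed.

(* The systems below were found by hill climbing on base blocks.  Except for
   those on 460, 1732 and 2908 points, where [m = 4], they have [m = 2] and a
   bipartite deficiency graph joining (0,x) to (1,x+s) for s in a set S of size
   w.  The 4-cycles come from cosets of a subgroup of order 3 contained in S, or,
   for w = 13, 19, 25, from a 3 x 3 grid B - A contained in S. *)
Lemma pent_3_30 : pent_size 3 30%num.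
Proof.
apply: (@table_pent 15 2 1 1 [::
  43; 145; 160; 209; 237; 534; 598; 686; 1398; 1525]%num);
vm_cast_no_check (erefl true).
Qed.

Lemma pent_3_34 : pent_size 3 34%num.
Proof.
apply: (@table_pent 17 2 1 1 [::
  49; 166; 194; 235; 267; 295; 742; 951; 1788; 1899]%num);
vm_cast_no_check (erefl true).
Qed.

Lemma pent_3_42 : pent_size 3 42%num.
Proof.
apply: (@table_pent 21 2 1 1 [::
  61; 198; 249; 289; 308; 372; 407; 447; 998; 1083; 1510; 2712; 2850; 2975]%num);
vm_cast_no_check (erefl true).
Qed.

Lemma pent_3_46 : pent_size 3 46%num.
Proof.
apply: (@table_pent 23 2 1 1 [::
  67; 216; 241; 360; 413; 456; 504; 1190; 1283; 1370; 1423; 1649; 3246; 3438]%num);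
vm_cast_no_check (erefl true).
Qed.

Lemma pent_3_54 : pent_size 3 54%num.
Proof.
apply: (@table_pent 27 2 1 1 [::
  79; 249; 290; 356; 479; 504; 590; 643; 736; 1718; 1932; 1990; 2050; 2259;
  2373; 4458; 4692; 4905]%num);
vm_cast_no_check (erefl true).
Qed.

Lemma pent_3_58 : pent_size 3 58%num.
Proof.
apply: (@table_pent 29 2 1 1 [::
  85; 254; 336; 392; 515; 579; 616; 748; 791; 846; 1845; 1956; 2084; 2318;
  2660; 5136; 5329; 5444]%num);
vm_cast_no_check (erefl true).
Qed.

Lemma pent_3_66 : pent_size 3 66%num.
Proof.
apply: (@table_pent 33 2 1 1 [::
  97; 317; 354; 440; 519; 588; 695; 748; 846; 922; 1053; 1101; 2488; 2629;
  2705; 2765; 2894; 3163; 6636; 6858; 6923; 7315]%num);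
vm_cast_no_check (erefl true).
Qed.

Lemma pent_3_70 : pent_size 3 70%num.
Proof.
apply: (@table_pent 35 2 1 1 [::
  103; 340; 376; 473; 512; 599; 755; 827; 881; 1170; 1233; 2655; 2849; 2998;
  3134; 3419; 3633; 3707; 4408; 7458; 7683; 7748]%num);
vm_cast_no_check (erefl true).
Qed.

Lemma pent_3_78 : pent_size 3 78%num.
Proof.
apply: (@table_pent 39 2 1 1 [::
  115; 364; 410; 536; 574; 682; 748; 824; 1011; 1040; 1147; 1299; 1369; 3582;
  3732; 3889; 4198; 4271; 4428; 4517; 4828; 5459; 9246; 9662; 9733; 10205]%num);
vm_cast_no_check (erefl true).
Qed.

Lemma pent_15_222 : pent4_size 15 222%num.
Proof.
apply: (@table_pent4 111 2 1 1 [::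
  322; 604; 849; 916; 1277; 1509; 1652; 1857; 2055; 2376; 3310; 3529; 3618;
  3849; 4196; 4438; 4708; 5008; 5320; 5839; 6162; 6500; 7088; 7268; 7678;
  7898; 8288; 8819; 9034; 9536; 9722; 10579; 11441; 11678; 12349; 25072;
  25258; 25659; 25969; 26126; 26383; 27002; 27461; 27893; 28175; 28392; 29235;
  30185; 30825; 31689; 32784; 33229; 35484; 36405; 37057; 37734; 39737; 42376;
  42821; 74271; 75012; 75611; 75851; 76098; 77650; 77864; 78785; 79879; 80553;
  82325]%num);
vm_cast_no_check (erefl true).
Qed.

Lemma pent_15_234 : pent4_size 15 234%num.
Proof.
apply: (@table_pent4 117 2 1 1 [::
  467; 567; 772; 1110; 1250; 1493; 1769; 1956; 2284; 2462; 2679; 3129; 3474;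
  3691; 3817; 4132; 4527; 4986; 5363; 5804; 6030; 6236; 6404; 6957; 7679;
  8382; 9093; 9204; 9510; 10961; 11445; 11668; 12288; 12623; 12830; 13294;
  27791; 28019; 28500; 28992; 29446; 29937; 30097; 30410; 30627; 31027; 31813;
  33183; 33629; 34363; 34580; 34790; 35094; 37649; 37836; 41392; 43988; 47004;
  47720; 48201; 48424; 49833; 51004; 82739; 83003; 83463; 83689; 84164; 84848;
  86055; 86752; 87231; 88627; 91455]%num);
vm_cast_no_check (erefl true).
Qed.

Lemma pent_15_246 : pent4_size 15 246%num.
Proof.
apply: (@table_pent4 123 2 1 1 [::
  254; 579; 851; 1198; 1305; 1707; 2303; 2887; 3043; 3575; 3905; 4105; 4325;
  4637; 4915; 5152; 5403; 5614; 5757; 6280; 6572; 6817; 6965; 7203; 7623;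
  7699; 8202; 8818; 9326; 10168; 11293; 13021; 13757; 13997; 14218; 14404;
  14676; 15004; 15134; 30649; 30938; 31399; 31908; 32670; 32912; 33104; 33356;
  33944; 34103; 34853; 35090; 35583; 36373; 36822; 37558; 39578; 39823; 42305;
  44237; 44991; 45253; 45699; 45962; 47698; 49188; 51152; 91259; 91427; 91648;
  92180; 93154; 93893; 96407; 97859; 98114; 98604; 99087; 101065]%num);
vm_cast_no_check (erefl true).
Qed.

Lemma pent_15_258 : pent4_size 15 258%num.
Proof.
apply: (@table_pent4 129 2 1 1 [::
  486; 708; 833; 1096; 1455; 1788; 1895; 2180; 2361; 2803; 3082; 3312; 3761;
  4106; 4178; 4422; 4715; 5344; 5781; 6108; 6707; 6786; 7060; 7469; 7650;
  8150; 8449; 8657; 9733; 10001; 10749; 11092; 11180; 11587; 11836; 12550;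
  12849; 14109; 14376; 14908; 15900; 16388; 34198; 35558; 35833; 36315; 36551;
  37362; 37914; 38134; 38408; 39628; 40418; 40744; 43268; 43791; 45353; 46125;
  46645; 47468; 47948; 48698; 50805; 51585; 54173; 54686; 56985; 59840; 65529;
  100822; 101076; 101828; 102060; 102396; 103155; 104198; 104471; 104668;
  105697; 106760; 107003; 111155]%num);
vm_cast_no_check (erefl true).
Qed.

Lemma pent_15_270 : pent4_size 15 270%num.
Proof.
apply: (@table_pent4 135 2 1 1 [::
  351; 761; 927; 1252; 1439; 1694; 1996; 2217; 2535; 2783; 3117; 3504; 3745;
  3953; 4150; 4427; 4702; 5272; 5653; 6037; 6658; 6940; 7270; 7546; 8507;
  8882; 9146; 9341; 10136; 11308; 11608; 11808; 12240; 12957; 13220; 14514;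
  15352; 15929; 16164; 17193; 17493; 17807; 18016; 37412; 37711; 38864; 39146;
  39359; 40223; 41533; 42294; 42867; 43371; 43933; 44194; 44446; 45305; 45836;
  46139; 48039; 48567; 49401; 50718; 50960; 51244; 51788; 52631; 53976; 54475;
  56376; 58833; 61549; 66398; 109810; 110886; 111172; 111411; 111954; 112247;
  113585; 113849; 114115; 114668; 115485; 118471; 121725]%num);
vm_cast_no_check (erefl true).
Qed.

Lemma pent_15_366 : pent4_size 15 366%num.
Proof.
apply: (@table_pent4 183 2 1 1 [::
  714; 848; 1327; 1663; 1947; 2337; 2687; 3097; 3553; 3813; 4146; 4731; 4921;
  5824; 5929; 6459; 6877; 7084; 7932; 8654; 9065; 9371; 9837; 10121; 10351;
  10956; 11619; 11915; 12522; 13106; 13478; 13797; 14266; 14407; 15130; 15953;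
  16724; 17059; 17330; 18153; 18958; 19346; 20016; 20799; 22228; 22448; 22894;
  23621; 25102; 25884; 28021; 28510; 29172; 30357; 31014; 31396; 31841; 32026;
  32506; 33215; 33496; 68766; 69169; 69530; 70154; 70507; 70928; 73506; 74986;
  75747; 76061; 79289; 79710; 83399; 83805; 84878; 85206; 86003; 87375; 88140;
  89249; 90011; 91408; 92885; 94004; 95498; 97291; 98779; 101293; 102058;
  104237; 109065; 111594; 112699; 113430; 115608; 119666; 121495; 122950;
  125902; 201918; 202680; 203361; 203730; 204067; 205217; 205669; 205908;
  206671; 208143; 211473; 212573; 214766; 215480; 215842; 216223; 218421;
  223565]%num);
vm_cast_no_check (erefl true).
Qed.

Lemma pent_15_378 : pent4_size 15 378%num.
Proof.
apply: (@table_pent4 189 2 1 1 [::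
  583; 977; 1180; 1885; 2213; 2340; 2864; 3310; 3429; 3848; 4259; 4618; 4967;
  5589; 6009; 6160; 6563; 7439; 7634; 7995; 8664; 9030; 9151; 9558; 10052;
  10673; 11311; 11613; 11843; 12400; 12851; 13151; 13421; 14230; 14444; 14951;
  15858; 16913; 17115; 17989; 18466; 18873; 19146; 19481; 21466; 22597; 23646;
  23940; 24860; 25640; 27194; 27811; 28657; 29004; 29752; 32468; 32882; 33080;
  34625; 34984; 72778; 73182; 74711; 75486; 76229; 80445; 80822; 81184; 81570;
  81991; 83395; 84196; 85676; 86846; 87270; 88356; 88798; 90714; 91067; 91358;
  94863; 96362; 96652; 97055; 98264; 98951; 99748; 100851; 101254; 102335;
  102739; 105016; 105814; 109582; 110333; 116044; 117922; 119765; 123937;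
  124720; 129642; 133795; 134179; 134561; 139474; 215795; 216906; 218088;
  218772; 219173; 219847; 221010; 222210; 222606; 223357; 224071; 225241;
  227469; 229026; 229387; 231654; 238455]%num);
vm_cast_no_check (erefl true).
Qed.

(** The multiplier 181 has order 3 modulo 237 = 3 * 79; one base block is listed per orbit of it. *)
Lemma pent_21_474 : pent4_size 21 474%num.
Proof.
apply: (@table_pent4 237 2 3 181 [::
  2424; 3029; 3704; 4065; 4409; 5298; 6575; 8949; 11432; 11965; 13676; 13860;
  18855; 19248; 21619; 22194; 25426; 29297; 34572; 36357; 37604; 38745; 43887;
  45744; 53499; 55260; 115071; 117544; 120854; 124541; 125603; 126520; 133952;
  135937; 137901; 139246; 140287; 147281; 153507; 158719; 161592; 164837;
  185762; 209013; 339809; 340153; 341620; 342629; 348832; 349248; 351149;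
  374855]%num);
vm_cast_no_check (erefl true).
Qed.

Lemma pent_21_582 : pent4_size 21 582%num.
Proof.
apply: (@table_pent4 291 2 3 229 [::
  2539; 5807; 6768; 11456; 13512; 16261; 20451; 21920; 22679; 24599; 29834;
  31365; 32824; 35656; 38326; 38941; 39771; 40467; 41254; 45320; 45924; 50590;
  51545; 56648; 61503; 62046; 68053; 68628; 71904; 72660; 74863; 78407; 82492;
  171488; 172034; 183806; 186224; 187199; 187946; 198253; 207769; 209940;
  210529; 211254; 222847; 223481; 224061; 226909; 240879; 261203; 279925;
  291521; 297356; 314851; 510244; 510789; 521951; 528992; 530618; 532999;
  538249; 544077; 548117; 565025]%num);
vm_cast_no_check (erefl true).
Qed.

Lemma pent_27_834 : pent4_size 27 834%num.
Proof.
apply: (@table_pent4 417 2 1 1 [::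
  1236; 2237; 2699; 3954; 4526; 5374; 5974; 7431; 7969; 8442; 9757; 10063;
  10959; 12008; 14716; 15204; 16092; 17482; 18232; 18645; 19857; 20501; 21536;
  22351; 23332; 23982; 24263; 25379; 26362; 26893; 27989; 28517; 29297; 30728;
  31154; 32154; 33087; 33624; 34926; 35378; 36931; 38173; 39170; 41684; 42180;
  42734; 43525; 45328; 47323; 48149; 49815; 50575; 51938; 53071; 53816; 54515;
  57248; 58166; 59195; 59697; 61203; 62309; 63229; 64118; 65336; 66381; 67149;
  67876; 69104; 69779; 70292; 72044; 72831; 75018; 75571; 76095; 78318; 78978;
  82190; 84094; 84869; 86501; 88839; 90705; 93231; 95036; 95718; 96671; 97268;
  98893; 99673; 102227; 102859; 103695; 105356; 107444; 109140; 109756;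
  110371; 113215; 114740; 116204; 118114; 119842; 123098; 124049; 125665;
  130593; 133120; 134046; 135606; 136675; 137567; 138391; 138904; 139771;
  142375; 143945; 146665; 148970; 150682; 154149; 154867; 157347; 158048;
  163268; 164011; 165717; 166678; 169043; 169819; 170562; 173386; 174116;
  349341; 350061; 353298; 357771; 359896; 361096; 361860; 366078; 368401;
  370969; 371683; 373301; 374174; 374919; 376052; 376612; 377766; 380135;
  380780; 383569; 387698; 388490; 392753; 394153; 395135; 404240; 406129;
  406724; 410259; 411028; 412791; 416979; 420996; 422527; 423493; 426107;
  427556; 430224; 439373; 440259; 442596; 443442; 444390; 445227; 448647;
  450304; 455260; 460959; 466172; 467764; 474325; 476922; 478583; 479437;
  483595; 485205; 489460; 490286; 491875; 494402; 498575; 501028; 501860;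
  503718; 505373; 507902; 511155; 518585; 519559; 520214; 521064; 525305;
  526916; 531244; 531971; 538577; 546267; 547843; 550432; 554559; 556272;
  558690; 559581; 561188; 564468; 566179; 572097; 573668; 576224; 581261;
  583776; 589628; 590409; 603794; 606269; 615433; 629653; 630446; 632995;
  1044601; 1046476; 1047987; 1048808; 1049877; 1052416; 1054133; 1054906;
  1055526; 1059006; 1059787; 1062241; 1068306; 1068859; 1070683; 1072397;
  1073286; 1074767; 1077304; 1078888; 1080673; 1086553; 1087431; 1088966;
  1095708; 1104802; 1109014; 1111481; 1114072; 1115658; 1116540; 1119952;
  1146596; 1147429; 1149106; 1154105; 1159955]%num);
vm_cast_no_check (erefl true).
Qed.

Lemma pent_27_858 : pent4_size 27 858%num.
Proof.
apply: (@table_pent4 429 2 1 1 [::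
  1076; 1771; 3250; 3749; 4466; 5950; 6361; 7432; 8379; 9115; 9594; 11060;
  11237; 12777; 13182; 13953; 14819; 15937; 16850; 17406; 18452; 19655; 20524;
  20973; 22008; 22532; 23453; 24162; 25052; 26433; 26904; 28292; 28462; 29810;
  30689; 31468; 32449; 33281; 34014; 34589; 35669; 36615; 37552; 38078; 38940;
  39807; 40804; 42797; 43633; 44378; 45301; 46837; 48739; 49185; 50330; 50750;
  51811; 52701; 53499; 54522; 55266; 56460; 58040; 58584; 61180; 62821; 65764;
  66413; 67512; 67945; 69332; 73703; 73962; 75205; 76828; 78532; 79708; 80585;
  81451; 81820; 83098; 83453; 86296; 87275; 88107; 89805; 90313; 91655; 92526;
  93245; 94034; 95939; 97585; 103446; 104337; 105520; 107011; 108100; 111403;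
  113239; 114951; 115708; 116649; 118299; 120938; 122980; 125954; 128330;
  130341; 131154; 132071; 133434; 135441; 138647; 139507; 141299; 142029;
  143145; 144642; 149090; 150773; 152368; 153271; 154223; 155077; 156000;
  156591; 158457; 159356; 160129; 163609; 165207; 166037; 166975; 167748;
  169491; 171596; 173065; 178992; 180896; 369757; 371120; 372052; 374787;
  375461; 377476; 379743; 382550; 383278; 384053; 386071; 388544; 389231;
  393463; 396156; 398028; 401471; 404035; 407543; 409220; 409966; 411479;
  413541; 414088; 415908; 416968; 421041; 422729; 424589; 430603; 432421;
  433027; 441800; 446829; 448692; 452161; 455410; 456165; 458800; 460632;
  463269; 465812; 466559; 468206; 469039; 471790; 472546; 475085; 476832;
  482147; 483036; 483797; 484506; 485441; 493305; 494119; 495031; 495836;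
  500205; 501917; 512879; 515601; 519945; 520805; 522286; 523251; 527623;
  538812; 540332; 541362; 549852; 554061; 555946; 557675; 560177; 561919;
  567920; 568705; 570483; 573925; 579055; 579971; 585017; 590196; 591874;
  596283; 597044; 597907; 610752; 622016; 624528; 628037; 641692; 649441;
  652874; 670029; 687208; 691505; 709556; 1105745; 1106767; 1108223; 1109223;
  1110762; 1114397; 1115148; 1116188; 1117677; 1118623; 1119474; 1122038;
  1125339; 1127214; 1128010; 1129018; 1129845; 1131427; 1133303; 1139195;
  1142574; 1143429; 1144279; 1153788; 1155657; 1156313; 1157140; 1158059;
  1159726; 1163276; 1165831; 1167624; 1170900; 1172802; 1178804; 1186399;
  1188200; 1212225; 1227655]%num);
vm_cast_no_check (erefl true).
Qed.

(** Here the multiplier 55 has order 5 modulo 633 = 3 * 211. *)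
Lemma pent_33_1266 : pent4_size 33 1266%num.
Proof.
apply: (@table_pent4 633 2 5 55 [::
  7404; 8219; 11239; 26540; 27474; 29986; 37977; 44481; 45899; 49298; 67656;
  73080; 78399; 82229; 88076; 89456; 90582; 94522; 99394; 102347; 104230;
  113049; 119816; 122486; 130795; 138457; 150545; 154833; 158550; 160714;
  161696; 193671; 205505; 265716; 267102; 267548; 295978; 302219; 346575;
  350638; 355295; 369485; 803481; 808375; 809879; 816550; 832887; 836477;
  863349; 903416; 911269; 946467; 979768; 983593; 991096; 1013845; 1036776;
  1038116; 1080917; 1087087; 1094734; 1122928; 1124173; 1127921; 1140626;
  1144218; 1202388; 1241745; 1255743; 1296375; 1411489; 1444476; 2412379;
  2449574; 2450689; 2471993; 2508876; 2517788; 2535504; 2543040; 2559593;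
  2563475; 2610241; 2672315]%num);
vm_cast_no_check (erefl true).
Qed.

Lemma pent_33_1446 : pent4_size 33 1446%num.
Proof.
apply: (@table_pent4 723 2 5 328 [::
  8518; 17489; 26177; 28878; 42267; 43859; 50434; 52805; 54557; 79753; 88183;
  89430; 101073; 107880; 117503; 123181; 130604; 132717; 135365; 138418;
  153563; 155094; 161078; 173368; 183043; 184158; 185538; 236438; 261275;
  292048; 326429; 346794; 348968; 350997; 365509; 368236; 372805; 389826;
  431687; 434906; 442053; 447910; 452526; 453454; 462686; 468387; 496883;
  1053942; 1067120; 1081246; 1092587; 1098691; 1118999; 1137545; 1190000;
  1224600; 1227090; 1229022; 1230280; 1244783; 1249297; 1259064; 1280656;
  1291034; 1328774; 1373357; 1392268; 1409712; 1424187; 1437014; 1448886;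
  1490766; 1506423; 1519387; 1520861; 1564423; 1584597; 1607787; 1714722;
  1719041; 1784197; 1802981; 2067765; 3155047; 3163717; 3179450; 3180751;
  3217182; 3254650; 3255947; 3260544; 3267586; 3292277; 3297865; 3322586;
  3486065]%num);
vm_cast_no_check (erefl true).
Qed.

Lemma pent_33_1506 : pent4_size 33 1506%num.
Proof.
apply: (@table_pent4 753 2 5 271 [::
  1578; 28956; 32735; 34098; 42337; 47031; 54364; 58990; 62108; 66127; 71785;
  80826; 84192; 101184; 114732; 119823; 120878; 126682; 131909; 139357;
  150392; 153934; 187882; 199992; 229857; 247773; 265028; 266482; 267620;
  271543; 282412; 289068; 299020; 305240; 314026; 352180; 358376; 378508;
  394323; 411053; 413416; 452891; 459044; 468064; 481322; 483099; 511365;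
  525378; 526680; 565849; 1180179; 1182165; 1193950; 1204644; 1227007;
  1242217; 1287264; 1332314; 1335535; 1352055; 1356823; 1365869; 1375908;
  1412234; 1427365; 1483271; 1495218; 1498308; 1505583; 1534318; 1545040;
  1602037; 1605123; 1617408; 1632358; 1647293; 1679039; 1743663; 1793551;
  1797976; 1819142; 1832555; 2010368; 2037519; 2073686; 2075163; 3404995;
  3431851; 3449932; 3457664; 3462077; 3464985; 3504247; 3523722; 3529970;
  3556952; 3568701; 3669865; 3674357; 3781315]%num);
vm_cast_no_check (erefl true).
Qed.

Lemma pent_33_1626 : pent4_size 33 1626%num.
Proof.
apply: (@table_pent4 813 2 5 10 [::
  11860; 14421; 14943; 20821; 39692; 55205; 66227; 90748; 99745; 107522;
  124773; 126620; 135228; 151511; 153406; 199604; 201503; 202992; 205274;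
  233356; 234665; 262668; 271406; 289825; 310384; 313366; 329378; 341909;
  349142; 360870; 366416; 375437; 412577; 418772; 441188; 450252; 451497;
  454831; 495144; 511849; 532845; 534221; 547521; 564148; 565154; 568784;
  573811; 586199; 599274; 618837; 620437; 622258; 643703; 649920; 654841;
  656304; 1370003; 1375151; 1386927; 1388157; 1409591; 1415641; 1417307;
  1428582; 1433498; 1438533; 1446682; 1471473; 1487491; 1495800; 1508829;
  1534744; 1591673; 1596579; 1599376; 1632243; 1664856; 1676309; 1710337;
  1720070; 1733138; 1784847; 1960601; 1972243; 2029001; 2123416; 2133136;
  2173814; 2178819; 2211148; 2302315; 2599949; 3974877; 3978351; 4005820;
  4009060; 4014289; 4066128; 4102211; 4118458; 4119816; 4152680; 4172044;
  4201207; 4256649; 4308661; 4332949; 4407815]%num);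
vm_cast_no_check (erefl true).
Qed.

(** The seed 6 * 288 + 4 of class 4. It serves only as a last group, so no 4-cycle is required. *)
Lemma pent_27_1732 : pent_size 27 1732%num.
Proof.
apply: (@table_pent 433 4 1 1 [::
  1964; 4925; 6789; 8559; 9926; 11268; 13839; 13885; 16671; 17957; 19682;
  21393; 23932; 24737; 26324; 29330; 30346; 31647; 33671; 35117; 39194; 40357;
  42225; 43506; 45258; 47521; 49998; 52220; 54622; 55996; 57714; 59588; 61872;
  63325; 64206; 66479; 67683; 70315; 71825; 73335; 75669; 76985; 79523; 80870;
  83088; 84279; 86427; 87845; 89876; 90778; 92248; 94346; 95734; 98482; 99913;
  101613; 102426; 104928; 107115; 108888; 109833; 112292; 113994; 115224;
  117144; 118283; 120850; 121934; 123252; 125888; 127958; 129828; 130441;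
  132617; 134223; 135286; 137476; 138751; 141259; 142294; 145335; 147178;
  150107; 152288; 153310; 157158; 158505; 160577; 161705; 163566; 165031;
  169041; 171039; 173103; 174053; 176172; 177370; 179481; 182735; 183847;
  185941; 187778; 189859; 191431; 196854; 198669; 200506; 202137; 204214;
  205135; 206998; 209287; 209839; 214653; 215427; 218220; 219890; 221219;
  223048; 224531; 226026; 228454; 229944; 231096; 232531; 236244; 238071;
  239937; 241997; 243692; 245377; 247467; 248806; 250823; 252810; 255175;
  256785; 261327; 261968; 264639; 267720; 269535; 270960; 273148; 274118;
  276232; 278673; 280303; 281765; 284976; 286217; 290576; 291791; 294070;
  295454; 297395; 299501; 302755; 303835; 306419; 307938; 312278; 316806;
  317965; 319314; 321858; 322807; 325003; 328641; 333219; 335037; 336963;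
  339907; 342858; 344363; 346396; 355010; 356572; 361030; 364406; 366467;
  367786; 369576; 371675; 373688; 375103; 751654; 759066; 763773; 764692;
  770693; 772328; 773839; 777409; 781814; 787454; 788608; 790576; 794972;
  795937; 799904; 802389; 804186; 806234; 809647; 811324; 815580; 819226;
  828589; 830788; 832869; 834404; 835534; 839095; 840819; 842375; 844172;
  846606; 850264; 853115; 855220; 856755; 858679; 860585; 861517; 865606;
  867080; 868313; 869990; 872743; 874226; 875481; 877061; 881528; 882557;
  886602; 887789; 889811; 891969; 893023; 894468; 896958; 900091; 901292;
  905728; 907452; 909251; 913329; 915180; 916816; 919459; 920911; 923046;
  923962; 926202; 931600; 935113; 940354; 941781; 943345; 944635; 947238;
  949036; 953307; 955585; 957348; 959351; 960728; 962799; 965779; 969105;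
  973043; 975051; 976552; 977426; 982742; 988216; 994065; 995149; 997126;
  998648; 1000283; 1003910; 1005884; 1008677; 1012553; 1014223; 1018332;
  1021292; 1022700; 1026357; 1028077; 1029852; 1031750; 1033306; 1036652;
  1038638; 1040877; 1041717; 1045576; 1049420; 1051316; 1054719; 1057966;
  1059424; 1063192; 1066781; 1067643; 1071247; 1075076; 1076317; 1078227;
  1088373; 1095790; 1099180; 1100840; 1102448; 1106536; 1107798; 1110047;
  1113596; 1115250; 1116956; 1118081; 1120264; 1125528; 1128330; 1137815;
  1140449; 1145818; 1153365; 1157743; 1161696; 1163030; 1167287; 1168766;
  1172561; 1175767; 1177641; 1179093; 1180979; 1183775; 1190660; 1195842;
  1198191; 1207189; 1208883; 1212103; 1214944; 1217385; 1219255; 1220891;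
  1227419; 1229438; 1232179; 1234895; 1239662; 1241334; 1246624; 1247992;
  1249618; 1253811; 1254927; 1257389; 1258249; 1261677; 1268866; 1276178;
  1279210; 1280752; 1284158; 1287882; 1294655; 1298525; 1300094; 1302050;
  1303561; 1307004; 1309065; 1317194; 1325893; 1328133; 1333626; 1334741;
  1340184; 1343795; 1349169; 1350164; 1352621; 1357383; 1363002; 1365938;
  1367966; 1369841; 1371711; 1372873; 1376844; 1377926; 1379963; 1381777;
  1386568; 1388517; 1390601; 1395299; 1400436; 1402029; 1404102; 1406136;
  1411121; 1414334; 1424544; 1428078; 1430229; 1431880; 1433992; 1435822;
  1438498; 1441006; 1443638; 1445545; 1447489; 1448794; 1450804; 1452813;
  1454726; 1461030; 1464794; 1468414; 1470090; 1472146; 1482416; 1484319;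
  1490556; 1492660; 1494044; 1495706; 1497808; 1499307; 1502689; 1504809;
  1506281; 1511302; 1513338; 1520285; 1522090; 1524001; 1527473; 1531011;
  1532236; 1537361; 1539384; 1541107; 1544684; 1545998; 1551809; 1555101;
  1556646; 1559838; 1561718; 1565683; 1567377; 1568647; 1570647; 1572013;
  1574159; 1584336; 1585970; 1590937; 1598389; 1601668; 1603443; 1605485;
  1606576; 1610313; 1613912; 1618688; 1620629; 1627944; 1632543; 1636236;
  1637693; 1639978; 1641671; 1647008; 1648623; 1660675; 1664422; 1669629;
  1670688; 1672702; 1681330; 1684798; 1690268; 1693187; 1695237; 1696679;
  1703978; 1705660; 1712434; 1714644; 1721407; 1726263; 1728484; 1736971;
  1740275; 1745795; 1750749; 1752335; 1762974; 1764711; 1769992; 1778675;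
  1781560; 1783756; 1785356; 1787137; 1788854; 1804272; 1813244; 1814841;
  1816252; 1818097; 1824942; 1830098; 1833589; 1835403; 1839080; 1840884;
  1842559; 1847430; 1854415; 1860045; 1868232; 1870100; 1873861; 1878699;
  1882336; 1884097; 1885608; 1891087; 1899446; 1903097; 1910338; 1915431;
  1920479; 1925943; 1928983; 1930565; 1932910; 1942815; 1946332; 1948256;
  1950018; 1965622; 1967286; 1975889; 1984311; 1991516; 1994806; 1998210;
  2000347; 2003817; 2008626; 2012559; 2013786; 2017367; 2022886; 2024462;
  2038296; 2039895; 2041681; 2043729; 2072809; 2077957; 2081413; 2088612;
  2090062; 2092158; 2114472; 2131972; 2133354; 2135464; 2150917; 2152747;
  2155894; 2161168; 2166705; 2168101; 2180520; 2188902; 2190593; 2192379;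
  2197617; 2209781; 2211612; 2218269; 2230717; 2239295; 2248015; 2251383;
  2259864; 2263448; 2272008; 2275441; 2279255; 2282506; 2292982; 2301808;
  2305241; 2313608; 2322605; 2332886; 2339764; 2341642; 2348554; 2351728;
  2353438; 2362185; 2365771; 2367559; 2374319; 2375973; 2384808; 2396795;
  2407424; 2417620; 2436857; 2438627; 2447252; 2455787; 2467857; 2495719;
  2519920; 2539021; 2544242; 2547585; 2559672; 2568439; 2570248; 2585702;
  2596069; 2601309; 2618783; 2632508; 2641287; 2670561; 2672389; 2693216;
  2698318; 2753845; 2785033; 3752568; 3754654; 3756593; 3758272; 3762965;
  3765210; 3766467; 3769510; 3773262; 3777003; 3780574; 3784275; 3785172;
  3787393; 3789461; 3790258; 3794485; 3796024; 3797577; 3799214; 3801455;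
  3802528; 3805153; 3807531; 3809482; 3812078; 3812784; 3815200; 3818827;
  3819671; 3822173; 3823821; 3825229; 3828434; 3830123; 3832091; 3834466;
  3837431; 3839450; 3844299; 3846246; 3847896; 3849064; 3850931; 3854919;
  3856462; 3857823; 3860152; 3862015; 3865245; 3866425; 3868467; 3870394;
  3877366; 3880644; 3883008; 3884778; 3887686; 3891524; 3892685; 3894782;
  3896576; 3898003; 3901750; 3903554; 3906410; 3910028; 3913773; 3916047;
  3917774; 3920476; 3923652; 3928119; 3929413; 3934072; 3936284; 3939448;
  3944476; 3946965; 3955620; 3958665; 3960422; 3962111; 3964523; 3969685;
  3972720; 3975673; 3993922; 3995311; 3997036; 3998396; 4000815; 4002460;
  4003878; 4007829; 4008989; 4012321; 4019343; 4024781; 4026212; 4036438;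
  4043646; 4049360; 4050374; 4052329; 4053891; 4055580; 4057579; 4061361;
  4063052; 4064778; 4066047; 4071407; 4078078; 4079729; 4082248; 4090573;
  4093714; 4097104; 4111326; 4115093; 4116941; 4118343; 4119950; 4501014;
  4507922; 4514514; 4516444; 4518042; 4523431; 4528700; 4531962; 4535906;
  4537760; 4542411; 4549552; 4551533; 4553088; 4554889; 4556536; 4558623;
  4559611; 4563045; 4565526; 4570447; 4573772; 4575741; 4582199; 4587687;
  4589472; 4592781; 4596540; 4606833; 4609983; 4615348; 4616948; 4618625;
  4620296; 4632460; 4634339; 4636233; 4639966; 4641756; 4648143; 4653805;
  4655482; 4656746; 4661784; 4667624; 4669371; 4672829; 4681524; 4682897;
  4689706; 4691461; 4695353; 4696817; 4700365; 4702336; 4703491; 4705766;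
  4707013; 4715501; 4724291; 4726056; 4736618; 4741930; 4746896; 4753673;
  4759301; 4760582; 4762749; 4764368; 4767531; 4769878; 4774587; 4781958;
  4783486; 4786902; 4788914; 4793742; 4795900; 4800594; 4802200; 4814827;
  4824944; 4836957; 4840756; 4842576; 4847804; 4852553; 4856067; 4861408;
  4863369; 4864999; 4873234; 4877088; 4880373; 4885449; 4894179; 4896227;
  4897762; 4910067; 4913067; 4920228; 4922086; 4923788; 4935992; 4946560;
  4949993; 4961981; 4963815; 4968961; 4970499; 4972463; 4974295; 4975563;
  4978924; 4980757; 4982474; 4984308; 4987657; 4989677; 4996348; 4999886;
  5001836; 5012365; 5017431; 5027805; 5032721; 5034586; 5036361; 5039791;
  5041708; 5050419; 5060794; 5062340; 5064249; 5065775; 5072561; 5076041;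
  5081603; 5083414; 5104193; 5109143; 5119602; 5133164; 5138521; 5142157;
  5149049; 5160939; 5171566; 5188699; 5190787; 5194016; 5197438; 5200807;
  5218210; 5221632; 5223493; 5227131; 5233879; 5245978; 5256339; 5258135;
  5261742; 5264874; 5268483; 5270408; 5275313; 5282579; 5284087; 5291117;
  5299566; 5320652; 5325531; 5334476; 5337770; 5342945; 5348132; 5351710;
  5358560; 5367111; 5372553; 5386482; 5408777; 5414037; 5419408; 5424382;
  5436484; 5450442; 5460827; 5462647; 5464311; 5466031; 5473078; 5474726;
  5493683; 5521545; 5540436; 5547493; 5557831; 5563123; 5573558; 5583854;
  5585548; 5587404; 5592575; 5615075; 5623654; 5642718; 5647851; 5654878;
  5658303; 5661869; 5684311; 5705195; 5724106; 5779651; 5786572; 5788261;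
  5798720; 5814236; 5918213; 7502415; 7504648; 7508063; 7509125; 7511541;
  7516504; 7518412; 7521804; 7526747; 7528887; 7531714; 7533378; 7535751;
  7538636; 7541024; 7542439; 7547826; 7549094; 7551245; 7555952; 7558219;
  7561851; 7566960; 7572013; 7589444; 7594462; 7604540; 7607953; 7613647;
  7616802; 7624067; 7627458; 7629126; 7649716; 7655388; 7658375; 7668940;
  7672421; 7674078; 7689747; 7700077; 7701965; 7705532; 7708778; 7715948;
  7717504; 7726078; 7727947; 7734538; 7736721; 7741717; 7743728; 7746991;
  7752134; 7755878; 7769390; 7778399; 7783263; 7786919; 7790512; 7804175;
  7821623; 7828482; 7831871; 7833413; 7840710; 7845918; 7849387; 7856076;
  7857711; 7863086; 7864917; 7866409; 7868262; 7869833; 7873563; 8256196;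
  8258025; 8275167; 8277130; 8280646; 8296277; 8318642; 8320378; 8325592;
  8337710; 8339253; 8356543; 8358476; 8366985; 8372471; 8393068; 8419105;
  8438152; 8445193; 8448415; 8458780; 8460632; 8462252; 8465956; 8486694;
  8490079; 8521277; 8535031; 8549130; 8559316; 8564660; 8578538; 8581820;
  8613180; 8620064; 8626995; 8663405; 8672094; 8710227; 8751665; 8782847;
  8789845; 8793290; 8808902; 8840049; 8874766; 11262867; 11268122; 11278552;
  11281940; 11289140; 11290706; 11294286; 11295868; 11299275; 11307872;
  11321781; 11323716; 11325427; 11337367; 11341001; 11344536; 11417203;
  11450073; 11462245]%num);
vm_cast_no_check (erefl true).
Qed.

Lemma pent_33_2908 : pent_size 33 2908%num.
Proof.
apply: (@table_pent 727 4 1 1 [::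
  3280; 6828; 10339; 11801; 14943; 17540; 21613; 23955; 27169; 31343; 34741;
  36590; 39690; 42495; 43935; 48865; 51045; 54570; 57914; 60229; 63223; 66395;
  68490; 71550; 75345; 76492; 81001; 82518; 86332; 89420; 91765; 94549; 96715;
  101704; 104513; 108432; 110698; 116082; 118151; 122062; 124772; 125724;
  131304; 135276; 140658; 144228; 147363; 148772; 152878; 154650; 159488;
  161981; 165478; 168559; 170864; 172549; 176395; 178256; 181795; 185132;
  186925; 191281; 194497; 195162; 198077; 203503; 204499; 207207; 211747;
  214724; 216505; 220206; 223041; 225396; 227348; 231081; 234771; 236394;
  241017; 243644; 245124; 248970; 253891; 258768; 261188; 266470; 272542;
  274431; 276864; 280989; 284636; 285194; 288279; 293489; 295717; 298404;
  300482; 304574; 306486; 310318; 311541; 316446; 318440; 321194; 324850;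
  331194; 332121; 335980; 339511; 341181; 347749; 351419; 354078; 356120;
  363494; 365938; 367566; 369580; 373792; 375706; 379388; 381389; 385678;
  387919; 392027; 395296; 397427; 403697; 406677; 407680; 410340; 414324;
  417166; 419273; 422801; 426405; 429549; 433148; 434034; 436562; 439639;
  443256; 448154; 451689; 458908; 462209; 463205; 467675; 470203; 472088;
  476285; 477865; 484950; 495536; 501510; 505527; 506972; 510968; 513019;
  516221; 518351; 522272; 525315; 527219; 531282; 534778; 537824; 539823;
  543039; 544740; 549012; 550645; 553794; 557648; 559765; 562855; 569772;
  574817; 578523; 580904; 584151; 588201; 594192; 597816; 604271; 606143;
  610407; 614427; 620808; 625021; 626851; 630445; 632323; 637937; 642246;
  644422; 647274; 650876; 653452; 656145; 659764; 662663; 665725; 667832;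
  671595; 673225; 679291; 682971; 686005; 688831; 691029; 692886; 696238;
  699557; 703373; 705737; 707475; 711098; 713657; 717903; 719189; 722674;
  726480; 729341; 732639; 734500; 738133; 743140; 746070; 748777; 751733;
  758588; 761811; 762797; 774572; 777451; 781854; 783126; 786251; 789186;
  792471; 796302; 799231; 801100; 803944; 806516; 813070; 816453; 828456;
  830154; 835724; 842941; 845027; 847909; 850459; 852943; 856350; 858727;
  861915; 865912; 867885; 870695; 878000; 879695; 883126; 886783; 888485;
  891363; 897914; 899636; 905968; 911186; 920847; 924107; 926447; 930442;
  932090; 934732; 941879; 946726; 952756; 961916; 964092; 967145; 972341;
  976647; 978506; 982534; 983845; 987834; 993436; 999605; 1002060; 1004246;
  1009047; 1013704; 1016449; 1022695; 1026458; 1028252; 1031950; 1038991;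
  1042276; 1045408; 1049407; 1051666; 1057047; 2121222; 2125584; 2126849;
  2130078; 2133722; 2136282; 2142069; 2146020; 2148847; 2152847; 2156342;
  2163521; 2165464; 2167379; 2171458; 2173381; 2182140; 2187672; 2192217;
  2195370; 2205436; 2208399; 2211758; 2214531; 2216894; 2220535; 2223716;
  2229914; 2232297; 2238596; 2240074; 2244177; 2246541; 2252088; 2255730;
  2257849; 2260540; 2267523; 2270406; 2273215; 2279175; 2281115; 2287140;
  2289789; 2292482; 2300106; 2302043; 2305160; 2307697; 2314671; 2317559;
  2319130; 2322765; 2327805; 2332156; 2333737; 2336142; 2338842; 2341948;
  2354074; 2359415; 2363662; 2369684; 2372498; 2374265; 2377812; 2381422;
  2382980; 2385878; 2393207; 2394268; 2398310; 2401504; 2403222; 2406766;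
  2411618; 2421788; 2426633; 2435045; 2439029; 2444049; 2449631; 2452583;
  2460021; 2468505; 2470787; 2473754; 2482391; 2494279; 2500839; 2501804;
  2506625; 2509301; 2511082; 2513424; 2518117; 2532203; 2538092; 2540220;
  2545805; 2549332; 2552758; 2554696; 2559008; 2560910; 2564720; 2566688;
  2569155; 2574887; 2580829; 2584430; 2587428; 2589156; 2592120; 2595228;
  2598191; 2600958; 2608247; 2609829; 2612966; 2618734; 2625069; 2628142;
  2632936; 2637231; 2640278; 2645156; 2647831; 2651268; 2662533; 2665741;
  2669428; 2676373; 2679422; 2682902; 2686633; 2692755; 2695100; 2700333;
  2702537; 2705884; 2708613; 2711477; 2715148; 2718025; 2719999; 2724035;
  2726205; 2729312; 2736213; 2742044; 2752852; 2755785; 2759030; 2764918;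
  2766902; 2775896; 2778792; 2781131; 2785331; 2790025; 2796885; 2799475;
  2803185; 2805844; 2807393; 2811419; 2813126; 2820548; 2823340; 2825595;
  2829222; 2832103; 2835280; 2836561; 2839233; 2847955; 2854469; 2861048;
  2878235; 2880979; 2882842; 2889913; 2892894; 2894847; 2906517; 2913005;
  2915448; 2922126; 2929718; 2935293; 2942409; 2957366; 2958984; 2968412;
  2971374; 2991230; 2993843; 2998042; 3009379; 3017833; 3020734; 3024076;
  3025629; 3032135; 3035154; 3040659; 3043307; 3047200; 3048818; 3054839;
  3058908; 3060810; 3064998; 3066937; 3069465; 3075541; 3078709; 3080749;
  3086872; 3089383; 3092337; 3099174; 3104923; 3107604; 3119318; 3122023;
  3128623; 3130899; 3136109; 3146355; 3159718; 3180189; 3188299; 3192842;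
  3195047; 3197598; 3201288; 3206966; 3209100; 3218613; 3222038; 3223978;
  3227811; 3230243; 3233416; 3235619; 3238409; 3241587; 3245189; 3246792;
  3249430; 3256509; 3259720; 3265136; 3267581; 3270416; 3276184; 3279925;
  3285564; 3287961; 3293031; 3299575; 3302394; 3304670; 3308847; 3311582;
  3322677; 3326535; 3329353; 3332063; 3340411; 3342630; 3346001; 3349219;
  3355479; 3363810; 3367409; 3373139; 3376095; 3378119; 3384691; 3390214;
  3392166; 3396166; 3398348; 3401645; 3405070; 3406635; 3415337; 3427130;
  3434115; 3436753; 3441876; 3445744; 3447362; 3451673; 3453846; 3456563;
  3458907; 3461839; 3468038; 3476357; 3485096; 3487900; 3491893; 3493974;
  3498009; 3511992; 3518507; 3520397; 3528692; 3534975; 3538034; 3541404;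
  3547017; 3548988; 3559083; 3560843; 3565156; 3575235; 3578688; 3582021;
  3584154; 3588203; 3592900; 3595938; 3602218; 3613653; 3619514; 3622872;
  3627829; 3631568; 3634608; 3639315; 3643540; 3648650; 3651398; 3654158;
  3660359; 3663468; 3665725; 3672418; 3675436; 3684135; 3686361; 3689493;
  3691560; 3701227; 3704021; 3710334; 3716338; 3718340; 3723982; 3728046;
  3729827; 3733669; 3736184; 3741311; 3750508; 3756928; 3761608; 3764405;
  3777128; 3783037; 3787877; 3794716; 3800278; 3815043; 3828967; 3851929;
  3855507; 3858562; 3860346; 3872371; 3885066; 3895919; 3899546; 3902139;
  3905388; 3908023; 3915545; 3927247; 3931455; 3933677; 3939392; 3945670;
  3948515; 3951019; 3954072; 3956543; 3966362; 3967958; 3970958; 3983902;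
  3985492; 3989394; 3995282; 4002897; 4008664; 4012237; 4014773; 4018197;
  4023369; 4026261; 4029737; 4032745; 4044097; 4049918; 4064616; 4069719;
  4079450; 4082122; 4090749; 4095939; 4102300; 4105334; 4108837; 4110750;
  4113895; 4116836; 4119671; 4128699; 4130878; 4139910; 4142583; 4149218;
  4155124; 4163280; 4166903; 4171671; 4175737; 4180900; 4193038; 4195560;
  4212622; 4215878; 4232724; 4235813; 4238480; 4241356; 4248226; 4256022;
  4262661; 4276530; 4285817; 4288152; 4308394; 4311316; 4314061; 4319942;
  4322937; 4325914; 4329267; 4337485; 4352170; 4364800; 4366522; 4372929;
  4384809; 4390035; 4393124; 4399550; 4410908; 4419557; 4428204; 4431356;
  4439827; 4442123; 4445293; 4448447; 4453791; 4466263; 4471813; 4480639;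
  4483531; 4486024; 4500563; 4506131; 4510063; 4515087; 4521650; 4524390;
  4526781; 4532428; 4536230; 4548107; 4556682; 4559389; 4564554; 4567313;
  4570056; 4574135; 4579705; 4582677; 4588489; 4593357; 4600428; 4612010;
  4616821; 4626048; 4634373; 4640616; 4645819; 4649295; 4657543; 4660546;
  4666520; 4692745; 4700984; 4710826; 4724713; 4733380; 4737078; 4738928;
  4750942; 4754534; 4756980; 4765545; 4771963; 4773687; 4776629; 4782582;
  4791425; 4795090; 4803541; 4812384; 4814777; 4843928; 4846424; 4849976;
  4853356; 4855641; 4858869; 4864818; 4866806; 4869804; 4873134; 4879500;
  4885342; 4887678; 4902020; 4910466; 4922906; 4946197; 4948315; 4957380;
  4977312; 4986879; 4989956; 5001280; 5013214; 5030218; 5033653; 5039377;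
  5048033; 5082246; 5085311; 5088401; 5091411; 5097375; 5108608; 5111156;
  5123178; 5129187; 5137882; 5140978; 5143400; 5155053; 5157896; 5161638;
  5163929; 5169984; 5172974; 5175721; 5184545; 5195534; 5199172; 5205034;
  5213931; 5216035; 5219276; 5221671; 5227485; 5231455; 5274938; 5283281;
  5285716; 5292533; 5294693; 5315288; 5317771; 5320885; 5335896; 5355596;
  5373965; 5379428; 5384711; 5387493; 5391330; 5399543; 5402188; 5417132;
  5422691; 5435017; 5457393; 5466530; 5472042; 5474822; 5478591; 5484166;
  5496020; 5498814; 5504750; 5510077; 5515772; 5521583; 5524309; 5530487;
  5547732; 5559546; 5579567; 5585644; 5591533; 5626120; 5655340; 5658822;
  5660975; 5667390; 5678619; 5690007; 5696508; 5705358; 5736778; 5743042;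
  5745354; 5754747; 5760469; 5762740; 5783093; 5789222; 5797978; 5801238;
  5803966; 5809711; 5812359; 5836033; 5841821; 5847945; 5850080; 5859416;
  5873404; 5879912; 5891127; 5917173; 5920569; 5940215; 5943329; 5952272;
  5954845; 5969631; 5984092; 5987468; 6007390; 6010540; 6024914; 6039223;
  6045665; 6053804; 6056834; 6059535; 6065829; 6077445; 6117806; 6147245;
  6155587; 6164869; 6167563; 6173367; 6191082; 6193743; 6202624; 6210874;
  6213776; 6219489; 6222889; 6272367; 6306908; 6312635; 6321546; 6324412;
  6333613; 6347754; 6353316; 6362571; 6376717; 6382490; 6417750; 6420210;
  6426593; 6440718; 6472805; 6478912; 6490319; 6496425; 6531247; 6568716;
  6574658; 6580223; 6586160; 6594771; 6597940; 6624137; 6629814; 6641309;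
  6662188; 6685316; 6720358; 6731911; 6754863; 6758033; 6775181; 6781136;
  6816169; 6827939; 6830547; 6833572; 6871092; 6891476; 6903165; 6906249;
  6915135; 6938360; 6944124; 6978700; 6984957; 7019792; 7022372; 7028183;
  7031373; 7048804; 7054402; 7066024; 7089666; 7109929; 7112778; 7138949;
  7159481; 7173841; 7182456; 7185655; 7197068; 7199985; 7202879; 7246518;
  7260995; 7263834; 7307498; 7316246; 7328139; 7330969; 7354150; 7363053;
  7371436; 7380502; 7386241; 7388886; 7412149; 7490799; 7511104; 7540307;
  7586747; 7601505; 7607253; 7612888; 7630379; 7674015; 7679849; 7711871;
  7726413; 7735037; 7741095; 7758472; 7778706; 7802113; 7863224; 7874840;
  7898021; 7932921; 7993934; 8084192; 8136561; 8203450; 8217999; 8363404;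
  10575065; 10578340; 10581258; 10583696; 10587586; 10593322; 10600439;
  10604729; 10607994; 10610796; 10613872; 10616767; 10618996; 10621415;
  10625243; 10627948; 10629872; 10633711; 10636902; 10641274; 10648959;
  10650915; 10656724; 10660351; 10665548; 10668635; 10670629; 10676324;
  10682848; 10687992; 10691874; 10702591; 10709533; 10716911; 10720173;
  10726494; 10729366; 10735538; 10741220; 10744418; 10747845; 10755658;
  10760577; 10765261; 10766765; 10770803; 10772871; 10779296; 10785195;
  10799672; 10801800; 10805165; 10807449; 10813900; 10820282; 10823422;
  10826460; 10828757; 10832157; 10833950; 10836906; 10840291; 10845640;
  10847938; 10850808; 10858422; 10859455; 10862409; 10866757; 10884487;
  10886602; 10889437; 10892768; 10895897; 10900758; 10907303; 10909372;
  10912668; 10919416; 10922296; 10923931; 10933199; 10935067; 10938116;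
  10945125; 10950642; 10954223; 10956469; 10962101; 10968257; 10970627;
  10973893; 10976578; 10978734; 10983059; 10985212; 10988151; 10993789;
  11000740; 11002100; 11006429; 11009264; 11014821; 11018313; 11024195;
  11032778; 11038559; 11043510; 11046264; 11048981; 11051670; 11061675;
  11067039; 11075605; 11084405; 11087867; 11089681; 11093117; 11096093;
  11102715; 11104927; 11119290; 11127634; 11130539; 11134231; 11137196;
  11139310; 11147975; 11150452; 11180207; 11183682; 11187004; 11204132;
  11216023; 11218388; 11221327; 11224688; 11227554; 11229349; 11236189;
  11242300; 11244234; 11247447; 11253663; 11255447; 11267474; 11270003;
  11273105; 11276943; 11279634; 11282791; 11285930; 11287852; 11294632;
  11297023; 11302685; 11304997; 11320137; 11323425; 11337332; 11341133;
  11343644; 11346570; 11348596; 11357313; 11381882; 11384321; 11386946;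
  11389997; 11392857; 11395278; 11402133; 11406733; 11410343; 11416610;
  11421650; 11429999; 11439717; 11442945; 11445377; 11456897; 11463333;
  11468478; 11471527; 11474048; 11486186; 11489172; 11492138; 11494390;
  11500991; 11503887; 11512292; 11515033; 11527071; 11532190; 11535166;
  11538813; 11550081; 11561882; 11564840; 11570927; 11573718; 11575603;
  11578635; 11581804; 11590034; 11593793; 11595949; 11598643; 11602108;
  11616024; 11619018; 11622167; 11628856; 12687224; 12695444; 12697855;
  12702122; 12703773; 12712611; 12718968; 12722155; 12730874; 12735860;
  12742747; 12745739; 12750979; 12756753; 12759095; 12767934; 12777385;
  12779854; 12792101; 12797036; 12799658; 12802646; 12815537; 12826644;
  12832682; 12838010; 12840587; 12849515; 12851968; 12855710; 12858852;
  12864788; 12887358; 12890771; 12896007; 12902492; 12905242; 12907504;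
  12913997; 12922411; 12924698; 12927603; 12936399; 12948331; 12950905;
  12956937; 12959658; 12968420; 12975237; 12980759; 13000614; 13004057;
  13009072; 13012060; 13018824; 13021091; 13027316; 13030185; 13039186;
  13050191; 13058650; 13062421; 13067353; 13070255; 13088078; 13091196;
  13094106; 13096561; 13100027; 13106295; 13108863; 13110917; 13123702;
  13125560; 13137299; 13146080; 13149509; 13160584; 13163416; 13169887;
  13175255; 13181171; 13184682; 13192505; 13201635; 13204972; 13207488;
  13210422; 13213089; 13216840; 13219661; 13222347; 13230409; 13239630;
  13253897; 13263332; 13271974; 13274945; 13285879; 13288368; 13292122;
  13294311; 13297360; 13304027; 13306405; 13312363; 13318204; 13340872;
  13347244; 13349697; 13361656; 13373812; 13376784; 13381827; 13405783;
  13407690; 13413473; 13417069; 13420146; 13431745; 13433908; 13436700;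
  13440086; 13454757; 13462898; 13466470; 13469328; 13472290; 13486883;
  13492321; 13494989; 13507256; 13512395; 13533561; 13541567; 13545410;
  13553534; 13562089; 13570775; 13573604; 13580267; 13582966; 13591373;
  13603240; 13606520; 13608868; 13617746; 13631634; 13634951; 13637909;
  13646375; 13649556; 13658566; 13661008; 13672372; 13678477; 13687594;
  13705322; 13707334; 13710488; 13719488; 13736905; 13751324; 13757231;
  13766083; 13774603; 13777399; 13780502; 13786378; 13789360; 13795324;
  13815782; 13823661; 13829883; 13841204; 13847639; 13861738; 13864628;
  13867276; 13873756; 13885453; 13896426; 13911498; 13922558; 13928549;
  13934659; 13952315; 13955458; 13958109; 13966359; 13975509; 13981344;
  13983843; 13989594; 13998533; 14004020; 14010349; 14013339; 14015854;
  14024463; 14044927; 14047957; 14050722; 14059559; 14065243; 14074650;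
  14080525; 14097809; 14099933; 14129949; 14135120; 14138331; 14149424;
  14158837; 14166897; 14175966; 14185056; 14193047; 14196653; 14210768;
  14216524; 14234139; 14237286; 14242901; 14251356; 14271928; 14283993;
  14297762; 14306828; 14309487; 14326976; 14330615; 14333215; 14356530;
  14376794; 14379480; 14382401; 14399873; 14408933; 14417344; 14420642;
  14437924; 14446143; 14469928; 14472722; 14478448; 14490557; 14498920;
  14504490; 14507766; 14510253; 14513268; 14524778; 14545602; 14548391;
  14565562; 14568314; 14574847; 14589023; 14618024; 14629446; 14664302;
  14679102; 14731493; 14737255; 14740288; 14766816; 14769443; 14772519;
  14801467; 14804179; 14815820; 14818935; 14839124; 14871400; 14903162;
  14911790; 14926594; 14940961; 14946712; 14958365; 14966928; 14970032;
  14981756; 14987436; 14990429; 15001833; 15008043; 15019341; 15037041;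
  15042538; 15063296; 15072014; 15097761; 15127041; 15136072; 15179170;
  15185345; 15194000; 15205616; 15234981; 15240475; 15258212; 15263577;
  15269843; 15310285; 15318947; 15324761; 15330797; 15339402; 15351150;
  15354202; 15374211; 15444005; 15447253; 15452734; 15455958; 15487995;
  15551894; 15563563; 15577708; 15583545; 15598398; 15656291; 15659503;
  15679666; 15697185; 15720425; 15723473; 15737936; 15778646; 15839757;
  15906614; 15970578; 15987907; 16028796; 16040369; 16057916; 16060646;
  16063575; 16104415; 16116121; 16121931; 16136394; 16156761; 16188670;
  16194505; 16203284; 16278929; 16299151; 16392379; 16401000; 16438878;
  16470875; 16502795; 16520279; 16622032; 16750039; 21148632; 21155570;
  21163853; 21166519; 21187395; 21198846; 21201230; 21203813; 21206875;
  21213142; 21221639; 21228297; 21233933; 21239698; 21254086; 21257368;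
  21265261; 21271000; 21288296; 21300857; 21306221; 21311732; 21328920;
  21332511; 21340856; 21347280; 21364673; 21370374; 21382147; 21390773;
  21396914; 21408378; 21422388; 21428448; 21431286; 21434283; 21436638;
  21443359; 21446385; 21454952; 21480541; 21492117; 21501355; 21509859;
  21532701; 21548086; 21550954; 21555913; 21558757; 21562421; 21571142;
  21577118; 21588744; 21591223; 21599689; 21603050; 21606324; 21611906;
  21615087; 21631711; 21637354; 21643595; 21655563; 21664561; 21681341;
  21687855; 21690666; 21699054; 21701948; 21710772; 21713732; 21727994;
  21734129; 21736720; 21739824; 21745358; 21757345; 21765690; 21780341;
  21789227; 21794455; 21800588; 21806722; 21821325; 21832766; 21859245;
  21861890; 21865092; 21879231; 21897157; 21902872; 21905703; 21911594;
  21914167; 21923077; 21934870; 21940405; 21943547; 21949039; 21977994;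
  21999014; 22004512; 22010238; 22024991; 22036545; 22045438; 22056967;
  22080302; 22089164; 22091535; 22094391; 22100166; 22117791; 22126354;
  22129439; 22164430; 22167626; 22170420; 22187802; 22190884; 22193349;
  23257910; 23263624; 23281330; 23287047; 23292456; 23295753; 23298283;
  23304626; 23306942; 23322157; 23373904; 23414960; 23420731; 23426644;
  23443682; 23446670; 23450107; 23458283; 23461485; 23478585; 23516636;
  23534352; 23540036; 23542598; 23554195; 23571756; 23592419; 23603664;
  23621603; 23653499; 23682407; 23705810; 23717311; 23726329; 23728736;
  23732083; 23749509; 23757991; 23772877; 23795769; 23804445; 23807280;
  23830738; 23836678; 23868804; 23909155; 23912154; 23920985; 23932583;
  23935478; 23944262; 23952941; 23976381; 23984878; 23996767; 23999674;
  24008317; 24028685; 24121767; 24127664; 24130441; 24162183; 24171248;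
  24197273; 24229071; 24246602; 24328267; 24351417; 24389076; 24409490;
  24421282; 24438810; 24450384; 24455998; 24473576; 24485216; 24514225;
  24537571; 24540371; 24546290; 24569556; 24584142; 24592795; 24697515;
  24732488; 24749915; 24825529; 24848784; 24915682; 24938883; 24944811;
  25017450; 25023330; 25087231; 25090142; 25244318; 31716962; 31723153;
  31725719; 31743052; 31746323; 31769496; 31795753; 31824940; 31839579;
  31871113; 31882736; 31900681; 31955546; 31981926; 31987608; 31996607;
  32045889; 32089489; 32092506; 32112710; 32115627; 32150467; 32269770;
  32275633; 32316350]%num);
vm_cast_no_check (erefl true).
Qed.

Lemma pent_15_460 : pent_size 15 460%num.
Proof.
apply: (@table_pent 115 4 1 1 [::
  819; 1228; 1556; 1919; 2594; 3095; 3372; 4026; 4290; 5028; 5415; 5874; 6037;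
  6560; 6931; 8056; 8590; 8974; 9524; 9794; 10268; 10841; 11267; 11695; 12351;
  12646; 13249; 13639; 13986; 14844; 15525; 15856; 16554; 17420; 17720; 18212;
  19305; 19639; 20183; 20984; 21554; 22034; 22196; 22708; 23423; 23893; 24086;
  24584; 24979; 25545; 26004; 53081; 54173; 54495; 56011; 56400; 56840; 59196;
  59597; 60018; 60696; 60932; 62508; 62947; 63382; 63735; 64681; 65514; 66044;
  66623; 67332; 68067; 68704; 70828; 71241; 71579; 72416; 72842; 73575; 73957;
  74238; 75167; 76149; 77262; 78180; 80233; 80925; 81727; 82757; 83059; 85363;
  86678; 87336; 87737; 88148; 88684; 90951; 92746; 93351; 94612; 95011; 96079;
  96517; 96921; 97448; 98242; 98783; 100111; 101133; 101638; 102564; 102880;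
  103294; 103748; 106222; 106536; 107166; 109310; 111107; 111729; 112113;
  113603; 115437; 116306; 116787; 118096; 119052; 122239; 122683; 123198;
  123650; 124051; 125057; 125873; 126470; 126856; 128167; 130040; 130559;
  131534; 136081; 136576; 136961; 138912; 142581; 144364; 144889; 145271;
  146648; 148486; 149958; 150345; 150794; 153060; 157710; 158615; 159981;
  160946; 161376; 162318; 175255; 179352; 180741; 185371; 186713; 189015;
  193624; 199159; 265410; 265708; 266060; 267102; 267550; 267889; 268498;
  268836; 269902; 270214; 270666; 271336; 272016; 274125; 274540; 274909;
  275250; 277638; 278110; 278613; 279045; 280059; 281915; 282373; 283178;
  284209; 285642; 286000; 288371; 290493; 318316; 320043; 320891; 322409;
  323293; 325214; 325666; 326014; 326956; 327389; 329221; 331121; 331972;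
  332856; 333389; 333824; 334228; 335684; 337002; 337941; 339420; 340808;
  341317; 344048; 345904; 346831; 347713; 349103; 349978; 352219; 352683;
  355029; 357374; 359232; 360150; 361436; 361898; 362865; 363833; 364697;
  365183; 366122; 367932; 372098; 373045; 373891; 376261; 378034; 378986;
  380849; 382194; 383156; 384484; 384995; 388197; 390054; 395578; 396476;
  401559; 404780; 407066; 417678; 529759; 530793; 531298; 531554; 536217;
  536745; 537694; 538966; 539435; 539940; 541317; 543671; 544086; 544620;
  545914; 551458; 552374; 554199; 582270; 582779; 583211; 585094; 592425;
  592930; 594693; 596125; 597007; 599362; 611777; 613148; 615916; 617284;
  796646; 799413; 801743; 804017]%num);
vm_cast_no_check (erefl true).
Qed.

Lemma pent_13_546 : pent4_size 13 546%num.
Proof.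
apply: (@table_pent4 273 2 3 16 [::
  1863; 2193; 3538; 4622; 6743; 10135; 13602; 17855; 19588; 19866; 23079;
  24003; 24299; 25494; 28500; 31302; 32132; 32892; 33673; 34259; 36995; 42984;
  49101; 49868; 52255; 53809; 55494; 56594; 58707; 60481; 65278; 68072; 69844;
  71397; 151162; 157697; 163133; 169130; 179532; 188332; 192576; 197031;
  197482; 199199; 202514; 207468; 207882; 219409; 230873; 237465; 238034;
  239083; 248373; 262039; 268618; 449136; 449899; 450740; 451842; 454093;
  467202; 470547; 471128; 476056; 478719; 480408]%num);
vm_cast_no_check (erefl true).
Qed.

Lemma pent_13_558 : pent4_size 13 558%num.
Proof.
apply: (@table_pent4 279 2 3 25 [::
  1188; 1752; 2486; 3586; 9791; 11020; 12411; 13458; 16962; 17467; 18741;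
  19523; 20538; 24770; 25252; 26979; 28578; 31594; 32789; 38288; 41166; 41826;
  49458; 49969; 52080; 54052; 56848; 60684; 61347; 64520; 66153; 71252; 76187;
  158902; 159930; 173342; 175038; 177397; 179597; 186277; 190676; 196400;
  197385; 198605; 201988; 203541; 208041; 208629; 212013; 228140; 230439;
  233206; 235961; 237120; 240944; 243745; 244902; 301873; 468650; 469203;
  469586; 470720; 479767; 480954; 484764; 492617; 494241; 495993]%num);
vm_cast_no_check (erefl true).
Qed.

Lemma pent_13_582 : pent4_size 13 582%num.
Proof.
apply: (@table_pent4 291 2 3 61 [::
  619; 2766; 3708; 4189; 8463; 9571; 11987; 13477; 15933; 16610; 17667; 19751;
  23448; 26067; 26715; 33509; 34547; 40345; 41160; 45576; 46934; 51674; 52848;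
  54618; 55047; 56648; 58719; 67952; 70803; 72640; 74251; 76609; 77803; 80752;
  81805; 172606; 176213; 184476; 184846; 193094; 198873; 201292; 206007;
  212365; 214664; 215166; 216999; 226301; 238616; 251867; 252496; 265273;
  265888; 273444; 281656; 287492; 289801; 310180; 321836; 509214; 511950;
  512634; 517737; 519617; 521986; 524190; 525951; 542856; 548708; 553962]%num);
vm_cast_no_check (erefl true).
Qed.

Lemma pent_13_618 : pent4_size 13 618%num.
Proof.
apply: (@table_pent4 309 2 3 46 [::
  2025; 8131; 9357; 11617; 13038; 14002; 14964; 15848; 16433; 19762; 20738;
  21198; 22177; 22397; 25599; 27167; 28828; 31064; 32741; 33912; 35746; 39095;
  40065; 41814; 42615; 43586; 44075; 46078; 48521; 56698; 57227; 63860; 72135;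
  73470; 75188; 81510; 86295; 89463; 192164; 200111; 205737; 208066; 208721;
  210599; 225387; 229035; 230299; 232875; 235959; 236459; 240312; 240900;
  255131; 259442; 264419; 267510; 278717; 279276; 284204; 294658; 318220;
  331224; 574437; 575190; 581454; 582702; 586443; 588228; 594364; 595639;
  598622; 604290; 604961; 612340]%num);
vm_cast_no_check (erefl true).
Qed.

Lemma pent_19_1374 : pent4_size 19 1374%num.
Proof.
apply: (@table_pent4 687 2 3 94 [::
  3501; 7781; 9803; 14975; 19313; 24198; 26990; 30038; 35061; 38285; 39076;
  43755; 45729; 47812; 48242; 49969; 51725; 54191; 55512; 59060; 63598; 64797;
  66249; 72429; 73957; 78924; 82296; 82644; 84122; 89000; 93892; 95178;
  101368; 103557; 117602; 118591; 123228; 126811; 129106; 131818; 136500;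
  141360; 143232; 149607; 157543; 170647; 174786; 177142; 183701; 194837;
  201808; 212730; 218989; 246656; 264990; 266183; 267696; 270599; 273877;
  303192; 307695; 315104; 322541; 326427; 355400; 366179; 376271; 388447;
  393948; 401039; 410183; 419026; 421482; 435070; 436659; 442278; 450557;
  463728; 468313; 953212; 957477; 967281; 981896; 986063; 990412; 994570;
  995726; 998895; 1002488; 1009526; 1013568; 1016514; 1019185; 1020418;
  1023094; 1046733; 1049582; 1052351; 1074136; 1076679; 1092121; 1108353;
  1109794; 1115506; 1133429; 1142789; 1145587; 1185652; 1200546; 1205883;
  1210057; 1214170; 1222790; 1233823; 1240577; 1255624; 1258518; 1259729;
  1272045; 1284375; 1316272; 1338128; 1355939; 1380842; 1402778; 1405496;
  1419334; 1446521; 1449275; 1453494; 1481061; 1494761; 1509904; 1552616;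
  1589602; 1611537; 1626684; 1761427; 2842628; 2871084; 2878176; 2881161;
  2882183; 2886208; 2887636; 2896044; 2897594; 2912715; 2915484; 2916755;
  2926228; 2927691; 2935806; 2951011; 2959285; 2968839; 2975852; 3003417;
  3007525; 3106362]%num);
vm_cast_no_check (erefl true).
Qed.

Lemma pent_19_1422 : pent4_size 19 1422%num.
Proof.
apply: (@table_pent4 711 2 3 292 [::
  12114; 14799; 15715; 24976; 30327; 36018; 38203; 39042; 53331; 54432; 56435;
  57981; 60930; 61743; 63614; 70004; 76781; 80010; 84484; 86633; 93848; 94471;
  100669; 101280; 111226; 115704; 124612; 127500; 133519; 138492; 139906;
  154035; 159543; 169749; 171150; 173041; 182433; 190889; 208634; 216919;
  227018; 233146; 240056; 267715; 275754; 282393; 287650; 292433; 298574;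
  300005; 300860; 305215; 306626; 316920; 319565; 325435; 335570; 336981;
  337488; 339454; 342189; 348179; 355058; 361007; 378996; 396159; 403712;
  407662; 408900; 415102; 427828; 428842; 436528; 443025; 444532; 470459;
  477582; 481450; 487714; 490168; 504591; 1030689; 1031871; 1042161; 1046413;
  1049150; 1053503; 1063404; 1064557; 1067579; 1070722; 1084827; 1087811;
  1100347; 1116056; 1124204; 1152916; 1168772; 1170295; 1202600; 1204188;
  1218398; 1224124; 1226803; 1238420; 1254136; 1255131; 1262436; 1266961;
  1276626; 1280784; 1301128; 1312013; 1329326; 1346265; 1349241; 1369180;
  1399075; 1409041; 1413370; 1440131; 1444392; 1457491; 1497260; 1525649;
  1532811; 1562686; 1565418; 1579645; 1593991; 1620957; 1625105; 1662117;
  1663557; 1710567; 1757538; 1764666; 1780260; 1894081; 1908323; 1928222;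
  3048199; 3063966; 3068062; 3069655; 3072321; 3088226; 3095140; 3103949;
  3113858; 3117919; 3121049; 3127847; 3135263; 3149289; 3173452; 3187773;
  3193645; 3203354; 3204798; 3216275; 3224889; 3301693; 3321588]%num);
vm_cast_no_check (erefl true).
Qed.

Lemma pent_19_1446 : pent4_size 19 1446%num.
Proof.
apply: (@table_pent4 723 2 3 256 [::
  2695; 4380; 19784; 21499; 23976; 27727; 30650; 32997; 35330; 39555; 47307;
  49986; 52462; 55209; 59271; 63348; 76101; 76905; 78832; 82129; 83583; 86163;
  91599; 92986; 94610; 100866; 104541; 107153; 111954; 113313; 117699; 119489;
  134327; 139587; 142439; 144909; 146420; 148425; 159792; 167562; 178182;
  184829; 190495; 193074; 194988; 203284; 209150; 214837; 221668; 225362;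
  225903; 227779; 232287; 234220; 239061; 252617; 260678; 264284; 275711;
  284654; 293202; 300124; 307311; 313373; 324798; 330164; 336317; 340761;
  342691; 347930; 348968; 354060; 361094; 368461; 377388; 379597; 384106;
  390202; 417553; 420354; 433267; 442027; 472327; 481506; 494136; 518837;
  523323; 1064079; 1079499; 1089879; 1108661; 1117434; 1124863; 1136185;
  1139353; 1169427; 1178115; 1190895; 1207314; 1217261; 1232932; 1246359;
  1250425; 1260759; 1266346; 1310060; 1311361; 1362076; 1364691; 1373327;
  1390832; 1395149; 1403916; 1411109; 1418295; 1437298; 1439797; 1452808;
  1471839; 1496606; 1503633; 1512377; 1516548; 1523725; 1536992; 1561678;
  1589014; 1602111; 1620803; 1629476; 1643988; 1662875; 1664276; 1672755;
  1699041; 1707545; 1736636; 1785718; 1787070; 1800229; 1855195; 1885571;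
  1952009; 3142119; 3151701; 3165060; 3171922; 3176376; 3189506; 3192545;
  3214244; 3228480; 3229986; 3231255; 3237302; 3241575; 3244749; 3248627;
  3282211; 3283593; 3290672; 3308029; 3315477; 3358781; 3363225; 3376104;
  3397882; 3467260]%num);
vm_cast_no_check (erefl true).
Qed.

Lemma pent_19_1482 : pent4_size 19 1482%num.
Proof.
apply: (@table_pent4 741 2 3 178 [::
  1969; 4151; 5263; 7313; 7736; 12972; 15468; 17812; 31235; 36326; 40395;
  47243; 60693; 61511; 62352; 63992; 67474; 69865; 72410; 91527; 95917; 96664;
  99459; 107226; 117314; 123898; 125927; 128738; 132314; 133662; 141671;
  152626; 154408; 161887; 163783; 165418; 169404; 173693; 183364; 185807;
  187275; 192332; 195021; 199501; 207424; 213368; 218891; 225240; 228043;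
  231699; 235064; 240464; 252948; 257671; 277010; 277946; 279523; 288517;
  296272; 297798; 312554; 318607; 322039; 332470; 354135; 358219; 365494;
  366548; 380649; 384755; 388173; 410201; 414253; 450123; 460440; 463206;
  469762; 472289; 473526; 479546; 497542; 500193; 509799; 510691; 523076;
  527423; 530284; 543588; 1105522; 1128659; 1151235; 1168606; 1177845;
  1182145; 1192336; 1205866; 1223849; 1225014; 1251696; 1266497; 1296208;
  1321737; 1327705; 1330383; 1337892; 1340667; 1352767; 1362941; 1371933;
  1388301; 1407566; 1410756; 1415157; 1435939; 1450454; 1453390; 1465451;
  1475997; 1487479; 1489087; 1508566; 1511450; 1539456; 1540968; 1548426;
  1555716; 1581152; 1582380; 1603476; 1634470; 1656736; 1677530; 1695301;
  1708666; 1720481; 1748655; 1770733; 1788757; 1797447; 1810986; 1853981;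
  1965119; 2003625; 2010985; 2064384; 2089556; 2120731; 3296964; 3310150;
  3313736; 3335628; 3351946; 3359471; 3365458; 3392029; 3395164; 3398006;
  3402222; 3412889; 3427539; 3429156; 3449920; 3457266; 3464574; 3469180;
  3480786; 3516361; 3526809; 3535834; 3569831; 3617334; 3627658]%num);
vm_cast_no_check (erefl true).
Qed.

Lemma pent_25_2382 : pent4_size 25 2382%num.
Proof.
apply: (@table_pent4 1191 2 3 34 [::
  3982; 7754; 10197; 26589; 35768; 58534; 60920; 62853; 74120; 77596; 87828;
  100994; 112249; 114949; 118917; 119540; 125591; 127824; 129751; 132645;
  143053; 152187; 153105; 155657; 159304; 178631; 179684; 213704; 215257;
  229141; 250023; 263786; 268937; 270404; 278283; 295928; 302030; 306994;
  311214; 315889; 349865; 352528; 356136; 358155; 360554; 370238; 385372;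
  397746; 408699; 414935; 417766; 427855; 441483; 445084; 449855; 456290;
  458109; 465909; 468391; 475307; 485519; 490550; 493786; 499476; 502591;
  503377; 515467; 522621; 526342; 528422; 529593; 539167; 542277; 547053;
  556253; 569007; 587458; 598820; 607287; 630395; 654060; 669186; 684246;
  692021; 696336; 708075; 719076; 723668; 728036; 743967; 752216; 783116;
  787548; 794565; 805852; 808708; 822986; 835496; 847921; 875447; 904754;
  914261; 928045; 944776; 946448; 957121; 978269; 1004548; 1007251; 1020820;
  1037591; 1045190; 1062224; 1081036; 1128626; 1137954; 1152458; 1154547;
  1163639; 1168928; 1175754; 1180468; 1218546; 1259610; 1262124; 1281401;
  1328355; 1330838; 1361715; 1393448; 1400405; 1407627; 1417030; 2858305;
  2879545; 2881542; 2901088; 2928720; 2947851; 2964930; 2977097; 2979450;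
  3001221; 3012253; 3026708; 3036811; 3043730; 3045508; 3081459; 3091228;
  3133779; 3145600; 3157736; 3162639; 3189001; 3201245; 3220138; 3226758;
  3229255; 3231493; 3236925; 3286201; 3298722; 3315286; 3319962; 3322792;
  3324366; 3339000; 3352963; 3372011; 3383951; 3438815; 3441170; 3455581;
  3484863; 3494280; 3565335; 3579448; 3582493; 3638928; 3644173; 3675163;
  3691650; 3730005; 3741996; 3749218; 3772623; 3784601; 3803421; 3827466;
  3851047; 3877480; 3884772; 3891942; 3899063; 3901582; 3906438; 3918002;
  3932626; 3934465; 3986977; 4027661; 4032357; 4041950; 4058607; 4082491;
  4089579; 4108299; 4120535; 4144291; 4163345; 4182291; 4213504; 4246859;
  4266128; 4335175; 4346925; 4359019; 4361293; 4382706; 4508851; 4534957;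
  4539956; 4728021; 4880564; 4892579; 4920931; 4980704; 5059146; 5076017;
  5497639; 5604822; 5607226; 8519809; 8522131; 8539094; 8548975; 8574305;
  8586863; 8612404; 8624974; 8627039; 8631978; 8640827; 8656115; 8665123;
  8667336; 8690959; 8726861; 8741567; 8788986; 8808200; 8872229; 8881605;
  8927443; 8929377; 8953310; 8970039; 9015306; 9027041; 9034182; 9041505;
  9050991; 9110463; 9196577; 9208312; 9220398; 9255981]%num);
vm_cast_no_check (erefl true).
Qed.

Lemma pent_25_2394 : pent4_size 25 2394%num.
Proof.
apply: (@table_pent4 1197 2 3 121 [::
  7548; 31924; 39853; 42454; 46749; 51680; 57170; 58151; 66892; 78549; 80119;
  82072; 85752; 96121; 108270; 112428; 119446; 121042; 122732; 127544; 142633;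
  155237; 164091; 166992; 167778; 171335; 172773; 183479; 187576; 196058;
  197769; 206213; 208555; 213577; 225934; 236734; 237822; 240865; 246174;
  248777; 262327; 265649; 282397; 288254; 299524; 305628; 316566; 320696;
  322322; 337451; 339493; 348604; 351774; 376796; 391523; 394709; 400145;
  419939; 424379; 438702; 441934; 449208; 451984; 453201; 461877; 468318;
  477993; 480022; 487423; 489300; 502709; 505563; 525012; 528129; 531295;
  541899; 547450; 548951; 567155; 573847; 575937; 577764; 594544; 602442;
  605156; 611186; 628123; 633889; 648165; 652719; 666951; 672103; 675699;
  688772; 691705; 696296; 702089; 714714; 765045; 773098; 775272; 779375;
  801725; 806600; 851645; 884610; 931025; 949707; 956004; 966165; 1024087;
  1040828; 1053240; 1067027; 1071760; 1078965; 1091257; 1093936; 1103267;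
  1126995; 1180193; 1198667; 1208289; 1218000; 1220446; 1256490; 1263160;
  1296790; 1315941; 1328241; 1342220; 1345165; 1349054; 1357174; 1371245;
  1385384; 2888759; 2907945; 2914783; 2934698; 2939700; 2958662; 2973334;
  2975105; 3020102; 3075863; 3101738; 3121604; 3135225; 3144772; 3163909;
  3168913; 3171867; 3187843; 3191190; 3195549; 3219125; 3224337; 3242906;
  3245280; 3257257; 3344125; 3365081; 3381751; 3387443; 3435029; 3448933;
  3461637; 3468337; 3511266; 3537591; 3550299; 3559678; 3571267; 3595386;
  3609267; 3621851; 3626056; 3631071; 3633237; 3636028; 3652927; 3666812;
  3683878; 3698305; 3717744; 3719671; 3734565; 3736643; 3741812; 3791834;
  3811225; 3822819; 3866248; 3921279; 3926074; 3951769; 3975914; 3978446;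
  4009674; 4011997; 4023946; 4033656; 4072118; 4079227; 4098044; 4107573;
  4143784; 4174985; 4193680; 4196364; 4211045; 4222512; 4294272; 4354488;
  4358925; 4373572; 4454790; 4631975; 4653490; 4691935; 4694263; 4718445;
  4725622; 4828676; 4897824; 4938518; 4989079; 5044090; 5163770; 5171005;
  5273820; 5561222; 5628267; 8606067; 8629581; 8656033; 8677166; 8680002;
  8694687; 8720755; 8725521; 8766700; 8771283; 8785214; 8804889; 8807336;
  8811892; 8823480; 8835537; 8885674; 8898349; 8914830; 8940825; 8974325;
  8998866; 9017384; 9022522; 9051168; 9086904; 9104164; 9123027; 9137633;
  9139663; 9146978; 9175633; 9192376; 9209257; 9274047; 9300336]%num);
vm_cast_no_check (erefl true).
Qed.

Lemma pent_25_2418 : pent4_size 25 2418%num.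
Proof.
apply: (@table_pent4 1209 2 3 211 [::
  7211; 8382; 22281; 34491; 36440; 41011; 42660; 43681; 50870; 53711; 59564;
  62803; 64395; 66421; 82939; 84752; 93023; 95756; 103830; 106699; 117684;
  122200; 133287; 138209; 140612; 158105; 164247; 168840; 178429; 184342;
  192762; 202466; 209343; 214897; 220841; 239036; 243524; 246876; 251835;
  258249; 268327; 276677; 280231; 286840; 315749; 322195; 328500; 333112;
  339834; 349007; 356035; 360817; 365043; 383024; 391151; 404529; 421484;
  425375; 428539; 436107; 450688; 463972; 493726; 510791; 542991; 544599;
  576828; 588443; 593760; 603316; 615982; 618579; 625843; 640018; 662263;
  667314; 671437; 713243; 715008; 724430; 726177; 729258; 740799; 762528;
  796809; 800084; 807274; 808946; 812108; 819604; 838258; 840372; 859939;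
  869900; 871719; 874494; 882383; 888886; 893935; 901772; 932490; 947718;
  949766; 975260; 997880; 1024186; 1029911; 1044165; 1053675; 1060444;
  1066028; 1087055; 1090313; 1117090; 1121607; 1135517; 1179789; 1182385;
  1200897; 1215387; 1223265; 1229554; 1237494; 1271132; 1283392; 1326992;
  1368287; 1372913; 1382114; 1396587; 1404399; 1423055; 1438673; 1445574;
  2929588; 2935133; 2940049; 2954544; 2959244; 2960969; 2975643; 2981021;
  3007653; 3053144; 3058235; 3077923; 3087062; 3091625; 3101474; 3108962;
  3111526; 3123857; 3168951; 3184497; 3188940; 3193541; 3212803; 3223187;
  3229616; 3231810; 3249522; 3256704; 3258960; 3263561; 3273754; 3312324;
  3345799; 3360947; 3387310; 3396497; 3418133; 3432733; 3450284; 3486550;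
  3488820; 3513055; 3527447; 3529839; 3531851; 3544092; 3555969; 3573567;
  3604483; 3624034; 3629203; 3641407; 3682181; 3725593; 3732869; 3750267;
  3793293; 3830053; 3841457; 3884942; 3899831; 3907294; 3948445; 3960671;
  4020980; 4032988; 4059703; 4091190; 4100839; 4105066; 4132184; 4158907;
  4235983; 4272185; 4279840; 4344606; 4349662; 4359133; 4390920; 4405212;
  4422171; 4489689; 4494663; 4514120; 4603722; 4610647; 4637583; 4661821;
  4673559; 4683416; 4712634; 4751254; 4772976; 4777882; 4792084; 4937554;
  5072871; 5096881; 5128287; 5218006; 5234805; 5440403; 5662932; 8778633;
  8793756; 8805731; 8808619; 8815889; 8823211; 8836682; 8854023; 8857047;
  8863287; 8878633; 8905252; 8910004; 8912438; 8928804; 8955774; 9019002;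
  9023717; 9047245; 9093630; 9120025; 9127508; 9132400; 9153726; 9175754;
  9192658; 9207057; 9221498; 9265526; 9282320; 9316230; 9359452; 9511827;
  9533631; 9565229]%num);
vm_cast_no_check (erefl true).
Qed.

Lemma pent_25_2454 : pent4_size 25 2454%num.
Proof.
apply: (@table_pent4 1227 2 3 355 [::
  18822; 22572; 29040; 35080; 38502; 44445; 47171; 58173; 64854; 69354; 84528;
  87757; 89920; 96711; 98702; 106310; 117672; 119020; 125038; 128284; 132113;
  132630; 145335; 156410; 157325; 165873; 167900; 171475; 173098; 199730;
  204975; 225432; 231688; 236482; 254972; 257223; 276089; 277937; 286441;
  296386; 302139; 309888; 323807; 324624; 330159; 336500; 341549; 346519;
  360249; 361314; 364149; 370454; 372471; 387268; 391657; 401481; 413209;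
  421172; 424891; 440548; 447672; 451924; 457701; 464599; 472139; 475050;
  480391; 510940; 530730; 536824; 582866; 594579; 598577; 600510; 605538;
  640276; 650182; 653344; 691087; 702713; 706271; 709087; 720649; 723721;
  733587; 786531; 794829; 796898; 803815; 821651; 834115; 836130; 868316;
  873332; 887649; 889786; 916879; 929807; 949471; 956249; 963429; 965709;
  976554; 1001100; 1004504; 1010688; 1015435; 1022543; 1030297; 1049293;
  1059228; 1074319; 1108137; 1111520; 1120254; 1148113; 1157576; 1170295;
  1182279; 1191959; 1228584; 1243106; 1290769; 1294774; 1359067; 1381261;
  1395945; 1398226; 1400190; 1403109; 1410921; 1422786; 1449899; 1464958;
  1471890; 1474339; 1501366; 3037912; 3042592; 3057449; 3076165; 3083643;
  3091326; 3111593; 3133078; 3157492; 3167821; 3182276; 3195081; 3206624;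
  3214400; 3239241; 3314483; 3317199; 3329480; 3339368; 3351870; 3354281;
  3373633; 3375767; 3380959; 3425248; 3442424; 3469795; 3535959; 3570359;
  3577481; 3599959; 3621679; 3636158; 3646077; 3660480; 3678185; 3690189;
  3707212; 3709898; 3719603; 3727255; 3734732; 3769096; 3783976; 3788457;
  3793104; 3805649; 3810403; 3837693; 3856925; 3906354; 3908565; 3933618;
  3970226; 3982028; 4014503; 4016789; 4051380; 4053247; 4060801; 4068272;
  4083412; 4087659; 4102445; 4107669; 4119994; 4124874; 4149543; 4198220;
  4205948; 4207917; 4262167; 4267036; 4304251; 4328245; 4375130; 4414228;
  4426625; 4431282; 4539299; 4542057; 4593372; 4618408; 4630590; 4635195;
  4654976; 4686770; 4770288; 4807313; 4809776; 4831719; 4925091; 4978891;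
  5001019; 5030312; 5076953; 5087131; 5204749; 5226949; 5258722; 5263565;
  5327574; 5693249; 9057237; 9069274; 9081728; 9098408; 9103726; 9118006;
  9130771; 9133286; 9140405; 9162612; 9168084; 9179924; 9201540; 9233527;
  9265386; 9270410; 9312408; 9337296; 9344274; 9358992; 9371661; 9376430;
  9381278; 9395937; 9398011; 9447131; 9459994; 9481394; 9498830; 9506017;
  9545760; 9565242; 9629027; 9688078; 9695453; 9736889]%num);
vm_cast_no_check (erefl true).
Qed.

(** The seed 6 * 100 + 2 of class 2; it is also inflated by 3 for w = 39. *)
Lemma pent_13_602 : pent_size 13 602%num.
Proof.
apply: (@table_pent 301 2 3 79 [::
  5236; 6092; 7957; 8506; 9708; 11389; 11985; 13996; 16410; 21843; 25460;
  27916; 28808; 29456; 31680; 34075; 34780; 41750; 43248; 45741; 48129; 52924;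
  53553; 54668; 55925; 57043; 63604; 64760; 67793; 76331; 77559; 83546; 88258;
  90221; 183530; 186580; 190759; 191766; 194922; 197933; 204076; 207621;
  209961; 213514; 217285; 227978; 228669; 231589; 232211; 240676; 247853;
  282332; 291873; 295474; 299788; 306362; 326854; 353966; 550166; 551916;
  552572; 553780; 557927; 560333; 565745; 569358; 571722; 585603]%num);
vm_cast_no_check (erefl true).
Qed.

Lemma pent_19_1406 : pent_size 19 1406%num.
Proof.
apply: (@table_pent 703 2 3 26 [::
  7575; 10929; 11711; 12897; 16145; 19543; 21725; 24021; 29862; 36039; 37330;
  50987; 61331; 65542; 66386; 74356; 81531; 90834; 100536; 102630; 102837;
  106024; 109662; 110786; 113230; 116436; 120622; 124139; 131934; 135197;
  136692; 141362; 145285; 146668; 149968; 156297; 165270; 167046; 174299;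
  174697; 185390; 195885; 200178; 210267; 212229; 214045; 218834; 229089;
  234791; 242258; 263651; 279568; 282281; 286717; 289467; 294907; 301812;
  306299; 307853; 314366; 327440; 339623; 348560; 377680; 380712; 383271;
  389331; 395066; 404227; 407543; 412870; 427311; 429809; 432418; 462181;
  466268; 474629; 486311; 492095; 994029; 996853; 1002065; 1003284; 1009404;
  1012286; 1013329; 1038889; 1044287; 1046862; 1068344; 1069890; 1071256;
  1104584; 1109033; 1111896; 1116069; 1117648; 1120316; 1121873; 1136909;
  1161133; 1173520; 1190487; 1223118; 1224302; 1225663; 1232624; 1269377;
  1287850; 1317061; 1352291; 1353758; 1365136; 1366207; 1373434; 1404379;
  1415472; 1464965; 1473478; 1517001; 1533803; 1535299; 1538161; 1553391;
  1588598; 1591343; 1594313; 1595598; 1618068; 1644970; 1671663; 1713739;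
  1775735; 1785526; 1808046; 1833399; 2973150; 2977453; 2979080; 2981458;
  2987130; 2990460; 2995871; 3016941; 3032485; 3069172; 3071611; 3090065;
  3101511; 3111114; 3112544; 3122606; 3140775; 3161782; 3165928; 3180191;
  3184243; 3208238]%num);
vm_cast_no_check (erefl true).
Qed.

Lemma pent_25_2426 : pent_size 25 2426%num.
Proof.
apply: (@table_pent 1213 2 3 217 [::
  9352; 15129; 17330; 54101; 69387; 73663; 87632; 91142; 98160; 101087;
  102344; 108260; 109316; 113845; 116413; 117561; 122638; 125098; 127088;
  141465; 144587; 146404; 170524; 174014; 176485; 180939; 187144; 200247;
  204814; 224018; 252258; 265800; 277508; 289384; 303663; 309010; 311901;
  314227; 318465; 330263; 334667; 336062; 345498; 357950; 368445; 375362;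
  383035; 391604; 394986; 404182; 415747; 418814; 421900; 425805; 436063;
  439034; 453314; 456871; 462462; 466178; 469079; 482763; 513726; 514772;
  520592; 527380; 532678; 539999; 550331; 551366; 555289; 559414; 564232;
  565902; 569597; 588868; 598681; 607128; 617661; 634482; 646235; 652577;
  656808; 690928; 696008; 717459; 722135; 729666; 731027; 734020; 736490;
  739585; 755721; 763270; 778547; 781168; 782713; 806241; 816922; 853207;
  885219; 901824; 915427; 945363; 947899; 950185; 958213; 966915; 979758;
  992175; 993842; 1008494; 1012975; 1027668; 1047293; 1059172; 1093914;
  1105166; 1124798; 1127480; 1144909; 1190205; 1238617; 1263664; 1274976;
  1284948; 1292991; 1299568; 1309727; 1336167; 1343179; 1374702; 1379472;
  1416361; 1418810; 1426468; 2951892; 2970945; 3019330; 3027037; 3084745;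
  3095480; 3109538; 3121265; 3123806; 3135999; 3158633; 3230404; 3269207;
  3276563; 3286486; 3306589; 3308442; 3327967; 3351855; 3369408; 3378846;
  3388743; 3390709; 3403656; 3417509; 3444587; 3452028; 3478003; 3502777;
  3512470; 3515092; 3517095; 3539074; 3544167; 3563655; 3595016; 3599356;
  3609073; 3621314; 3628900; 3636521; 3647954; 3670106; 3706245; 3716171;
  3718387; 3728072; 3757251; 3762093; 3842230; 3859389; 3875995; 3897994;
  3944076; 3965904; 3975842; 3980306; 3987954; 4007261; 4012487; 4021986;
  4031542; 4048891; 4065911; 4097100; 4104452; 4143160; 4150180; 4158054;
  4184645; 4192023; 4211148; 4218378; 4354085; 4356492; 4359101; 4366509;
  4388330; 4429561; 4504846; 4509767; 4514662; 4516827; 4536317; 4608889;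
  4613872; 4621234; 4623715; 4635936; 4638201; 4657805; 4728172; 4815296;
  4842127; 5014285; 5053216; 5101663; 5191450; 5259448; 8844629; 8847281;
  8883305; 8902567; 8917716; 8926600; 8932122; 8939709; 8946023; 8955908;
  8970649; 8975416; 8999826; 9002146; 9017177; 9033478; 9053098; 9106374;
  9118763; 9133602; 9137961; 9147918; 9160385; 9220369; 9244756; 9286133;
  9296238; 9298190; 9344704; 9356361; 9380905; 9395487; 9436762; 9475303;
  9560366; 9635595; 9744794]%num);
vm_cast_no_check (erefl true).
Qed.

Lemma pent_27_894 : pent4_size 27 894%num.
Proof.
apply: (@table_pent4 447 2 1 1 [::
  904; 2043; 3034; 4385; 5254; 6020; 6599; 7900; 10024; 11407; 11874; 12761;
  13864; 15086; 15935; 16803; 17569; 18395; 19118; 20327; 21303; 21991; 22574;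
  23876; 24398; 25136; 26114; 26958; 27995; 28913; 30094; 31216; 31761; 32461;
  33214; 34335; 35017; 36026; 36814; 38135; 38812; 40204; 40560; 41508; 42890;
  43463; 44624; 44889; 46408; 47202; 47747; 49002; 49683; 50646; 51315; 52509;
  52982; 54217; 55333; 55809; 57684; 58446; 60249; 61569; 62241; 63218; 63947;
  64590; 65418; 66445; 67235; 70401; 71459; 72211; 73182; 76255; 77239; 78013;
  79221; 80211; 81600; 83718; 84879; 87534; 89905; 91081; 91684; 94704; 96265;
  102574; 103505; 104378; 106111; 108481; 110535; 112338; 113480; 114146;
  115811; 117089; 117784; 118729; 119645; 120462; 123108; 126510; 128414;
  129208; 130306; 131034; 133504; 136472; 137463; 138319; 140970; 144418;
  147244; 148198; 150094; 151031; 151809; 153551; 154373; 155375; 156970;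
  164434; 165198; 171514; 173368; 175795; 177758; 179398; 182029; 183072;
  184148; 185794; 187468; 188493; 190946; 194458; 195430; 196379; 197210;
  401128; 401981; 403928; 404736; 405608; 409310; 411068; 413840; 416415;
  417250; 417977; 420041; 421062; 425438; 427197; 427910; 429685; 431588;
  436876; 438792; 439767; 442339; 445079; 446062; 446759; 449643; 451327;
  454114; 454941; 455609; 460249; 462152; 466628; 467269; 470151; 471756;
  477963; 480026; 480659; 484244; 485346; 488726; 492480; 494058; 495252;
  498575; 501413; 502298; 503136; 506658; 513735; 523720; 531688; 534607;
  537047; 539716; 545292; 548737; 549600; 550552; 554978; 555815; 558684;
  561430; 564995; 568341; 572123; 573027; 574719; 576414; 586294; 590869;
  593503; 594328; 595376; 604297; 611291; 613146; 619533; 621273; 623834;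
  625736; 626653; 627459; 630169; 632027; 632866; 641776; 648897; 650802;
  651693; 654389; 671373; 694546; 700892; 707131; 710723; 711549; 713318;
  719635; 721438; 722273; 736600; 740182; 747367; 751851; 767914; 774198;
  1200633; 1201283; 1205672; 1209403; 1211131; 1212033; 1218199; 1221899;
  1223653; 1224704; 1225515; 1226460; 1228083; 1231691; 1232727; 1233395;
  1234502; 1235282; 1236283; 1237863; 1239693; 1240534; 1244309; 1245921;
  1246818; 1250406; 1252317; 1254857; 1257587; 1259362; 1263966; 1264927;
  1265689; 1266688; 1276363; 1277378; 1293443; 1307736; 1332805]%num);
vm_cast_no_check (erefl true).
Qed.

Lemma pent_27_906 : pent4_size 27 906%num.
Proof.
apply: (@table_pent4 453 2 1 1 [::
  1205; 2583; 2972; 3842; 5275; 6196; 6375; 7609; 8469; 9862; 10546; 11099;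
  12123; 13360; 14404; 15299; 15998; 17024; 18099; 18940; 19426; 20599; 21220;
  22417; 23493; 25168; 25706; 27031; 27481; 28275; 29448; 31050; 32030; 33002;
  33621; 34576; 35628; 36756; 37288; 38664; 39221; 40459; 41608; 42576; 42830;
  43829; 44922; 45494; 46590; 47352; 49252; 50463; 51128; 52255; 53428; 53816;
  54709; 57259; 58123; 59751; 60501; 62423; 64115; 65861; 66660; 69019; 70348;
  71559; 72055; 73253; 74245; 74558; 75785; 76380; 77807; 78526; 80058; 80837;
  81898; 85069; 87626; 88092; 89477; 93142; 95443; 96732; 97540; 99418;
  101276; 105870; 108674; 110996; 112822; 114997; 115829; 116529; 117768;
  118678; 119555; 120342; 122058; 122904; 123832; 124966; 128235; 132206;
  132879; 135601; 137108; 139290; 142193; 143123; 146671; 147669; 150325;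
  151121; 151911; 153607; 154753; 155408; 156317; 157421; 158363; 159439;
  159987; 161857; 163654; 166556; 169008; 173783; 175706; 177351; 178425;
  179035; 181815; 185331; 187277; 190180; 196229; 197178; 199135; 201030;
  201974; 202787; 203819; 204712; 412070; 412889; 417360; 418138; 419352;
  420266; 421848; 422717; 423792; 424848; 425766; 426716; 427608; 429290;
  430115; 430992; 432870; 442832; 444562; 448079; 449071; 450962; 452034;
  452877; 453782; 454580; 456295; 458364; 459259; 461087; 463593; 464556;
  465595; 466214; 469138; 469956; 474657; 476189; 478011; 479949; 482745;
  484344; 486237; 487245; 488191; 490719; 491599; 493742; 497119; 498860;
  500775; 509951; 511701; 512651; 513415; 514286; 515438; 518931; 527038;
  528098; 530886; 533472; 536988; 537924; 546123; 548995; 549915; 551535;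
  554275; 557068; 565267; 566176; 567817; 571482; 573482; 583278; 585979;
  595167; 596032; 598645; 603364; 606041; 606841; 614088; 615124; 618592;
  624153; 627746; 632224; 646710; 661379; 663113; 665832; 670418; 674030;
  681222; 691163; 700335; 703003; 703939; 708453; 734710; 744727; 747436;
  771877; 778252; 782765; 789113; 1232768; 1233806; 1234627; 1235570; 1238476;
  1239055; 1240008; 1242817; 1243606; 1245438; 1257218; 1259069; 1260088;
  1262752; 1264426; 1265620; 1266478; 1267239; 1269205; 1270898; 1274541;
  1275355; 1277316; 1278033; 1279084; 1280810; 1282560; 1285311; 1286231;
  1289120; 1290069; 1291822; 1300929; 1306268; 1308072; 1311646; 1312680;
  1313432; 1319929; 1368815]%num);
vm_cast_no_check (erefl true).
Qed.

Lemma in_consP (T : eqType) (P : T -> Prop) a (l : seq T) :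
  P a -> {in l, forall x, P x} -> {in a :: l, forall x, P x}.
Proof. by move=> Pa Pl x; rewrite inE => /predU1P[->|/Pl]. Qed.

Local Open Scope N_scope.

(** * The eight values of w *)

(** The second window is empty: XV = (2 * 68873 + 14) / 6 = 22960 already exceeds A1 + 3 * A0 + 15 =
    18401, so every required size of class 2 comes from one more filling. The same happens for w =
    19 and w = 25. *)
Definition cert_13 : certificate := Certificate 2
  [:: 91; 93; 97; 103] [:: 100]
  [::
    (3,91); (3,93); (3,97); (3,103); (4,91); (4,97); (4,103); (3,273);
    (3,291); (3,279); (3,309); (3,455); (3,457); (3,479); (3,485); (3,467);
    (3,491); (3,503); (3,509); (3,461); (3,515); (3,481); (3,505); (4,481);
    (4,457); (4,505); (4,515); (4,455); (4,479); (4,491); (3,691); (4,467);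
    (4,485); (4,503); (3,685); (4,509); (4,461); (3,837); (3,819); (3,873);
    (3,927); (4,685); (4,691); (3,1185); (3,1209); (3,1191); (3,1203);
    (3,1221); (3,1297); (3,1329); (3,1243); (3,1275); (3,1183); (3,1515);
    (3,1545); (3,1455); (4,1213); (4,1231); (4,1249); (4,1201); (4,1261);
    (3,1333); (3,1473); (3,1219); (3,1245); (3,1311); (3,1339); (3,1365);
    (3,1509); (3,1239); (3,1383); (3,1443); (4,1189); (4,1219); (4,1237);
    (3,1273); (3,1293); (3,1527); (3,1225); (3,1257); (4,1183); (3,1207);
    (3,1231); (3,1309); (3,1327); (3,1401); (3,1437); (3,1919); (3,1795);
    (4,1931); (4,1765); (4,1825); (3,2189); (4,1855); (4,2891); (4,2407);
    (4,2093); (4,2909)]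
  [::
    (3,91); (4,91); (3,93); (3,97); (4,97); (3,103); (4,103); (3,273);
    (3,279); (3,291); (3,309); (3,455); (3,457); (3,461); (3,467); (3,479);
    (3,481); (3,485); (3,491); (3,503); (3,505); (3,509); (3,515); (4,455);
    (4,457); (4,481); (4,505); (4,503); (4,479); (4,509); (4,461); (4,467);
    (4,485); (4,491); (4,515); (3,685); (3,691); (3,819); (4,685); (3,927)]
  103 5079 15253 3149 22960 0.

Lemma cert_13_ok : certified cert_13.
Proof. by vm_cast_no_check (erefl true). Qed.

Lemma pentD_13 x d : 22960 <= x -> d = 0 \/ d = 2 ->
  pentD_size 13 (6 * x + d)%num.
Proof.
apply: (certified_pentD cert_13_ok).
  apply: in_consP; first exact pent_13_546.
  apply: in_consP; first exact pent_13_558.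
  apply: in_consP; first exact pent_13_582.
  apply: in_consP; last by []; exact pent_13_618.
apply: in_consP; last by []; exact pent_13_602.
Qed.

(** XV lies below A1 + 3 * A0 + 15 = 4135, so the sizes of class 4 in between are read off the bits,
    and L1 = 2127 fills exactly this gap. *)
Definition cert_15 : certificate := Certificate 4
  [:: 37; 39; 41; 43; 45; 61; 63] [:: 76]
  [::
    (3,37); (3,39); (3,41); (3,43); (3,45); (4,37); (4,41); (4,43); (3,61);
    (4,61); (3,63); (3,111); (3,123); (3,129); (3,117); (3,135); (3,183);
    (3,201); (3,215); (3,205); (3,191); (3,225); (3,211); (3,227); (3,213);
    (3,187); (3,189); (3,203); (3,207); (3,209); (3,217); (4,211); (4,215);
    (4,187); (4,185); (4,191); (3,333); (4,233); (4,281); (4,205); (3,351);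
    (4,355); (4,307); (3,507); (4,533); (3,573); (4,481)]
  [::
    (4,37); (3,39); (3,41); (4,41); (3,43); (4,43); (3,45); (3,61); (4,61);
    (3,63); (3,117); (3,111); (3,123); (3,129); (3,135); (3,183); (3,193);
    (3,187); (3,201); (3,189); (3,203); (3,205); (3,185); (3,191); (3,207);
    (3,215); (3,209); (4,185); (4,187); (4,191); (4,193); (3,211); (3,213);
    (3,217); (3,225); (3,227); (3,233); (3,235); (4,215); (4,209); (4,217);
    (3,333); (4,211); (4,203); (3,289); (4,205); (4,233); (4,235); (3,281);
    (3,307); (4,227); (3,283); (3,285); (3,305); (3,351); (4,281); (4,283);
    (3,287); (4,287); (4,289); (3,355); (3,361); (3,367); (3,369); (3,373);
    (3,379); (3,387); (3,405); (4,305); (4,307); (3,491); (4,355); (4,367);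
    (4,361); (3,497); (3,499); (4,373); (3,483); (3,485); (3,493); (3,549);
    (3,551); (3,589); (3,597); (4,481); (4,491); (3,635); (3,631); (3,699);
    (4,379); (3,519); (3,527); (3,517); (4,499); (3,495); (4,497); (4,523);
    (3,529); (3,591); (4,485); (3,503); (4,595); (4,611); (3,761); (3,817);
    (4,563)]
  76 918 2770 1366 2008 2127.

Lemma cert_15_ok : certified cert_15.
Proof. by vm_cast_no_check (erefl true). Qed.

Lemma pentD_15 x d : 2008 <= x -> d = 0 \/ d = 4 ->
  pentD_size 15 (6 * x + d)%num.
Proof.
apply: (certified_pentD cert_15_ok).
  apply: in_consP; first exact pent_15_222.
  apply: in_consP; first exact pent_15_234.
  apply: in_consP; first exact pent_15_246.
  apply: in_consP; first exact pent_15_258.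
  apply: in_consP; first exact pent_15_270.
  apply: in_consP; first exact pent_15_366.
  apply: in_consP; last by []; exact pent_15_378.
apply: in_consP; last by []; exact pent_15_460.
Qed.

Definition cert_19 : certificate := Certificate 2
  [:: 229; 237; 241; 247] [:: 234]
  [::
    (3,229); (3,237); (3,241); (3,247); (4,229); (4,241); (4,247); (3,687);
    (3,711); (3,723); (3,741); (3,1145); (3,1153); (3,1163); (3,1193);
    (3,1201); (3,1211); (3,1225); (3,1235); (3,1157); (3,1217); (3,1205);
    (3,1229); (4,1153); (4,1201); (4,1157); (4,1225); (4,1229); (4,1145);
    (4,1193); (3,1651); (3,1699); (4,1211); (4,1235); (4,1163); (4,1205);
    (4,1217); (3,1675); (3,2061); (3,2133); (3,2223); (4,1651); (3,2169);
    (4,1699); (4,1675); (3,2977); (3,3093); (3,3201); (3,3019); (3,3151);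
    (3,2985); (3,3061); (3,3211); (3,3021); (3,3111); (3,2989); (3,3171);
    (3,3009); (3,3067); (3,3205); (3,3109); (4,3043); (4,3073); (4,2977);
    (4,3001); (3,2995); (4,3019); (3,3117); (3,3183); (3,3039); (3,3705);
    (3,3081); (3,3579); (4,3097); (4,3061); (4,3151); (4,3187); (3,3471);
    (3,3651); (4,3121); (3,3615); (4,2989); (4,3031); (3,3489); (3,3459);
    (4,3163); (3,3675); (3,3013); (4,3013); (4,3049); (4,3085); (4,3133);
    (3,3175); (4,3205); (3,3435); (3,3633); (3,3687); (3,3043); (3,3091);
    (4,3109); (3,3147); (4,3175); (4,2995); (4,3025); (3,3031); (3,3057);
    (4,3067); (3,3187); (3,3603); (3,4407); (3,4437); (3,3001); (3,3103);
    (3,3129); (4,3139); (4,3193); (3,4383); (3,3049); (4,3091); (4,3103);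
    (4,3115); (3,3121); (4,3127); (3,3133); (3,3157); (4,3157); (3,3181);
    (4,3181); (3,3193); (3,4363); (3,4395); (3,4411); (3,4413); (3,4419);
    (3,4431); (3,4563); (3,4405); (3,4693); (3,4369); (3,4449); (3,4435);
    (3,4441); (3,4467); (3,4503); (3,4575); (3,4865); (3,4889); (3,5375);
    (3,5393); (4,4597); (4,4387); (3,6423); (3,6615); (4,4507); (3,5545);
    (3,5129); (3,6263); (4,4693); (4,4531); (4,6905); (4,5791); (4,5299);
    (4,6803); (4,5041); (4,5821); (4,10339); (4,8419); (4,8563); (4,10603)]
  [::
    (3,229); (4,229); (3,237); (3,241); (3,247); (4,241); (4,247); (3,687);
    (3,711); (3,723); (3,741); (3,1145); (3,1153); (3,1157); (3,1163);
    (3,1193); (3,1201); (3,1205); (3,1211); (3,1217); (3,1225); (3,1229);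
    (3,1235); (4,1145); (4,1153); (4,1157); (4,1193); (4,1201); (4,1205);
    (4,1217); (4,1225); (4,1229); (4,1163); (4,1235); (4,1211); (3,1651);
    (3,1675); (3,1699); (3,2061); (3,2133); (3,2223); (4,1651); (3,2169);
    (4,1699); (4,1675); (3,2977); (3,3009); (3,3111); (3,3181); (3,3061);
    (3,3183); (3,2995); (3,3117); (3,3139); (3,3039); (3,3201); (3,2989);
    (3,3211); (3,3091); (3,3151); (3,3021); (3,3205); (3,3067); (3,3081);
    (3,3019); (3,3171); (4,2977); (3,2985); (4,3001); (4,3025); (4,3049);
    (4,3073); (3,3109); (4,2989); (4,3013); (4,3061); (4,3133); (3,3603);
    (3,3013); (4,3043); (4,3085); (3,3093); (4,3097); (4,3109); (4,3121);
    (3,3147); (3,3435); (3,3471); (3,3489); (3,3633); (3,3651); (3,3687);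
    (3,3705); (4,3031); (3,3043); (3,3057); (3,3103); (3,3163); (3,3187);
    (3,3459); (3,3579); (3,3615); (3,3675); (4,2995); (4,3019); (3,3031);
    (4,3067); (4,3091); (4,3103); (4,3115); (4,3127); (3,3129); (4,3139);
    (3,3193); (3,3001); (3,3049); (3,3121); (3,3127); (3,3133); (4,3151);
    (3,3157); (3,3175); (4,3187)]
  247 18544 55648 13969 112318 0.

Lemma cert_19_ok : certified cert_19.
Proof. by vm_cast_no_check (erefl true). Qed.

Lemma pentD_19 x d : 112318 <= x -> d = 0 \/ d = 2 ->
  pentD_size 19 (6 * x + d)%num.
Proof.
apply: (certified_pentD cert_19_ok).
  apply: in_consP; first exact pent_19_1374.
  apply: in_consP; first exact pent_19_1422.
  apply: in_consP; first exact pent_19_1446.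
  apply: in_consP; last by []; exact pent_19_1482.
apply: in_consP; last by []; exact pent_19_1406.
Qed.

(** Since 7 is 1 modulo 6, inflation by 7 keeps residues modulo 6: systems for w = 3 on 30, 42, ...
    points give multiples of 6, and those on 34, 46 and 58 points give the seeds of class 4. *)
Definition cert_21 : certificate := Certificate 4
  [:: 35; 49; 63; 77; 91; 79; 97] [:: 39; 53; 67]
  [::
    (3,35); (3,49); (4,35); (4,49); (3,77); (3,79); (3,63); (3,97); (3,105);
    (4,79); (4,77); (4,97); (4,91); (3,91); (3,147); (3,175); (3,189);
    (3,203); (3,217); (3,237); (4,175); (3,291); (3,231); (3,275); (3,245);
    (3,287); (4,203); (4,217); (4,245); (3,259); (3,273); (3,293); (3,301);
    (3,315); (3,343); (3,391); (3,395); (3,431); (4,301); (3,371); (3,357);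
    (4,259); (4,365); (3,497); (3,467); (4,445); (4,377); (4,451); (4,539);
    (4,601); (4,467); (4,763); (4,637)]
  [::
    (3,35); (4,35); (3,49); (3,63); (4,49); (3,77); (3,79); (3,91); (3,97);
    (4,79); (3,105); (4,77); (4,97); (4,91); (3,147); (3,175); (3,237);
    (3,189); (3,203); (3,275); (4,175); (3,291); (3,231); (3,217); (3,245);
    (3,259); (4,203); (4,217); (4,275); (3,293); (3,351); (3,395); (4,259);
    (3,431); (3,387); (3,377); (3,423); (3,405); (4,287); (3,287); (3,315);
    (3,365); (3,427); (3,451); (3,273); (3,391); (3,437); (4,377); (4,371);
    (4,451); (4,379); (3,467); (3,493); (3,443); (4,467); (4,395); (4,391);
    (4,563); (4,511); (4,463); (3,751); (4,421); (4,721); (4,647)]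
  97 1308 3940 1078 2340 2677.

Lemma cert_21_ok : certified cert_21.
Proof. by vm_cast_no_check (erefl true). Qed.

Lemma pentD_21 x d : 2340 <= x -> d = 0 \/ d = 4 ->
  pentD_size 21 (6 * x + d)%num.
Proof.
apply: (certified_pentD cert_21_ok).
  apply: in_consP; first exact (pent_inflate7 pent_3_30 isT).
  apply: in_consP; first exact (pent_inflate7 pent_3_42 isT).
  apply: in_consP; first exact (pent_inflate7 pent_3_54 isT).
  apply: in_consP; first exact (pent_inflate7 pent_3_66 isT).
  apply: in_consP; first exact (pent_inflate7 pent_3_78 isT).
  apply: in_consP; first exact pent_21_474.
  apply: in_consP; last by []; exact pent_21_582.
apply: in_consP; first exact (pent4_pent (pent_inflate7 pent_3_34 isT)).
apply: in_consP; first exact (pent4_pent (pent_inflate7 pent_3_46 isT)).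
apply: in_consP; last by []; exact (pent4_pent (pent_inflate7 pent_3_58 isT)).
Qed.

Definition cert_25 : certificate := Certificate 2
  [:: 397; 399; 403; 409] [:: 404]
  [::
    (3,397); (3,399); (3,403); (3,409); (4,397); (4,403); (4,409); (3,1191);
    (3,1197); (3,1209); (3,1227); (3,1985); (3,1991); (3,1997); (3,2009);
    (3,2015); (3,2021); (3,2033); (3,2039); (3,2045); (3,1987); (3,2011);
    (3,2035); (4,2035); (4,1987); (4,2011); (4,2045); (4,1985); (4,2021);
    (4,2009); (4,1997); (4,2033); (4,1991); (4,2015); (4,2039); (3,2827);
    (3,2833); (3,3573); (3,3681); (3,3627); (3,3591); (4,2827); (4,2833);
    (3,5163); (3,5289); (3,5221); (3,5317); (3,5179); (3,5253); (3,5307);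
    (3,5187); (3,5275); (3,5161); (3,5199); (3,5311); (3,5991); (3,5955);
    (3,6135); (4,5317); (3,5169); (4,5221); (4,5161); (4,5179); (4,5197);
    (4,5239); (4,5257); (4,5275); (3,5277); (4,5293); (3,6033); (3,6099);
    (3,5961); (3,6063); (3,5181); (4,5209); (4,5305); (3,6105); (3,5223);
    (3,5973); (3,5203); (3,6027); (3,5293); (3,6045); (4,5167); (4,5185);
    (3,5217); (4,5227); (3,5235); (4,5245); (4,5263); (4,5281); (3,6117);
    (3,5271); (3,5305); (3,5167); (4,5173); (4,5191); (4,5203); (4,5215);
    (4,5233); (4,5251); (4,5269); (3,5287); (4,5287); (4,5299); (4,5311);
    (3,5173); (3,5191); (3,5197); (3,5257); (3,5185); (3,5299); (3,5209);
    (3,5233); (3,5239); (3,5251); (3,8373); (3,7765); (3,7587); (3,7681);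
    (3,7545); (3,7635); (3,7659); (3,7725); (3,7563); (3,8439); (3,7717);
    (3,8443); (3,7741); (3,7701); (3,8347); (3,8433); (3,7573); (3,7771);
    (3,8445); (3,8539); (3,8343); (3,7569); (3,7671); (3,7743); (3,7621);
    (3,7657); (3,7761); (3,8487); (3,7599); (3,8349); (3,8435); (3,7623);
    (3,7695); (3,7705); (3,8385); (3,8531); (3,7543); (3,7551); (3,7581);
    (3,7629); (3,7731); (3,8391); (3,8441); (3,8453); (3,8459); (3,8483);
    (3,8529); (3,8555); (3,8579); (3,5215); (3,5269); (3,7585); (3,7641);
    (3,7675); (3,7723); (3,7759); (3,8339); (3,8387); (3,8447); (3,8457);
    (3,8463); (3,8469); (3,8481); (3,8493); (3,8537); (3,9131); (3,5227);
    (3,5263); (3,5281); (3,7557); (3,7561); (3,7579); (3,7615); (3,7633);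
    (3,7645); (3,7651); (3,7687); (3,7689); (3,7713); (3,7735); (3,7747);
    (3,8363); (3,8367); (3,8397); (3,8535); (3,8541); (3,8543); (3,8549);
    (3,8553); (3,8559); (3,8565); (3,9137); (3,9155); (3,9173); (3,9191);
    (3,9245); (3,9263); (3,7591); (3,7597); (3,7603); (3,7617); (3,7639);
    (3,7653); (3,7669); (3,7707); (3,7711); (3,7729); (3,7753); (3,8337);
    (3,8345); (3,8351); (3,8357); (3,8361); (3,8577); (3,8583); (3,8589);
    (3,9145); (3,9149); (3,9167); (3,9359); (3,9365); (3,9383); (3,9389);
    (3,10017); (3,10107); (4,7543); (4,8443); (4,8357); (4,7669); (3,11861);
    (4,8483); (4,9253); (4,9139); (4,8435); (4,10079); (3,10719); (4,7771);
    (4,7633); (4,8453); (3,9337); (4,7687); (4,8387); (3,11707); (4,8459);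
    (3,9241); (3,9235); (3,9331); (4,7681); (4,8339); (4,9271); (4,7597);
    (4,8531); (3,9271); (3,10917); (4,7651); (3,10141); (3,9233); (3,9293);
    (4,10031); (4,10055); (3,10225); (3,10893); (4,9241); (3,11765); (4,7591);
    (4,7675); (3,9269); (3,9275); (3,9281); (3,12499); (4,11671); (4,11783);
    (4,10973); (3,14857); (4,13303); (4,17113); (3,22225); (4,14113);
    (4,16439); (4,25627); (4,21593); (4,25633); (4,26093)]
  [::
    (3,397); (4,397); (3,399); (3,403); (4,403); (3,409); (4,409); (3,1191);
    (3,1197); (3,1209); (3,1227); (3,1985); (3,1987); (3,1991); (3,1997);
    (3,2009); (3,2011); (3,2015); (3,2021); (3,2033); (3,2035); (3,2039);
    (3,2045); (4,1985); (4,1987); (4,2011); (4,2035); (4,2033); (4,2009);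
    (4,2039); (4,1991); (4,1997); (4,2015); (4,2021); (4,2045); (3,2827);
    (3,2833); (3,3573); (3,3681); (3,3591); (4,2827); (4,2833); (3,3627);
    (3,5163); (3,5203); (3,5235); (3,5307); (3,5275); (3,5161); (3,5317);
    (3,5277); (3,5187); (3,5245); (3,5181); (3,5289); (3,5311); (3,5223);
    (3,5169); (4,5239); (4,5161); (3,5167); (4,5179); (4,5197); (4,5215);
    (4,5257); (4,5275); (4,5293); (4,5311); (3,5191); (3,5305); (4,5221);
    (4,5245); (4,5317); (3,6063); (4,5167); (4,5173); (4,5185); (4,5191);
    (4,5203); (4,5209); (3,5217); (4,5227); (4,5233); (4,5251); (3,5253);
    (4,5263); (4,5269); (3,5271); (4,5281); (4,5287); (4,5299); (4,5305);
    (3,5955); (3,5961); (3,5973); (3,5991); (3,6027); (3,6033); (3,6045);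
    (3,6099); (3,6105); (3,6117); (3,6135); (3,5197); (3,5199); (3,5287);
    (3,5293); (3,5185); (3,5221); (3,5173); (3,5209); (3,5233); (3,5239);
    (3,5251); (3,5257); (3,5299); (4,8443)]
  409 45652 136972 34171 736484 0.

Lemma cert_25_ok : certified cert_25.
Proof. by vm_cast_no_check (erefl true). Qed.

Lemma pentD_25 x d : 736484 <= x -> d = 0 \/ d = 2 ->
  pentD_size 25 (6 * x + d)%num.
Proof.
apply: (certified_pentD cert_25_ok).
  apply: in_consP; first exact pent_25_2382.
  apply: in_consP; first exact pent_25_2394.
  apply: in_consP; first exact pent_25_2418.
  apply: in_consP; last by []; exact pent_25_2454.
apply: in_consP; last by []; exact pent_25_2426.
Qed.

(** Inflation by 9 turns every even size into a multiple of 6. Both classes for w = 3 thus feed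
    class 0, but class 4 cannot be seeded in this way and needs the system on 1732 points. *)
Definition cert_27 : certificate := Certificate 4
  [:: 45; 51; 63; 69; 81; 87; 99; 105; 139; 143; 149; 151] [:: 288]
  [::
    (3,45); (3,51); (3,63); (3,69); (3,81); (3,87); (3,99); (3,105); (3,143);
    (3,135); (3,139); (3,149); (3,151); (3,153); (4,139); (4,143); (4,151);
    (3,189); (4,149); (3,207); (3,243); (3,315); (3,297); (3,261); (3,405);
    (3,417); (3,513); (3,429); (3,483); (3,447); (3,453); (3,459); (3,495);
    (3,501); (3,519); (3,477); (3,607); (3,567); (3,585); (3,603); (3,695);
    (3,709); (3,717); (3,729); (4,709); (3,815); (3,951); (4,607); (4,617);
    (3,623); (4,839); (4,755); (4,647); (4,1111); (4,911)]
  [::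
    (4,139); (4,143); (3,149); (4,149); (3,151); (4,151); (3,153); (3,189);
    (3,207); (3,243); (3,261); (3,297); (3,315); (3,429); (3,447); (3,405);
    (3,417); (3,453); (3,459); (3,477); (3,483); (3,495); (3,501); (3,513);
    (3,519); (3,567); (3,585); (3,591); (3,597); (3,601); (3,603); (3,607);
    (3,609); (3,615); (3,617); (3,619); (3,621); (3,623); (3,625); (3,627);
    (3,633); (3,667); (3,647); (3,653); (3,695); (3,665); (3,685); (3,691);
    (3,715); (3,717); (3,729); (4,601); (3,671); (3,705); (3,735); (3,741);
    (3,747); (3,785); (4,607); (3,643); (3,673); (3,755); (3,779); (3,783);
    (4,619); (3,637); (3,661); (3,693); (3,703); (3,723); (3,743); (3,745);
    (3,765); (4,635); (3,639); (3,641); (3,651); (3,663); (3,675); (3,681);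
    (3,699); (3,709); (3,711); (3,721); (3,749); (3,753); (3,771); (3,789);
    (3,793); (3,803); (4,617); (4,625); (3,645); (3,649); (3,669); (3,687);
    (3,725); (3,731); (3,761); (3,799); (3,807); (3,811); (3,843); (4,623);
    (3,635); (4,637); (4,641); (4,643); (4,647); (4,649); (4,653); (3,655);
    (4,655); (3,657); (3,659); (4,659); (4,661); (4,665); (4,667); (4,671);
    (4,673); (3,677); (4,677); (3,683); (4,683); (4,685); (4,691); (4,695);
    (3,701); (4,701); (4,703); (3,707); (4,707); (4,709); (4,715); (4,721);
    (4,725); (4,731); (3,739); (4,739); (4,743); (4,745); (3,757); (3,763);
    (3,801); (3,815); (3,817); (3,819); (3,825); (3,833); (3,837); (3,839);
    (3,847); (3,853); (3,855); (3,857); (3,861); (3,865); (3,869); (3,871);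
    (3,873); (3,879); (3,887); (3,891); (3,893); (3,897); (3,901); (3,909);
    (3,911); (3,915); (3,919); (3,927); (3,933); (3,945); (3,951); (3,963);
    (3,969); (3,981); (3,987); (3,1025); (3,1015); (3,1031); (3,1021);
    (4,755); (4,779); (4,785); (4,793); (4,763); (3,1017); (4,799); (3,1003);
    (4,761); (4,803); (4,815); (4,817); (4,833); (4,853); (4,901); (4,919);
    (3,1013); (3,1095); (4,757); (4,839); (4,847); (4,857); (4,869); (4,871);
    (4,887); (4,911); (4,1003); (4,1007); (3,1239); (3,1283); (3,1323);
    (3,1347); (4,811); (4,865); (4,893); (3,999); (3,1005); (4,1009);
    (4,1015); (4,1021); (3,1035); (3,1053); (3,1059); (3,1107); (3,1121);
    (3,1187); (3,1233); (3,1241); (3,1251); (3,1273); (3,1275); (3,1277);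
    (4,749); (3,1001); (4,1001); (3,1007); (3,1009); (4,1013); (3,1023);
    (4,1025); (4,1031); (3,1033); (4,1033); (3,1041); (3,1071); (3,1077);
    (3,1089); (3,1111); (3,1113); (3,1115); (4,1115); (3,1123); (4,1123);
    (3,1125); (3,1129); (3,1131); (3,1133); (3,1139); (4,1139); (3,1141);
    (3,1143); (3,1149); (3,1161); (3,1165); (3,1167); (3,1169); (3,1175);
    (3,1177); (3,1179); (3,1183); (3,1185); (3,1191); (3,1193); (3,1195);
    (3,1197); (3,1203); (3,1209); (3,1215); (3,1219); (3,1221); (3,1223);
    (3,1229); (3,1231); (3,1237); (3,1245); (3,1247); (3,1249); (3,1257);
    (3,1263); (3,1269); (3,1281); (3,1285); (3,1287); (3,1291); (3,1293);
    (3,1295); (3,1299); (3,1301); (3,1303); (3,1305); (3,1311); (3,1327);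
    (3,1329); (3,1331); (3,1337); (3,1339); (3,1341); (3,1345); (3,1349);
    (3,1353); (3,1355); (3,1357); (3,1359); (3,1365); (3,1371); (3,1377);
    (3,1381); (3,1383); (3,1385); (3,1389); (3,1391); (3,1393); (3,1395);
    (3,1399); (3,1401); (3,1403); (3,1407); (3,1409); (3,1411); (3,1413);
    (3,1419); (3,1425); (3,1431); (3,1435); (3,1437); (3,1439); (3,1443);
    (3,1445); (3,1447); (3,1449); (3,1451); (3,1455); (3,1457); (3,1459);
    (3,1461); (3,1463); (3,1467); (3,1469); (3,1471); (3,1473); (3,1477);
    (3,1479); (3,1481); (3,1483); (3,1485); (3,1489); (3,1491); (3,1493);
    (3,1497); (3,1499); (3,1501); (3,1503); (3,1505); (3,1509); (3,1511);
    (3,1513); (3,1515); (3,1517); (3,1521); (3,1523); (3,1525); (3,1527);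
    (3,1531); (3,1533); (3,1539); (3,1547); (3,1549); (3,1551); (4,1435);
    (4,1463); (3,1925); (3,1815); (3,1991); (4,1249); (3,2347); (3,2305);
    (4,1223); (3,1821)]
  288 1847 5557 3315 5505 4460.

Lemma cert_27_ok : certified cert_27.
Proof. by vm_cast_no_check (erefl true). Qed.

Lemma pentD_27 x d : 5505 <= x -> d = 0 \/ d = 4 ->
  pentD_size 27 (6 * x + d)%num.
Proof.
apply: (certified_pentD cert_27_ok).
  apply: in_consP; first exact (pent_inflate9 pent_3_30 isT).
  apply: in_consP; first exact (pent_inflate9 pent_3_34 isT).
  apply: in_consP; first exact (pent_inflate9 pent_3_42 isT).
  apply: in_consP; first exact (pent_inflate9 pent_3_46 isT).
  apply: in_consP; first exact (pent_inflate9 pent_3_54 isT).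
  apply: in_consP; first exact (pent_inflate9 pent_3_58 isT).
  apply: in_consP; first exact (pent_inflate9 pent_3_66 isT).
  apply: in_consP; first exact (pent_inflate9 pent_3_70 isT).
  apply: in_consP; first exact pent_27_834.
  apply: in_consP; first exact pent_27_858.
  apply: in_consP; first exact pent_27_894.
  apply: in_consP; last by []; exact pent_27_906.
apply: in_consP; last by []; exact pent_27_1732.
Qed.

Definition cert_33 : certificate := Certificate 4
  [:: 211; 241; 251; 271] [:: 484]
  [::
    (3,211); (3,241); (3,251); (3,271); (4,211); (4,241); (4,271); (4,251);
    (3,633); (3,723); (3,753); (3,813); (3,1055); (3,1175); (3,1085);
    (3,1245); (3,1095); (3,1295); (3,1205); (3,1115); (3,1325); (3,1355);
    (4,1055); (4,1085); (3,1215); (3,1275); (3,1235); (3,1255); (3,1335);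
    (4,1255); (3,1597); (3,1899); (4,1115); (4,1355); (3,1717); (4,1175);
    (4,1295); (3,1837); (4,1235); (4,1205); (3,1727); (4,1325); (3,1807);
    (3,1637); (4,1637); (4,1597); (3,2169); (3,2439); (4,1727); (3,2773);
    (4,1837); (3,2743); (3,2873); (4,1807); (3,2259); (3,2923); (3,2783);
    (4,1717); (3,2833); (3,3165); (3,2983); (3,3255); (3,3345); (3,2863);
    (3,2953); (3,3043); (3,3285); (3,2803); (3,2893); (3,3013); (3,3053);
    (3,3323); (4,2783); (3,3523); (3,3193); (4,3053); (4,2903); (4,3173);
    (4,2963); (3,3143); (4,3233); (3,3503); (4,2873); (4,3143); (4,2743);
    (3,3133); (4,2983); (3,4005); (4,3073); (3,3173); (4,3283); (4,2893);
    (4,3163); (3,3313); (3,3073); (4,3223); (4,3343); (3,3615); (3,4065);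
    (4,3013); (3,3103); (4,3263); (3,3885); (4,2833); (3,2903); (4,3103);
    (3,3525); (3,4009); (4,2923); (3,3373); (3,3443); (3,3735); (3,4039);
    (4,2803); (3,2963); (3,3163); (3,3233); (4,3323); (3,3975); (3,4069);
    (3,4499); (3,3253); (3,3283); (3,3343); (3,3403); (4,3403); (3,3413);
    (3,3433); (3,3463); (3,3493); (4,3523); (3,3645); (3,3705); (3,3765);
    (3,3825); (3,4139); (3,4319); (3,4399); (3,4589); (3,4731); (4,4169);
    (3,5275); (3,4889); (4,3043); (4,2953); (4,3413); (4,4219); (3,5513);
    (4,5059); (4,4951); (3,7139); (3,6345); (4,4589); (4,4711); (3,7017);
    (3,5615); (4,7561); (4,6215); (4,6655); (4,7003); (4,5425); (4,7571);
    (4,10777); (4,8987); (4,10781)]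
  [::
    (4,211); (4,241); (3,251); (4,251); (3,271); (4,271); (3,633); (3,723);
    (3,753); (3,813); (3,1055); (3,1085); (3,1115); (3,1175); (3,1205);
    (3,1235); (3,1295); (3,1325); (3,1355); (3,1245); (4,1055); (3,1095);
    (3,1215); (3,1255); (3,1335); (3,1275); (4,1085); (4,1115); (4,1175);
    (4,1205); (4,1235); (4,1255); (3,1597); (3,1637); (4,1325); (3,1727);
    (3,1837); (4,1355); (3,1899); (4,1295); (4,1637); (3,2169); (3,2259);
    (4,1597); (3,1717); (4,1727); (3,1807); (4,1717); (4,1807); (4,1837);
    (3,2439); (3,2743); (3,2773); (3,2873); (3,2803); (3,2783); (3,2923);
    (3,3073); (3,3233); (3,2903); (3,2953); (3,3313); (3,2833); (3,3165);
    (3,3255); (3,3285); (3,3345); (3,3433); (3,3493); (3,3525); (4,2743);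
    (3,2863); (3,2893); (3,3043); (3,3503); (3,3615); (3,3645); (4,2773);
    (3,3013); (3,3053); (3,3373); (3,3523); (4,2783); (3,2963); (3,3133);
    (3,3163); (3,3193); (3,3253); (3,3283); (3,3403); (3,3413); (4,2803);
    (3,2983); (3,3103); (3,3143); (3,3173); (3,3223); (3,3323); (3,3343);
    (3,3443); (3,3463); (3,3705); (3,3735); (3,3975); (4,3053); (3,4039);
    (4,3073); (4,2903); (4,3343); (3,4319); (3,4065); (3,4069); (3,4005);
    (4,2923); (4,3263); (4,3133); (3,4679); (4,2873); (3,4139); (3,3825);
    (3,4491); (4,3193); (4,2963); (4,3463); (4,3143); (4,2983); (3,4349);
    (3,4159); (4,2953); (4,3173); (3,3885); (3,4471); (4,3013); (4,3523);
    (3,3765); (3,4519); (3,4949); (4,3043); (4,3253); (4,3413); (3,4009);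
    (4,2833); (4,3233); (4,3323); (4,3503); (3,4431); (3,4589); (4,3223);
    (3,3263); (4,3403); (4,4049); (4,2863); (4,2893); (4,3103); (4,3163);
    (3,4289); (3,4399); (3,5069); (3,5455); (3,5575); (4,3283); (4,3493);
    (4,4009); (3,4049); (3,4499); (3,5513); (3,5695); (4,3313); (4,3373);
    (4,3433); (4,3443); (4,4039); (3,4099); (4,4169); (3,4229); (3,4279);
    (3,4409); (3,4591); (3,4639); (3,4759); (3,4879); (3,4941); (3,4999);
    (3,5129); (3,5633); (4,4069); (4,4099); (3,4169); (4,4229); (4,4259);
    (4,4289); (3,4461); (4,4471); (3,4611); (3,4711); (3,4859); (3,4951);
    (3,5039); (3,5071); (3,5119); (3,5149); (3,5191); (3,5231); (3,5273);
    (3,5275); (3,5291); (3,5365); (3,5405); (3,5431); (3,5551); (3,5661);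
    (3,5671); (3,5753); (3,5697); (3,5743); (4,5261); (3,5955); (3,4853);
    (4,4591); (3,6173); (3,5213); (3,5033); (3,6385); (4,4409); (3,5333);
    (3,6233); (3,6581); (3,5855); (4,4711); (3,4829); (4,4649); (4,4139);
    (3,5091); (3,5541); (3,5543); (4,4349); (3,5093); (4,5653); (3,4549);
    (3,4943); (4,4951); (3,6113); (3,7183); (4,4739); (4,5231); (3,5315);
    (3,5833); (3,6085); (3,4709); (3,4939); (3,4973); (3,5009); (3,5153);
    (3,5965); (3,5993); (3,6239); (3,6671); (3,7023); (4,4129); (3,4219);
    (4,4429); (3,4459); (3,4529); (3,4579); (3,4649); (3,4769); (3,4799);
    (4,4859); (3,5061); (3,5391); (3,5725); (4,4189); (4,4219); (4,4319);
    (3,4369); (3,4429); (3,4489); (3,4609); (3,4619); (3,4669); (3,4699);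
    (3,4729); (4,4729); (3,4739); (3,4789); (3,4819); (3,4849); (3,4889);
    (4,4943); (3,4969); (3,4979); (3,5029); (3,5031); (3,5059); (3,5063);
    (4,5071); (3,5181); (3,5211); (4,5291); (3,5335); (4,5365); (4,5431);
    (4,5551); (3,5845); (3,5885); (3,5945); (3,6571); (3,6745); (4,5995);
    (4,6187); (4,6053); (3,7561); (4,6155); (4,5543); (3,7931); (4,5695);
    (3,5933); (4,8977); (4,7603); (4,7027); (4,8543); (4,6941); (4,9005);
    (4,7109); (4,6215); (4,9997); (4,9371)]
  484 18850 56566 13351 40131 29785.

Lemma cert_33_ok : certified cert_33.
Proof. by vm_cast_no_check (erefl true). Qed.

Lemma pentD_33 x d : 40131 <= x -> d = 0 \/ d = 4 ->
  pentD_size 33 (6 * x + d)%num.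
Proof.
apply: (certified_pentD cert_33_ok).
  apply: in_consP; first exact pent_33_1266.
  apply: in_consP; first exact pent_33_1446.
  apply: in_consP; first exact pent_33_1506.
  apply: in_consP; last by []; exact pent_33_1626.
apply: in_consP; last by []; exact pent_33_2908.
Qed.

Definition cert_39 : certificate := Certificate 4
  [:: 65; 91; 117; 143; 273; 301] [:: 73]
  [::
    (4,65); (3,91); (3,65); (4,91); (3,117); (3,143); (3,195); (4,143);
    (3,301); (3,273); (3,325); (4,301); (3,351); (3,377); (3,403); (4,403);
    (4,325); (3,455); (4,377); (3,429); (4,455); (3,481); (4,481); (3,507);
    (3,559); (3,585); (3,637); (3,663); (3,903); (3,689); (3,873); (4,559);
    (3,715); (4,637); (3,767); (3,819); (3,845); (4,689); (4,715); (4,767);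
    (3,871); (3,897); (3,923); (3,949); (3,975); (3,1163); (3,1269); (3,1183);
    (3,1505); (4,845); (4,949); (3,1215); (4,871); (3,1189); (3,1321);
    (3,1053); (3,1079); (3,1105); (3,1131); (3,1157); (3,1209); (3,1241);
    (3,1267); (3,1293); (3,1319); (3,1345); (3,1371); (3,1397); (3,1423);
    (4,923); (4,1079); (4,1105); (4,1157); (4,1183); (3,1235); (3,1261);
    (3,1287); (3,1313); (3,1339); (3,1365); (3,1391); (3,1417); (3,1443);
    (3,1449); (3,1469); (3,1475); (3,1495); (3,1521); (3,1547); (3,1573);
    (3,1599); (4,1505); (3,1601); (4,1163); (4,1399); (4,1321); (3,2077);
    (4,1477); (4,1313); (3,1555); (4,1295); (3,1399); (3,1477); (3,1677);
    (3,1625); (3,1809); (3,1913); (4,1261); (3,1529); (3,1581); (3,1703);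
    (3,1781); (4,1235); (4,1529); (3,1651); (3,1729); (3,1755); (3,1859);
    (3,2411); (4,1703); (4,1685); (4,1601); (3,2709); (4,1397); (4,2077);
    (4,1241); (3,2203); (4,1267); (4,1319); (4,1913); (3,2489); (4,1345);
    (4,1423); (4,1573); (3,2093); (3,2145); (3,2197); (3,2249); (4,1189);
    (4,1417); (4,1495); (4,1547); (4,1651); (4,1711); (4,1729); (4,1763);
    (4,1789); (3,1885); (3,1911); (3,1937); (3,1963); (3,1989); (3,2015);
    (3,2041); (3,2119); (3,2171); (3,2223); (3,2225); (3,2251); (3,2275);
    (3,2301); (3,2329); (3,2353); (3,2381); (3,2407); (3,2515); (3,2619);
    (3,2645); (3,2671); (3,2697); (3,2723); (3,3703); (4,2489); (4,2407);
    (3,3587); (3,2969); (4,3733); (4,3437); (4,3823); (4,2723); (4,5603);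
    (3,6837); (4,3925); (4,6683)]
  [::
    (3,65); (4,65); (3,91); (4,91); (3,117); (3,143); (4,143); (3,195);
    (3,273); (3,301); (3,325); (3,351); (3,377); (4,301); (4,325); (3,403);
    (4,377); (4,403); (3,429); (3,455); (3,481); (3,507); (4,455); (3,715);
    (3,585); (4,481); (3,559); (3,663); (3,873); (3,903); (4,637); (3,819);
    (4,559); (4,689); (3,871); (3,1269); (3,689); (3,1163); (3,1189); (4,715);
    (4,767); (3,845); (3,1215); (3,1241); (3,637); (3,767); (3,897); (3,923);
    (3,949); (3,975); (3,1267); (3,1295); (4,923); (3,1505); (3,1601);
    (3,1313); (3,1131); (4,1295); (4,949); (3,1469); (4,871); (4,1079);
    (3,1347); (4,845); (4,1105); (3,1399); (3,1287); (3,1321); (3,1053);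
    (4,1163); (3,1105); (3,1293); (3,1521); (3,1599); (3,1235); (3,1365);
    (3,1079); (3,1157); (3,1391); (4,1189); (3,1209); (4,1241); (3,1261);
    (4,1321); (3,1423); (3,1449); (4,1505); (3,1183); (4,1183); (4,1235);
    (4,1267); (3,1339); (3,1371); (3,1397); (3,1417); (3,1477); (4,1601);
    (4,1391); (4,1397); (3,2203); (3,2077); (3,1913); (3,2709); (4,1345);
    (3,1809); (4,1319); (4,1477); (3,1833); (3,1919); (4,1157); (3,1703);
    (4,1261); (4,1555); (3,1911); (3,2067); (4,1529); (3,2121); (4,1399);
    (3,1529); (3,1711); (3,1893); (3,2489); (3,1475); (3,1547); (3,1581);
    (3,1625); (3,1971); (3,2251); (3,2697); (3,1677); (3,1789); (3,1885);
    (3,2249); (3,2969); (3,2995); (3,3021); (4,1339); (3,1555); (3,1573);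
    (3,1607); (4,1607); (3,1633); (3,1659); (3,1685); (4,1685); (4,1711);
    (3,1729); (3,1763); (4,1763); (3,1781); (3,1867); (3,1937); (3,1989);
    (3,2023); (3,2041); (3,2093); (3,2145); (3,2225); (3,2407); (3,2645);
    (3,3047); (4,2077); (4,2203); (3,2847); (4,1913); (4,2023); (3,2411);
    (4,1475); (4,1789); (4,1423); (4,1633); (3,2075); (3,2329); (4,2407);
    (3,3073); (3,3099); (3,2485); (4,2485); (4,2075); (3,2173); (4,2173);
    (4,2251); (3,2515); (3,2619); (3,3125); (3,3151); (3,3703); (3,3755);
    (3,3807); (4,3061); (3,4295); (3,4081); (4,3089); (3,3217); (4,2411);
    (4,3265); (4,4609); (4,3973); (4,4457); (4,3613); (4,6065); (4,5531)]
  301 11684 35068 7296 28033 14330.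

Lemma cert_39_ok : certified cert_39.
Proof. by vm_cast_no_check (erefl true). Qed.

Lemma pentD_39 x d : 28033 <= x -> d = 0 \/ d = 4 ->
  pentD_size 39 (6 * x + d)%num.
Proof.
apply: (certified_pentD cert_39_ok).
  apply: in_consP; first exact (pent_inflate13 pent_3_30 isT).
  apply: in_consP; first exact (pent_inflate13 pent_3_42 isT).
  apply: in_consP; first exact (pent_inflate13 pent_3_54 isT).
  apply: in_consP; first exact (pent_inflate13 pent_3_66 isT).
  apply: in_consP; first exact (pent_inflate3 (pent4_pent pent_13_546) isT).
  (* 3 * 602 = 6 * 301: a size of class 2 for w = 13 becomes a multiple of 6. *)
  apply: in_consP; last by []; exact (pent_inflate3 pent_13_602 isT).
apply: in_consP; last by []; exact (pent4_pent (pent_inflate13 pent_3_34 isT)).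
Qed.

Local Close Scope N_scope.

(** v = 2r + w + 1 is even because w is odd. Modulo 3 it is w + 1 if r is 0, and 3 (w + 1) = 0 if r
    is w + 1. Hence v is 0 or c modulo 6, with c = 4 for w = 3 and c = 2 for w = 1 modulo 6. *)
Lemma exists_type_D (w : nat) (rw c X : N) (r : nat) :
  nat_of_bin rw <= r -> admissible 3 w r ->
  (forall x d, (X <= x)%num -> d = 0%num \/ d = c -> pentD_size w (6 * x + d)%num) ->
  [&& 0 < w, (w %% 6 == 3) && (c == 4)%num || (w %% 6 == 1) && (c == 2)%num,
      (0 <? rw)%num & (6 * X <=? 2 * rw + bin_of_nat w + 1)%num] ->
  exists G : partial_linear_space, type_D 3 r w G.
Proof.
move=> rwr adm H /and4P[w0 wc /N.ltb_spec0 rw0 /N.leb_spec0 Xrw]; pose v := (r.*2 + w).+1.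
(* The prime 3 divides r (w + 1 - r), hence one of the factors. *)
have rmod : r %% 3 = 0 \/ r %% 3 = (w + 1) %% 3.
  have : (Posz r * (Posz w + 1 - Posz r))%R \in dvdz 3.
    by apply/dvdz_mod0P; rewrite adm.
  rewrite dvdzE abszM Euclid_dvdM // => /orP[]; first by left; lia.
  by right; lia.
have [T [f [cT fP fK [f4 fD]]]] : pentD_size w v.
  have -> : v = (6 * bin_of_nat (v %/ 6) + bin_of_nat (v %% 6))%num.
    by rewrite /v; lia.
  apply: H; first by rewrite /v; lia.
  have : v %% 6 = 0 \/ v %% 6 = c by rewrite /v; lia.
  by case=> ->; [left|right; rewrite nat_of_binK].
by eexists; apply: (type_D_pls fP) => //; lia.
Qed.

Theorem theorem4p3 (w : nat) (rw : N) (r : nat) :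
  (w, rw) \in [:: (13, 68873%num); (15, 6018%num); (19, 336944%num);
                  (21, 7009%num); (25, 2209439%num); (27, 16503%num);
                  (33, 120378%num); (39, 84079%num)] ->
  nat_of_bin rw <= r -> admissible 3 w r ->
  exists G : partial_linear_space, type_D 3 r w G.
Proof.
rewrite !inE !xpair_eqE.
case/or4P; [..|case/or4P; [..|case/orP]] =>
  /andP[/eqP-> /eqP->] rwr adm.
- exact (exists_type_D rwr adm pentD_13 isT).
- exact (exists_type_D rwr adm pentD_15 isT).
- exact (exists_type_D rwr adm pentD_19 isT).
- exact (exists_type_D rwr adm pentD_21 isT).
- exact (exists_type_D rwr adm pentD_25 isT).
- exact (exists_type_D rwr adm pentD_27 isT).
- exact (exists_type_D rwr adm pentD_33 isT).
exact (exists_type_D rwr adm pentD_39 isT).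
Qed.
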